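(* Let $G$ be a finite group and let $\chi \in \mathrm{Irr}(G)$. Let $B$ be the block of $\mathcal{O}G$ containing $\chi$ and let $L$ be an $\mathcal{O}G$-lattice affording $\chi$. Let $P$ be an anchor of $\chi$ and let $\Delta P = \{(x,x) \mid x\in P\} \leq G\times G$. The following hold. (a) $P$ is contained in a defect group of $B$. (b) $P$ contains a vertex of $L$. (c) $O_p(G)\leq P$. (d) The suborder $\mathcal{O}P e_\chi$ of $\mathcal{O}Ge_\chi$ is local, and $\mathcal{O}Ge_\chi$ is a separable extension of $\mathcal{O}Pe_\chi$. (e) $\Delta P$ is contained in a vertex of the $\mathcal{O}(G\times G)$-module $\mathcal{O}Ge_\chi$, and $P\times P$ contains a vertex of $\mathcal{O}Ge_\chi$. Moreover, $\Delta P$ is a vertex of $\mathcal{O}Ge_\chi$ if and only if $\chi$ is of defect zero.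
   Context: $p$ is a prime, $\mathcal{O}$ is a complete discrete valuation ring with residue field $k=\mathcal{O}/J(\mathcal{O})$ of characteristic $p$ and field of fractions $K$ of characteristic $0$; $K$ and $k$ are assumed to be splitting fields for all finite groups under consideration. $\mathrm{Irr}(G)$ is the set of characters of simple $KG$-modules. For $\chi\in\mathrm{Irr}(G)$, $e_\chi$ is the unique primitive idempotent in $Z(KG)$ with $\chi(e_\chi)\neq 0$. The $\mathcal{O}$-order $\mathcal{O}Ge_\chi\subseteq KGe_\chi$ is an algebra on which $G$ acts by conjugation. For $P\leq G$, $(\mathcal{O}Ge_\chi)^P$ is the subalgebra of $P$-fixed points and $\mathrm{Tr}_P^G:(\mathcal{O}Ge_\chi)^P\to(\mathcal{O}Ge_\chi)^G$, $a\mapsto\sum_{x\in G/P}xax^{-1}$, is the relative trace map. An anchor of $\chi$ is a subgroup $P$ of $G$ that is minimal subject to $e_\chi\in \mathrm{Tr}_P^G((\mathcal{O}Ge_\chi)^P)$, i.e. a defect group of the primitive $G$-interior $\mathcal{O}$-algebra $\mathcal{O}Ge_\chi$; the anchors of $\chi$ form one $G$-conjugacy class of $p$-subgroups of $G$. An $\mathcal{O}G$-lattice is a left $\mathcal{O}G$-module that is free of finite rank over $\mathcal{O}$; $L$ affords $\chi$ if $K\otimes_{\mathcal{O}}L$ has character $\chi$. The block of $\mathcal{O}G$ containing $\chi$ is $\mathcal{O}Gb$, where $b$ is the primitive idempotent of $Z(\mathcal{O}G)$ with $be_\chi=e_\chi$. $O_p(G)$ is the largest normal $p$-subgroup of $G$.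 The group $G\times G$ acts on $\mathcal{O}Ge_\chi$ by $(x,y)\cdot a=xay^{-1}$. $\chi$ is of defect zero if $\chi(1)_p=|G|_p$, where $n_p$ denotes the $p$-part of $n$. An $\mathcal{O}$-order $R$ is a separable extension of a unitary suborder $S$ if the multiplication map $R\otimes_S R\to R$, $x\otimes y\mapsto xy$, splits as a map of $R$-$R$-bimodules. *)

(* Defs.v *)
From HB Require Import structures.
From mathcomp Require Import all_boot all_order all_fingroup all_algebra.
From mathcomp Require Import all_solvable all_character.
From mathcomp Require Import boolp.

Set Implicit Arguments.
Unset Strict Implicit.
Unset Printing Implicit Defensive.

Import GRing.Theory.
Local Open Scope ring_scope.
Local Open Scope quotient_scope.


(* R[gT]: an element a is the formal sum \sum_g a g * g. *)
Definition galg (R : comNzRingType) (gT : finGroupType) := {ffun gT -> R}.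

Section GroupAlgebra.
Variables (R : comNzRingType) (gT : finGroupType).
Local Notation A := (galg R gT).

HB.instance Definition _ := GRing.Lmodule.copy A {ffun gT -> R^o}.

Lemma galg_scaleE (c : R) (a : A) x : (c *: a) x = c * a x.
Proof. exact: ffunE. Qed.

Definition gelt (g : gT) : A := [ffun x => (x == g)%:R : R].

Definition galg_mul (a b : A) : A :=
  [ffun x => \sum_(y : gT) a y * b (y^-1 * x)%g : R].

Lemma galg_mulA : associative galg_mul.
Proof.
move=> a b c; apply/ffunP => x; rewrite !ffunE.
under [RHS]eq_bigr => y _ do rewrite ffunE mulr_suml.
rewrite exchange_big /=; apply: eq_bigr => z _.
rewrite ffunE mulr_sumr (reindex_inj (mulgI z^-1%g)) /=.
by apply: eq_bigr => y _; rewrite mulrA invMg invgK -mulgA mulKVg.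
Qed.

Lemma galg_mul1l : left_id (gelt 1) galg_mul.
Proof.
move=> a; apply/ffunP => x; rewrite ffunE (bigD1 1%g) //= big1 ?addr0.
  by rewrite ffunE eqxx mul1r invg1 mul1g.
by move=> y /negPf y1; rewrite ffunE y1 mul0r.
Qed.

Lemma galg_mul1r : right_id (gelt 1) galg_mul.
Proof.
move=> a; apply/ffunP => x; rewrite ffunE (bigD1 x) //= big1 ?addr0.
  by rewrite ffunE mulVg eqxx mulr1.
by move=> y /negPf yx; rewrite ffunE -eq_mulVg1 yx mulr0.
Qed.

Lemma galg_mulDl : left_distributive galg_mul +%R.
Proof.
move=> a b c; apply/ffunP => x; rewrite !ffunE -big_split.
by apply: eq_bigr => y _; rewrite ffunE mulrDl.
Qed.

Lemma galg_mulDr : right_distributive galg_mul +%R.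
Proof.
move=> a b c; apply/ffunP => x; rewrite !ffunE -big_split.
by apply: eq_bigr => y _; rewrite ffunE mulrDr.
Qed.

Lemma galg_oner_neq0 : gelt 1 != 0.
Proof. by apply/eqP => /ffunP/(_ 1%g)/eqP; rewrite !ffunE eqxx oner_eq0. Qed.

HB.instance Definition _ := GRing.Zmodule_isNzRing.Build A
  galg_mulA galg_mul1l galg_mul1r galg_mulDl galg_mulDr galg_oner_neq0.

Lemma galg_mulE (a b : A) x : (a * b) x = \sum_(y : gT) a y * b (y^-1 * x)%g.
Proof. exact: ffunE. Qed.

Lemma galg_scaleAl (c : R) (a b : A) : c *: (a * b) = (c *: a) * b.
Proof.
apply/ffunP => x; rewrite galg_scaleE !galg_mulE mulr_sumr.
by apply: eq_bigr => y _; rewrite galg_scaleE mulrA.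
Qed.

HB.instance Definition _ := GRing.Lmodule_isLalgebra.Build R A galg_scaleAl.

Lemma galg_scaleAr (c : R) (a b : A) : c *: (a * b) = a * (c *: b).
Proof.
apply/ffunP => x; rewrite galg_scaleE !galg_mulE mulr_sumr.
by apply: eq_bigr => y _; rewrite galg_scaleE mulrCA.
Qed.

HB.instance Definition _ := GRing.Lalgebra_isAlgebra.Build R A galg_scaleAr.

Lemma galg1E : (1 : A) = gelt 1. Proof. by []. Qed.

Lemma geltM g h : gelt (g * h) = gelt g * gelt h.
Proof.
apply/ffunP => x; rewrite galg_mulE ffunE (bigD1 g) //= big1 ?addr0.
  by rewrite !ffunE eqxx mul1r -(inj_eq (mulgI g) _ h) mulKVg.
by move=> y /negPf yg; rewrite ffunE yg mul0r.
Qed.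

Lemma galg_sum (a : A) : a = \sum_g a g *: gelt g.
Proof.
apply/ffunP => x; rewrite sum_ffunE (bigD1 x) //= big1 ?addr0.
  by rewrite galg_scaleE ffunE eqxx mulr1.
by move=> y /negPf yx; rewrite galg_scaleE ffunE eq_sym yx mulr0.
Qed.

(* The R-linear extension to R[gT] of a function on gT. *)
Definition galg_ext (chi : gT -> R) (a : A) : R := \sum_(g : gT) a g * chi g.

End GroupAlgebra.

Section GroupAlgebraMap.
Variables (R R' : comNzRingType) (phi : {rmorphism R -> R'}).
Variables (aT rT : finGroupType) (h : {morphism [set: aT] >-> rT}).

Definition galg_map (a : galg R aT) : galg R' rT :=
  \sum_(g : aT) phi (a g) *: gelt R' (h g).

Lemma galg_map_is_zmod_morphism : zmod_morphism galg_map.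
Proof.
move=> a b; rewrite /galg_map -sumrB; apply: eq_bigr => g _.
by rewrite !ffunE rmorphB scalerBl.
Qed.

Lemma galg_map_is_monoid_morphism : monoid_morphism galg_map.
Proof.
split=> [|a b]; rewrite /galg_map.
  rewrite (bigD1 1%g) //= big1 ?addr0.
    by rewrite galg1E ffunE eqxx rmorph1 scale1r morph1.
  by move=> g /negPf g1; rewrite galg1E ffunE g1 rmorph0 scale0r.
rewrite mulr_suml.
under eq_bigr => g _ do rewrite galg_mulE rmorph_sum scaler_suml.
rewrite exchange_big /=; apply: eq_bigr => y _.
rewrite mulr_sumr (reindex_inj (mulgI y)) /=; apply: eq_bigr => g _.
rewrite mulKg morphM ?inE // geltM rmorphM.
by rewrite -scalerAl -scalerAr scalerA.
Qed.

HB.instance Definition _ :=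
  GRing.isZmodMorphism.Build (galg R aT) (galg R' rT) galg_map
    galg_map_is_zmod_morphism.
HB.instance Definition _ :=
  GRing.isMonoidMorphism.Build (galg R aT) (galg R' rT) galg_map
    galg_map_is_monoid_morphism.

End GroupAlgebraMap.

Lemma galg_map_gelt (R R' : comNzRingType) (phi : {rmorphism R -> R'})
    (aT rT : finGroupType) (h : {morphism [set: aT] >-> rT}) (g : aT) :
  galg_map phi h (gelt R g) = gelt R' (h g).
Proof.
rewrite /galg_map (bigD1 g) //= big1 ?addr0 ?ffunE ?eqxx ?rmorph1 ?scale1r //.
by move=> x /negPf xg; rewrite ffunE xg rmorph0 scale0r.
Qed.


Section CentralIdempotents.
Variable B : nzRingType.

Definition central_idempotent (e : B) :=
  e * e = e /\ (forall x : B, e * x = x * e).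

(* e is a primitive idempotent of the ring Z(B). *)
Definition primitive_central_idempotent (e : B) :=
  [/\ e != 0, central_idempotent e &
      forall e1 e2 : B, central_idempotent e1 -> central_idempotent e2 ->
        e1 * e2 = 0 -> e = e1 + e2 -> e1 = 0 \/ e2 = 0].

Record pcidem := PCIdem {
  pcidem_val : B;
  pcidemP : primitive_central_idempotent pcidem_val }.

Lemma pcidem_idem (e : pcidem) : pcidem_val e * pcidem_val e = pcidem_val e.
Proof. by case: (pcidemP e) => _ []. Qed.

Lemma pcidemC (e : pcidem) (x : B) : pcidem_val e * x = x * pcidem_val e.
Proof. by case: (pcidemP e) => _ [_ ->]. Qed.

Lemma pcidem_neq0 (e : pcidem) : pcidem_val e != 0.
Proof. by case: (pcidemP e). Qed.

End CentralIdempotents.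

Section Corner.
Variables (A B : nzRingType) (f : {rmorphism A -> B}) (e : pcidem B).

Definition corner_pred : {pred B} :=
  fun x : B => `[< exists a : A, x = f a * pcidem_val e >].

Lemma corner_predP x :
  reflect (exists a : A, x = f a * pcidem_val e) (x \in corner_pred).
Proof. exact: asboolP. Qed.

Lemma corner_zmod_closed : zmod_closed corner_pred.
Proof.
split; first by apply/corner_predP; exists 0; rewrite rmorph0 mul0r.
move=> _ _ /corner_predP[a ->] /corner_predP[b ->].
by apply/corner_predP; exists (a - b); rewrite rmorphB mulrBl.
Qed.

HB.instance Definition _ :=
  GRing.isZmodClosed.Build B corner_pred corner_zmod_closed.

(* The subring f(A)e of B; its identity element is e. *)
Record corner := Corner { corner_val : B; cornerP : corner_val \in corner_pred }.

HB.instance Definition _ := [isSub for corner_val].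
HB.instance Definition _ := [Choice of corner by <:].
HB.instance Definition _ := [SubChoice_isSubZmodule of corner by <:].

Lemma corner_elt_subproof (a : A) : f a * pcidem_val e \in corner_pred.
Proof. by apply/corner_predP; exists a. Qed.

Definition corner_elt (a : A) : corner := Corner (corner_elt_subproof a).

Lemma corner_valM_subproof (x y : corner) : corner_val x * corner_val y \in corner_pred.
Proof.
case: x y => [_ /= /corner_predP[a ->]] [_ /= /corner_predP[b ->]].
apply/corner_predP; exists (a * b).
by rewrite rmorphM -mulrA (mulrA (pcidem_val e)) pcidemC -mulrA pcidem_idem mulrA.
Qed.

Definition corner_mul (x y : corner) : corner :=
  Corner (corner_valM_subproof x y).

Lemma corner_mulA : associative corner_mul.
Proof. by move=> x y z; apply: val_inj; rewrite /= mulrA. Qed.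

Lemma corner_mul1l : left_id (corner_elt 1) corner_mul.
Proof.
case=> x xP; apply: val_inj => /=; case/corner_predP: xP => a ->.
by rewrite rmorph1 mul1r pcidemC -mulrA pcidem_idem.
Qed.

Lemma corner_mul1r : right_id (corner_elt 1) corner_mul.
Proof.
case=> x xP; apply: val_inj => /=; case/corner_predP: xP => a ->.
by rewrite rmorph1 mul1r -mulrA pcidem_idem.
Qed.

Lemma corner_mulDl : left_distributive corner_mul +%R.
Proof. by move=> x y z; apply: val_inj; rewrite /= mulrDl. Qed.

Lemma corner_mulDr : right_distributive corner_mul +%R.
Proof. by move=> x y z; apply: val_inj; rewrite /= mulrDr. Qed.

Lemma corner_oner_neq0 : corner_elt 1 != 0.
Proof.
apply/eqP => /(congr1 val) /=; rewrite rmorph1 mul1r => /eqP.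
by rewrite (negPf (pcidem_neq0 e)).
Qed.

HB.instance Definition _ := GRing.Zmodule_isNzRing.Build corner
  corner_mulA corner_mul1l corner_mul1r corner_mulDl corner_mulDr
  corner_oner_neq0.

Lemma corner_val1 : corner_val 1 = pcidem_val e.
Proof. by rewrite /= rmorph1 mul1r. Qed.

Lemma corner_valM (x y : corner) : corner_val (x * y) = corner_val x * corner_val y.
Proof. by []. Qed.

End Corner.

Section CornerInclusion.
Variables (A A' B : nzRingType) (f : {rmorphism A -> B})
  (f' : {rmorphism A' -> B}) (e : pcidem B).
Hypothesis f'f : forall a' : A', exists a : A, f' a' = f a.

Lemma corner_incl_subproof (x : corner f' e) : corner_val x \in corner_pred f e.
Proof.
case: x => _ /= /corner_predP[a' ->]; have [a ->] := f'f a'.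
exact: corner_elt_subproof.
Qed.

Definition corner_incl (x : corner f' e) : corner f e :=
  Corner (corner_incl_subproof x).

Lemma corner_incl_is_zmod_morphism : zmod_morphism corner_incl.
Proof. by move=> x y; apply: val_inj. Qed.

Lemma corner_incl_is_monoid_morphism : monoid_morphism corner_incl.
Proof.
by split=> [|x y]; apply: val_inj => //=; rewrite !rmorph1.
Qed.

HB.instance Definition _ :=
  GRing.isZmodMorphism.Build (corner f' e) (corner f e) corner_incl
    corner_incl_is_zmod_morphism.
HB.instance Definition _ :=
  GRing.isMonoidMorphism.Build (corner f' e) (corner f e) corner_incl
    corner_incl_is_monoid_morphism.

End CornerInclusion.

Arguments corner_incl {A A' B f f'} e f'f x.


(* A (x)_S V for a ring morphism j : S -> A and a left S-module V.  It is
   realised as formal sums \sum_i a_i (x) v_i, two of them being identified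
   when no S-balanced biadditive map from A x V to an abelian group
   distinguishes them. *)
Section Tensor.
Variables (S A : nzRingType) (j : {rmorphism S -> A}) (V : lmodType S).

Record balanced (Z : zmodType) (F : A -> V -> Z) : Prop := Balanced {
  balancedDl : forall a b v, F (a + b) v = F a v + F b v;
  balancedDr : forall a u v, F a (u + v) = F a u + F a v;
  balancedS : forall a s v, F (a * j s) v = F a (s *: v) }.

Definition fsum (Z : zmodType) (F : A -> V -> Z) (s : seq (A * V)) : Z :=
  \sum_(t <- s) F t.1 t.2.

Definition tensor_equiv (s1 s2 : seq (A * V)) : bool :=
  `[< forall (Z : zmodType) (F : A -> V -> Z),
        balanced F -> fsum F s1 = fsum F s2 >].

Lemma tensor_equiv_is_equiv : equiv_class_of tensor_equiv.
Proof.
split=> [s|s1 s2|s2 s1 s3]; first exact/asboolP.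
  by apply/asboolP/asboolP => E Z F bF; rewrite E.
by move=> /asboolP E1 /asboolP E2; apply/asboolP => Z F bF; rewrite E1 ?E2.
Qed.

Canonical tensor_equiv_equiv := EquivRelPack tensor_equiv_is_equiv.
Canonical tensor_encModRel := defaultEncModRel tensor_equiv.

Definition tensor := {eq_quot tensor_equiv}.

HB.instance Definition _ : EqQuotient _ tensor_equiv tensor :=
  EqQuotient.on tensor.
HB.instance Definition _ := Choice.on tensor.

Definition tensor_of_seq (s : seq (A * V)) : tensor := \pi_tensor s.

Definition pure (a : A) (v : V) : tensor := tensor_of_seq [:: (a, v)].

Definition tensor_lift (Z : zmodType) (F : A -> V -> Z) (t : tensor) : Z :=
  fsum F (generic_quotient.repr t).

Lemma tensor_of_seq_eq s1 s2 :
  (forall (Z : zmodType) (F : A -> V -> Z),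
     balanced F -> fsum F s1 = fsum F s2) ->
  tensor_of_seq s1 = tensor_of_seq s2.
Proof. by move=> E; apply/eqmodP/asboolP. Qed.

Lemma tensor_lift_seq (Z : zmodType) (F : A -> V -> Z) s :
  balanced F -> tensor_lift F (tensor_of_seq s) = fsum F s.
Proof.
move=> bF; rewrite /tensor_lift.
have /eqmodP/asboolP/(_ Z F bF) : generic_quotient.repr (tensor_of_seq s) = s %[mod tensor].
  by rewrite reprK.
by [].
Qed.

Lemma tensor_ext t1 t2 :
  (forall (Z : zmodType) (F : A -> V -> Z),
     balanced F -> tensor_lift F t1 = tensor_lift F t2) -> t1 = t2.
Proof.
move=> E; rewrite -[t1]reprK -[t2]reprK; apply: tensor_of_seq_eq.
exact: E.
Qed.

Lemma fsum_map (Z : zmodType) (F : A -> V -> Z) (p : A * V -> A * V) s :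
  fsum F (map p s) = \sum_(t <- s) F (p t).1 (p t).2.
Proof. exact: big_map. Qed.

Lemma balanced0l (Z : zmodType) (F : A -> V -> Z) v : balanced F -> F 0 v = 0.
Proof.
by move=> bF; apply: (addrI (F 0 v)); rewrite -(balancedDl bF) !addr0.
Qed.

Lemma balancedNl (Z : zmodType) (F : A -> V -> Z) a v :
  balanced F -> F (- a) v = - F a v.
Proof.
move=> bF; apply: (addrI (F a v)).
by rewrite -(balancedDl bF) !subrr balanced0l.
Qed.

Definition tensor_zero : tensor := tensor_of_seq [::].
Definition tensor_opp (t : tensor) : tensor :=
  tensor_of_seq [seq (- p.1, p.2) | p <- generic_quotient.repr t].
Definition tensor_add (t1 t2 : tensor) : tensor :=
  tensor_of_seq (generic_quotient.repr t1 ++ generic_quotient.repr t2).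
Definition tensor_scale (a : A) (t : tensor) : tensor :=
  tensor_of_seq [seq (a * p.1, p.2) | p <- generic_quotient.repr t].

Lemma lift_zero (Z : zmodType) (F : A -> V -> Z) : balanced F -> @tensor_lift Z F tensor_zero = 0.
Proof. by move=> bF; rewrite tensor_lift_seq // /fsum big_nil. Qed.

Lemma lift_opp (Z : zmodType) (F : A -> V -> Z) t :
  balanced F -> @tensor_lift Z F (tensor_opp t) = - tensor_lift F t.
Proof.
move=> bF; rewrite tensor_lift_seq // fsum_map -sumrN.
by apply: eq_bigr => p _; rewrite balancedNl.
Qed.

Lemma lift_add (Z : zmodType) (F : A -> V -> Z) t1 t2 : balanced F ->
  @tensor_lift Z F (tensor_add t1 t2) = tensor_lift F t1 + tensor_lift F t2.
Proof. by move=> bF; rewrite tensor_lift_seq // /fsum big_cat. Qed.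

Lemma balanced_mull (Z : zmodType) (F : A -> V -> Z) a :
  balanced F -> balanced (fun b => F (a * b)).
Proof.
case=> Dl Dr BS; split=> [b c v|b u v|b s v]; first by rewrite mulrDr Dl.
  exact: Dr.
by rewrite mulrA BS.
Qed.

Lemma lift_scale (Z : zmodType) (F : A -> V -> Z) a t : balanced F ->
  @tensor_lift Z F (tensor_scale a t) = tensor_lift (fun b => F (a * b)) t.
Proof. by move=> bF; rewrite tensor_lift_seq // fsum_map. Qed.

Lemma tensor_addA : associative tensor_add.
Proof.
by move=> x y z; apply: tensor_ext => Z F bF; rewrite !lift_add // addrA.
Qed.

Lemma tensor_addC : commutative tensor_add.
Proof. by move=> x y; apply: tensor_ext => Z F bF; rewrite !lift_add // addrC. Qed.

Lemma tensor_add0 : left_id tensor_zero tensor_add.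
Proof.
by move=> x; apply: tensor_ext => Z F bF; rewrite lift_add // lift_zero ?add0r.
Qed.

Lemma tensor_addN : left_inverse tensor_zero tensor_opp tensor_add.
Proof.
move=> x; apply: tensor_ext => Z F bF.
by rewrite lift_add // lift_opp // lift_zero // addNr.
Qed.

HB.instance Definition _ := GRing.isZmodule.Build tensor
  tensor_addA tensor_addC tensor_add0 tensor_addN.

Lemma tensor_scaleA a b t :
  tensor_scale a (tensor_scale b t) = tensor_scale (a * b) t.
Proof.
apply: tensor_ext => Z F bF; rewrite !lift_scale //; last exact: balanced_mull.
by apply: eq_bigr => p _; rewrite mulrA.
Qed.

Lemma tensor_scale1 : left_id 1 tensor_scale.
Proof.
move=> t; apply: tensor_ext => Z F bF; rewrite lift_scale //.
by apply: eq_bigr => p _; rewrite mul1r.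
Qed.

Lemma tensor_scaleDr : right_distributive tensor_scale +%R.
Proof.
move=> a x y; apply: tensor_ext => Z F bF.
by rewrite !(lift_add, lift_scale) //; apply: balanced_mull.
Qed.

Lemma tensor_scaleDl t : {morph tensor_scale^~ t : a b / a + b}.
Proof.
move=> a b; apply: tensor_ext => Z F bF.
rewrite !(lift_add, lift_scale) // /tensor_lift /fsum -big_split.
by apply: eq_bigr => p _; rewrite mulrDl (balancedDl bF).
Qed.

HB.instance Definition _ := GRing.Zmodule_isLmodule.Build A tensor
  tensor_scaleA tensor_scale1 tensor_scaleDr tensor_scaleDl.

Lemma pure_balanced : balanced pure.
Proof.
split=> [a b v|a u v|a s v]; apply: tensor_ext => Z F bF;
  rewrite ?lift_add // !tensor_lift_seq // /fsum !big_seq1 /=.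
- exact: balancedDl.
- exact: balancedDr.
- exact: balancedS.
Qed.

Lemma tensor_lift_pure (Z : zmodType) (F : A -> V -> Z) a v :
  balanced F -> tensor_lift F (pure a v) = F a v.
Proof. by move=> bF; rewrite tensor_lift_seq // /fsum big_seq1. Qed.

Lemma tensor_liftB (Z : zmodType) (F : A -> V -> Z) :
  balanced F -> zmod_morphism (tensor_lift F).
Proof. by move=> bF x y; rewrite lift_add // lift_opp. Qed.

Lemma tensor_scale_pure a b v : a *: pure b v = pure (a * b) v.
Proof.
apply: tensor_ext => Z F bF; rewrite lift_scale //.
by rewrite !tensor_lift_pure //; apply: balanced_mull.
Qed.

Lemma tensor_sum_pure (t : tensor) : t = \sum_(p <- generic_quotient.repr t) pure p.1 p.2.
Proof.
rewrite -{1}[t]reprK; elim: (generic_quotient.repr t) => [|p s IHs]; first by rewrite big_nil.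
rewrite big_cons -IHs; apply: tensor_ext => Z F bF.
rewrite lift_add // !tensor_lift_seq // /fsum big_cons.
by rewrite big_seq1.
Qed.

End Tensor.

(* A as a left S-module through j : S -> A. *)
Definition restr (S A : nzRingType) (j : {rmorphism S -> A}) : Type := A.

Section Separable.
Variables (S A : nzRingType) (j : {rmorphism S -> A}).
Local Notation AS := (restr j).

HB.instance Definition _ := GRing.Zmodule.copy AS A.

Definition restr_scale (s : S) (a : AS) : AS := j s * (a : A).

Lemma restr_scaleA s t a :
  restr_scale s (restr_scale t a) = restr_scale (s * t) a.
Proof. by rewrite /restr_scale rmorphM mulrA. Qed.

Lemma restr_scale1 : left_id 1 restr_scale.
Proof. by move=> a; rewrite /restr_scale rmorph1 mul1r. Qed.

Lemma restr_scaleDr : right_distributive restr_scale +%R.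
Proof. by move=> s a b; rewrite /restr_scale; apply: mulrDr. Qed.

Lemma restr_scaleDl a : {morph restr_scale^~ a : s t / s + t}.
Proof. by move=> s t; rewrite /restr_scale rmorphD; apply: mulrDl. Qed.

HB.instance Definition _ := GRing.Zmodule_isLmodule.Build S AS
  restr_scaleA restr_scale1 restr_scaleDr restr_scaleDl.

Definition tensor_square := tensor j AS.

Definition tensor_rscale (t : tensor_square) (a : A) : tensor_square :=
  tensor_lift (fun x (y : AS) => pure j x ((y : A) * a : AS)) t.

Definition tensor_mult (t : tensor_square) : A :=
  tensor_lift (fun x (y : AS) => x * (y : A)) t.

Lemma balanced_rscale a :
  balanced j (fun x (y : AS) => pure j x ((y : A) * a : AS)).
Proof.
have [Dl Dr BS] := @pure_balanced _ _ j AS.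
split=> [x x' y|x y y'|x s y]; first exact: Dl.
  by rewrite -Dr; congr (pure _ _ _); apply: mulrDl.
by rewrite BS; congr (pure _ _ _); rewrite /GRing.scale /= /restr_scale mulrA.
Qed.

Lemma balanced_mult : balanced j (fun x (y : AS) => x * (y : A)).
Proof.
split=> [x x' y|x y y'|x s y]; [exact: mulrDl | exact: mulrDr |].
by rewrite /GRing.scale /= /restr_scale mulrA.
Qed.

Lemma tensor_rscale_pure x (y : AS) a :
  tensor_rscale (pure j x y) a = pure j x ((y : A) * a : AS).
Proof. exact/tensor_lift_pure/balanced_rscale. Qed.

Lemma tensor_mult_pure x (y : AS) :
  tensor_mult (pure j x y) = x * (y : A).
Proof. exact/tensor_lift_pure/balanced_mult. Qed.

Definition separable_extension :=
  exists sigma : A -> tensor_square,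
    [/\ {morph sigma : x y / x + y},
        forall a x : A, sigma (a * x) = a *: sigma x,
        forall x a : A, sigma (x * a) = tensor_rscale (sigma x) a &
        forall x : A, tensor_mult (sigma x) = x].

End Separable.

Section LocalRing.
Variable A : nzRingType.

Definition invertible (x : A) := exists y : A, x * y = 1 /\ y * x = 1.

(* A <> 0 is built into nzRingType. *)
Definition local_ring :=
  forall x y : A, ~ invertible x -> ~ invertible y -> ~ invertible (x + y).

End LocalRing.


Definition minimal_subgroup (gT : finGroupType) (Pr : {group gT} -> Prop)
    (P : {group gT}) :=
  Pr P /\ forall Q : {group gT}, Pr Q -> Q \subset P -> Q :=: P.

Section InteriorAlgebra.
(* iota : gT -> A is the structural map of an interior gT-algebra A; the sum
   in rel_trace runs over representatives of the left cosets xP. *)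
Variables (gT : finGroupType) (A : nzRingType) (iota : gT -> A).

Definition conj_act (x : gT) (a : A) : A := iota x * a * iota x^-1%g.

Definition fixed_by (P : {group gT}) (a : A) :=
  forall x, x \in P -> conj_act x a = a.

Definition rel_trace (P : {group gT}) (a : A) : A :=
  \sum_(C in lcosets P [set: gT]) conj_act (repr C) a.

Definition defect_group : {group gT} -> Prop :=
  minimal_subgroup (fun P => exists2 a, fixed_by P a & rel_trace P a = 1).

End InteriorAlgebra.

Section Vertex.
Variables (O : comNzRingType) (gT : finGroupType).

Definition galg_incl (H : {group gT}) :
    {rmorphism galg O (subg_of H) -> galg O gT} :=
  galg_map idfun (sgval_morphism H).

Definition induced (H : {group gT}) (V : lmodType (galg O (subg_of H))) :
    lmodType (galg O gT) :=
  tensor (galg_incl H) V.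

Definition direct_summand (A : nzRingType) (M N : lmodType A) :=
  exists (i : {linear M -> N}) (q : {linear N -> M}), forall x, q (i x) = x.

Definition relatively_projective (M : lmodType (galg O gT)) (H : {group gT}) :=
  exists V : lmodType (galg O (subg_of H)), direct_summand M (induced V).

Definition vertex (M : lmodType (galg O gT)) : {group gT} -> Prop :=
  minimal_subgroup (relatively_projective M).

End Vertex.

Section Lattice.
Variables (O : idomainType) (gT : finGroupType) (L : lmodType (galg O gT)).

(* c%:A is the image of c : O in the group algebra. *)
Definition O_basis n (v : 'I_n -> L) :=
  forall x : L, exists! c : {ffun 'I_n -> O}, x = \sum_i (c i)%:A *: v i.

Definition lattice := exists n (v : 'I_n -> L), O_basis v.

(* The character of K (x)_O L, computed on the K-basis 1 (x) v i. *)
Definition affords (chi : gT -> {fraction O}) :=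
  exists n (v : 'I_n -> L) (X : gT -> 'M[O]_n),
    [/\ O_basis v,
        forall g i, gelt O g *: v i = \sum_l (X g l i)%:A *: v l &
        forall g, chi g = \tr (map_mx (@tofrac O) (X g))].

End Lattice.


(* Simple K[gT]-modules are given by irreducible matrix representations. *)
Definition irr_character (K : fieldType) (gT : finGroupType) (chi : gT -> K) :=
  exists n (rG : mx_representation K [set: gT] n),
    mx_irreducible rG /\ forall g, chi g = \tr (rG g).

Definition defect_zero (p : nat) (K : fieldType) (gT : finGroupType)
    (chi : gT -> K) :=
  exists d : nat, chi 1%g = d%:R /\ (d`_p = #|[set: gT]|`_p)%N.


Section Orders.
Variables (O : idomainType) (gT : finGroupType).
Local Notation K := {fraction O}.

Definition galg_frac : {rmorphism galg O gT -> galg K gT} :=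
  galg_map (@tofrac O) (idm_morphism [set: gT]).

Definition galg_sub_frac (P : {group gT}) :
    {rmorphism galg O (subg_of P) -> galg K gT} :=
  galg_map (@tofrac O) (sgval_morphism P).

Section Block.
Variable b : pcidem (galg O gT).

Definition block := corner (@idfun (galg O gT)) b.

Definition block_elt (g : gT) : block := corner_elt idfun b (gelt O g).

Definition block_defect_group : {group gT} -> Prop := defect_group block_elt.

End Block.

Variable e : pcidem (galg K gT).

Definition OGe := corner galg_frac e.

Definition OGe_elt (g : gT) : OGe := corner_elt galg_frac e (gelt O g).

Definition anchor : {group gT} -> Prop := defect_group OGe_elt.

Definition OPe (P : {group gT}) := corner (galg_sub_frac P) e.

Lemma galg_frac_gelt g : galg_frac (gelt O g) = gelt K g.
Proof. exact: galg_map_gelt. Qed.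

Lemma galg_frac_scale (c : O) a : galg_frac (c *: a) = tofrac c *: galg_frac a.
Proof.
rewrite /galg_frac /= /galg_map scaler_sumr; apply: eq_bigr => g _.
by rewrite galg_scaleE rmorphM scalerA.
Qed.

Lemma galg_sub_frac_factor (P : {group gT}) (a : galg O (subg_of P)) :
  exists a', galg_sub_frac P a = galg_frac a'.
Proof.
exists (galg_incl O P a).
have -> : galg_incl O P a = \sum_g a g *: gelt O (sgval g) by [].
rewrite rmorph_sum; apply: eq_bigr => g _.
by rewrite galg_frac_scale galg_frac_gelt.
Qed.

Definition OPe_incl (P : {group gT}) : {rmorphism OPe P -> OGe} :=
  corner_incl e (@galg_sub_frac_factor P).

(* OGe as an O(G x G)-module, (x, y) acting by a |-> x a y^-1. *)
Definition OGe_bimod := OGe.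

HB.instance Definition _ := GRing.Zmodule.on OGe_bimod.

Definition bimod_act (c : galg O (gT * gT)%type) (a : galg K gT) : galg K gT :=
  \sum_(u : gT * gT) tofrac (c u) *: (gelt K u.1 * a * gelt K u.2^-1%g).

Lemma bimod_act_corner c (a : OGe) : bimod_act c (corner_val a) \in corner_pred galg_frac e.
Proof.
apply: rpred_sum => u _; case: a => _ /= /corner_predP[a ->].
apply/corner_predP; exists (c u *: (gelt O u.1 * a * gelt O u.2^-1%g)).
rewrite galg_frac_scale !rmorphM !galg_frac_gelt -scalerAl; congr (_ *: _).
by rewrite -!mulrA pcidemC !mulrA.
Qed.

Definition bimod_scale (c : galg O (gT * gT)%type) (a : OGe_bimod) : OGe_bimod :=
  Corner (bimod_act_corner c a).

Lemma bimod_scaleA c d a :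
  bimod_scale c (bimod_scale d a) = bimod_scale (c * d) a.
Proof.
apply: val_inj; rewrite /= /bimod_act.
under [RHS]eq_bigr => u _ do rewrite galg_mulE rmorph_sum scaler_suml.
rewrite exchange_big /=; apply: eq_bigr => u _.
rewrite [RHS](reindex_inj (mulgI u)) mulr_sumr mulr_suml scaler_sumr /=.
apply: eq_bigr => v _.
rewrite mulKg -scalerAr -scalerAl scalerA rmorphM; congr (_ *: _).
by rewrite invMg !geltM !mulrA.
Qed.

Lemma bimod_scale1 : left_id 1 bimod_scale.
Proof.
move=> a; apply: val_inj; rewrite /= /bimod_act (bigD1 1%g) //= big1 ?addr0.
  by rewrite galg1E ffunE eqxx rmorph1 scale1r invg1 -galg1E mul1r mulr1.
by move=> u /negPf u1; rewrite galg1E ffunE u1 rmorph0 scale0r.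
Qed.

Lemma bimod_scaleDr : right_distributive bimod_scale +%R.
Proof.
move=> c a b; apply: val_inj; rewrite /= /bimod_act -big_split.
by apply: eq_bigr => u _; rewrite mulrDr mulrDl scalerDr.
Qed.

Lemma bimod_scaleDl a : {morph bimod_scale^~ a : c d / c + d}.
Proof.
move=> c d; apply: val_inj; rewrite /= /bimod_act -big_split.
by apply: eq_bigr => u _; rewrite ffunE rmorphD scalerDl.
Qed.

HB.instance Definition _ :=
  GRing.Zmodule_isLmodule.Build (galg O (gT * gT)%type) OGe_bimod
    bimod_scaleA bimod_scale1 bimod_scaleDr bimod_scaleDl.

End Orders.

Definition diag_set (gT : finGroupType) (P : {group gT}) : {set gT * gT} :=
  [set (x, x) | x in P].

Lemma diag_group_set (gT : finGroupType) (P : {group gT}) :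
  group_set (diag_set P).
Proof.
apply/group_setP; split; first by apply/imsetP; exists 1%g.
move=> _ _ /imsetP[x xP ->] /imsetP[y yP ->].
by apply/imsetP; exists (x * y)%g; rewrite ?groupM.
Qed.

Canonical diag_group (gT : finGroupType) (P : {group gT}) :=
  Group (diag_group_set P).


Section DVR.
Variable O : idomainType.

Definition divides (d x : O) := exists c, x = d * c.

Definition uniformizer (pi : O) :=
  [/\ pi != 0, pi \isn't a GRing.unit &
      forall x, x != 0 -> exists n u, u \is a GRing.unit /\ x = u * pi ^+ n].

(* Every Cauchy sequence for the pi-adic topology converges. *)
Definition adically_complete (pi : O) :=
  forall u : nat -> O,
    (forall N, exists M, forall m n, (M <= m)%N -> (M <= n)%N ->
       divides (pi ^+ N) (u m - u n)) ->
    exists l, forall N, exists M, forall n, (M <= n)%N ->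
      divides (pi ^+ N) (u n - l).

Definition complete_dvr := exists2 pi, uniformizer pi & adically_complete pi.

(* res identifies k with O/J(O); the maximal ideal J(O) of the local ring O
   consists of the non-units. *)
Definition residue_map (k : fieldType) (res : {rmorphism O -> k}) :=
  (forall y : k, exists x, res x = y) /\
  (forall x, res x = 0 <-> x \isn't a GRing.unit).

End DVR.

(* Main.v *)
(* Let X : G -> GL_n(O) be given by the lattice L.  Its extension to K is
   absolutely irreducible, e = n/|G| sum_g chi(g^-1) g, and OGe is identified
   with the O-span of X(G) in M_n(O); its G-fixed points are the scalars Oe, a
   local ring, so in any decomposition of e into relative traces one of the
   traces is a unit.  With Mackey's formula this shows that P lies in a
   conjugate of every D with e in Tr_D((OGe)^D); hence (a), and the first half
   of (e) by restricting a Higman endomorphism of OGe to the diagonal and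
   evaluating it at e.  Writing e = Tr_P(a), the Higman endomorphisms y |-> ay
   of L and x |-> axa of OGe give (b) and the second half of (e), and the sum of
   the ga (x) g^-1 over G/P is a separability idempotent.  For (c), a normal
   p-subgroup Q fixes a nonzero vector of the reduction of L, and Tr_P(a)
   multiplies the vectors fixed by Q by a multiple of |PQ : P|.  OP is local
   because its augmentation is.

   If chi has defect zero, n/|G| is a unit and OGe contains an element of trace
   1, so P = 1.  Conversely, if DeltaP is a vertex then OGe is a projective left
   module, so OG -> OGe splits and e lies in OG.  The matrix of the coefficients
   of e at x y^-1 is then an idempotent over O of rank n^2 over K, hence also
   over k.  A simple submodule of the reduction of L has trace proportional to
   these coefficients, since the centre of OGe is Oe, and so its degree is at
   least n.  The reduction of L is thus absolutely irreducible, some chi(g) is a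
   unit, and n/|G| is in O. *)

Require Import Defs.
From HB Require Import structures.
From mathcomp Require Import all_boot all_order all_fingroup all_algebra.
From mathcomp Require Import all_solvable all_character.

Set Implicit Arguments.
Unset Strict Implicit.
Unset Printing Implicit Defensive.

Import GRing.Theory.
Local Open Scope ring_scope.

(** * Sums over cosets *)

Section CosetSums.
Variables (gT : finGroupType) (Z : zmodType).
Implicit Types (D H K G : {group gT}) (F : gT -> Z).

(** The value depends on the representatives picked by [repr] unless [F] is constant on left cosets
    of [H], which is what [coset_fun] demands. The shape agrees definitionally with [rel_trace]. *)
Definition coset_sum H G F : Z := \sum_(C in lcosets H G) F (repr C).

Definition coset_fun H F := forall x h, h \in H -> F (x * h)%g = F x.

Lemma repr_lcoset H x : exists2 h, h \in H & repr (x *: H)%g = (x * h)%g.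
Proof.
have: repr (x *: H)%g \in (x *: H)%g by apply: mem_repr (lcoset_refl H x).
by case/lcosetP => h; exists h.
Qed.

Lemma repr_lcosetK H x : (repr (x *: H) *: H = x *: H)%g.
Proof. by have [h hH ->] := repr_lcoset H x; rewrite lcosetM lcoset_id. Qed.

Lemma repr_lcosetsK H G C : C \in lcosets H G -> (repr C *: H = C)%g.
Proof. by case/lcosetsP => x _ ->; rewrite repr_lcosetK. Qed.

Lemma repr_lcosets_in H G C : H \subset G -> C \in lcosets H G -> repr C \in G.
Proof.
move=> /subsetP HG /lcosetsP[x xG ->]; have [h hH ->] := repr_lcoset H x.
by apply: groupM => //; apply: HG.
Qed.

Lemma coset_fun_repr H F x : coset_fun H F -> F (repr (x *: H)%g) = F x.
Proof. by have [h hH -> Fi] := repr_lcoset H x; apply: Fi. Qed.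

(** Independence of the transversal, the latter indexed by an arbitrary finite type. Translation,
    transitivity, conjugation and Mackey's formula all follow by naming a suitable family. *)
Lemma coset_sum_transversal (T : finType) (B : {pred T}) (f : T -> gT) H G F :
    H \subset G -> coset_fun H F ->
    (forall t, t \in B -> f t \in G) ->
    (forall x, x \in G -> exists2 t, t \in B & ((f t)^-1 * x)%g \in H) ->
    {in B &, forall t t', ((f t)^-1 * f t')%g \in H -> t = t'} ->
  coset_sum H G F = \sum_(t in B) F (f t).
Proof.
move=> sHG Fi fG fs fi.
rewrite /coset_sum; have <- : [set (f t *: H)%g | t in B] = lcosets H G.
  apply/setP => C; apply/imsetP/lcosetsP => [[t tB ->]|[x xG ->]].
    by exists (f t); rewrite ?fG.
  have [t tB tH] := fs x xG; exists t => //.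
  by apply/lcoset_eqP; rewrite mem_lcoset.
rewrite big_imset //=.
  by apply: eq_bigr => t _; rewrite coset_fun_repr.
by move=> t t' tB t'B /lcoset_eqP; rewrite mem_lcoset => /fi ->.
Qed.

Lemma lcosets_inj H G C C' : C \in lcosets H G -> C' \in lcosets H G ->
  ((repr C)^-1 * repr C')%g \in H -> C = C'.
Proof.
move=> CG C'G; rewrite -mem_lcoset => /lcoset_eqP.
by rewrite (repr_lcosetsK CG) (repr_lcosetsK C'G).
Qed.

Lemma lcosets_repr_surj H G x : H \subset G -> x \in G ->
  exists2 C, C \in lcosets H G & ((repr C)^-1 * x)%g \in H.
Proof.
move=> sHG xG; exists (x *: H)%g; first by apply/lcosetsP; exists x.
by rewrite -mem_lcoset repr_lcosetK lcoset_refl.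
Qed.

Lemma coset_sum_transl H G F h : H \subset G -> coset_fun H F -> h \in G ->
  coset_sum H G (fun x => F (h * x)%g) = coset_sum H G F.
Proof.
move=> sHG Fi hG.
rewrite [RHS](@coset_sum_transversal _ (lcosets H G) (fun C => h * repr C)%g) //.
- by move=> C CG; rewrite groupM // (repr_lcosets_in sHG).
- move=> x xG; have [|C CG] := @lcosets_repr_surj H G (h^-1 * x)%g sHG.
    by rewrite groupM ?groupV.
  by exists C => //; rewrite invMg -mulgA.
by move=> C C' CG C'G; rewrite invMg -mulgA mulKg; apply: lcosets_inj CG C'G.
Qed.

Lemma coset_sum_trans H K G F : H \subset K -> K \subset G -> coset_fun H F ->
  coset_sum H G F =
  coset_sum K G (fun x => coset_sum H K (fun y => F (x * y)%g)).
Proof.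
move=> sHK sKG Fi; rewrite {2}/coset_sum; under [RHS]eq_bigr do rewrite /coset_sum.
rewrite pair_big_dep /=.
rewrite (@coset_sum_transversal _ (fun CE => (CE.1 \in lcosets K G) && (CE.2 \in lcosets H
  K)) (fun CE => repr CE.1 * repr CE.2)%g) //.
- exact: subset_trans sKG.
- move=> [C E] /andP[/= CG EK]; rewrite groupM ?(repr_lcosets_in _ CG) //.
  by rewrite (subsetP sKG) // (repr_lcosets_in _ EK).
- move=> x xG; have [C CG Cx] := lcosets_repr_surj sKG xG.
  have [E EK Ex] := lcosets_repr_surj sHK Cx.
  by exists (C, E); rewrite ?[_ \in _]CG ?invMg -?mulgA // unfold_in /= CG.
move=> [C E] [C' E'] /andP[/= CG EK] /andP[/= C'G E'K] eqH.
have eqC: C = C'.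
  apply: lcosets_inj CG C'G _.
  have := subsetP sHK _ eqH; rewrite invMg -mulgA groupMl ?groupV ?(repr_lcosets_in _ EK) //.
  by rewrite mulgA groupMr ?(repr_lcosets_in _ E'K).
rewrite -eqC in eqH *; congr (_, _); apply: lcosets_inj EK E'K _.
by move: eqH; rewrite invMg -mulgA mulKg.
Qed.

(** The group [D :^ z^-1] is z D z^-1, and right multiplication by [z] carries a left transversal of
    it to one of [D]. *)
Lemma coset_sum_conjr D G F z : D \subset G -> coset_fun D F -> z \in G ->
  coset_sum (D :^ z^-1)%G G (fun x => F (x * z)%g) = coset_sum D G F.
Proof.
move=> sDG Fi zG.
have inDz x : (x \in (D :^ z^-1)%G) = (z^-1 * x * z \in D)%g.
  by rewrite /= mem_conjg invgK /conjg mulgA.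
have sDzG : (D :^ z^-1)%G \subset G.
  apply/subsetP => x; rewrite inDz => /(subsetP sDG).
  by rewrite groupMr // groupMl ?groupV.
rewrite [RHS](@coset_sum_transversal _ (lcosets (D :^ z^-1)%G G) (fun C => repr C * z)%g) //.
- by move=> C CG; rewrite groupM // (repr_lcosets_in sDzG).
- move=> x xG; have [|C CG] := @lcosets_repr_surj (D :^ z^-1)%G G (x * z^-1)%g sDzG.
    by rewrite groupM ?groupV.
  by rewrite inDz => CP; exists C; rewrite // invMg; move: CP; rewrite !mulgA mulgKV.
move=> C C' CG C'G E; apply: (lcosets_inj CG C'G).
by move: E; rewrite inDz invMg !mulgA.
Qed.

Lemma eq_coset_sum D G F F' : D \subset G -> {in G, F =1 F'} ->
  coset_sum D G F = coset_sum D G F'.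
Proof.
move=> sDG eF; apply: eq_bigr => C CG.
by rewrite eF // (repr_lcosets_in sDG).
Qed.

Lemma coset_sum_id G F : coset_fun G F -> coset_sum G G F = F 1%g.
Proof.
move=> Fi; rewrite (@coset_sum_transversal unit predT (fun => 1%g)) //.
- by rewrite (big_pred1 tt) //; case.
- by move=> x xG; exists tt; rewrite ?invg1 ?mul1g.
- by case=> [] [].
Qed.

End CosetSums.

(** * Double cosets and Mackey's formula *)

Section Mackey.
Variables (gT hT : finGroupType) (P : {group hT}) (f : {morphism P >-> gT}).
Variable D : {group gT}.

Definition double_coset (w : gT) : {set gT} := ((f @* P) * (w *: D))%g.

Lemma double_coset_refl w : w \in double_coset w.
Proof. by rewrite -[w in w \in _]mul1g mem_mulg ?group1 ?lcoset_refl. Qed.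

Lemma double_coset_eq w w' : w' \in double_coset w -> double_coset w' = double_coset w.
Proof.
case/mulsgP => u v uP /lcosetP[d dD ->] ->.
by rewrite /double_coset !lcosetM lcoset_id // mulgA rcoset_id.
Qed.

Definition double_reps : {set gT} := [set repr (double_coset w) | w : gT].

Lemma repr_double_coset w : repr (double_coset w) \in double_coset w.
Proof. exact: mem_repr (double_coset_refl w). Qed.

Lemma double_repsK z : z \in double_reps -> repr (double_coset z) = z.
Proof. by case/imsetP=> w _ ->; rewrite (double_coset_eq (repr_double_coset w)). Qed.

(** The stabiliser in [P] of the coset zD, where [P] acts through [f]. *)
Definition mackey_stab (z : gT) : {group hT} := (f @*^-1 (D :^ z^-1))%G.

Lemma mackey_stabP z y :
  (y \in mackey_stab z) = (y \in P) && (z^-1 * f y * z \in D)%g.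
Proof. by rewrite /= !inE mem_conjg invgK /conjg mulgA. Qed.

Lemma mackey_stab_sub z : mackey_stab z \subset P.
Proof. by apply/subsetP => y; rewrite mackey_stabP => /andP[]. Qed.

(** The double cosets are the [P]-orbits on left cosets of [D], and each orbit is indexed by the
    cosets of a stabiliser. Allowing a morphism [f] covers subgroups of G as well as the diagonal
    and the left factor of G x G. *)
Lemma coset_sum_mackey (Z : zmodType) (F : gT -> Z) : coset_fun D F ->
  coset_sum D [set: gT] F =
  \sum_(z in double_reps) coset_sum (mackey_stab z) P (fun y => F (f y * z)%g).
Proof.
move=> Fi; rewrite /coset_sum pair_big_dep /=.
rewrite -[LHS]/(coset_sum D [set: gT] F).
rewrite (@coset_sum_transversal _ _ _ (fun zE => (zE.1 \in double_reps)
  && (zE.2 \in lcosets (mackey_stab zE.1) P)) (fun zE => f (repr zE.2) * zE.1)%g) //.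
- exact: subsetT.
- by move=> t _; rewrite inE.
- move=> x _; pose z := repr (double_coset x).
  have zR : z \in double_reps by apply: imset_f.
  have : x \in double_coset z.
    by rewrite (double_coset_eq (repr_double_coset x)) double_coset_refl.
  case/mulsgP => _ _ /morphimP[y _ yP ->] /lcosetP[d dD ->] xE.
  have [E EP Ey] := lcosets_repr_surj (mackey_stab_sub z) yP.
  have EP' := repr_lcosets_in (mackey_stab_sub z) EP.
  exists (z, E); first by rewrite unfold_in /= zR.
  rewrite xE /= invMg !mulgA groupMr //; move: Ey.
  by rewrite mackey_stabP morphM ?morphV ?groupV // => /andP[_]; rewrite !mulgA.
move=> [z E] [z' E'] /andP[/= zR EP] /andP[/= z'R E'P].
have EP1 := repr_lcosets_in (mackey_stab_sub z) EP.
have EP2 := repr_lcosets_in (mackey_stab_sub z') E'P.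
rewrite -mem_lcoset => /lcosetP[d dD /(canRL (mulKg _)) z'E].
have zz' : z' = z.
  rewrite -(double_repsK zR) -(double_repsK z'R) (@double_coset_eq z z') //.
  rewrite z'E -morphV // !mulgA -morphM ?groupV // -mulgA.
  by rewrite mem_mulg ?mem_morphim ?groupM ?groupV // mem_lcoset mulKg.
rewrite zz' in E'P EP2 z'E *; congr (_, _); apply: lcosets_inj EP E'P _.
rewrite mackey_stabP groupM ?groupV // morphM ?morphV ?groupV //=.
have -> : f (repr E') = (f (repr E) * z * d * z^-1)%g.
  by apply: (canRL (mulgK z)); rewrite {1}z'E mulKVg.
by rewrite !mulgA !mulgKV mulVg mul1g.
Qed.

End Mackey.

(** * Higman's criterion *)

Section RestrictScalars.
Variables (S A : nzRingType) (j : {rmorphism S -> A}) (M : lmodType A).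

(** The type mentions the morphism so that instance inference can attach to it the [S]-module
    structure pulled back along that morphism. *)
Definition restr_mod of {rmorphism S -> A} : Type := M.
Local Notation MS := (restr_mod j).

HB.instance Definition _ := GRing.Zmodule.copy MS M.

Definition restr_mod_scale (s : S) (x : MS) : MS := j s *: (x : M).

Lemma restr_mod_scaleA s t x :
  restr_mod_scale s (restr_mod_scale t x) = restr_mod_scale (s * t) x.
Proof. by rewrite /restr_mod_scale rmorphM scalerA. Qed.

Lemma restr_mod_scale1 : left_id 1 restr_mod_scale.
Proof. by move=> x; rewrite /restr_mod_scale rmorph1 scale1r. Qed.

Lemma restr_mod_scaleDr : right_distributive restr_mod_scale +%R.
Proof. by move=> s x y; rewrite /restr_mod_scale; apply: scalerDr. Qed.

Lemma restr_mod_scaleDl x : {morph restr_mod_scale^~ x : s t / s + t}.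
Proof. by move=> s t; rewrite /restr_mod_scale rmorphD; apply: scalerDl. Qed.

HB.instance Definition _ := GRing.Zmodule_isLmodule.Build S MS
  restr_mod_scaleA restr_mod_scale1 restr_mod_scaleDr restr_mod_scaleDl.

End RestrictScalars.

Lemma tensor_eq_pure (S A : nzRingType) (j : {rmorphism S -> A}) (V : lmodType S)
    (Z : zmodType) (f g : tensor j V -> Z) :
    zmod_morphism f -> zmod_morphism g ->
  (forall a v, f (pure j a v) = g (pure j a v)) -> f =1 g.
Proof.
move=> fB gB fg t.
pose f' : {additive _ -> _} := HB.pack f (GRing.isZmodMorphism.Build _ _ f fB).
pose g' : {additive _ -> _} := HB.pack g (GRing.isZmodMorphism.Build _ _ g gB).
rewrite -[f]/(f' : _ -> _) -[g]/(g' : _ -> _) [t]tensor_sum_pure !raddf_sum.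
by apply: eq_bigr => p _; apply: fg.
Qed.

Section Higman.
Variables (O : comNzRingType) (gT : finGroupType).
Local Notation A := (galg O gT).
Implicit Types (M : lmodType A) (H : {group gT}).

Lemma galg_scaler M (c : O) (a : A) (x : M) : (c *: a) *: x = c%:A *: (a *: x).
Proof. by rewrite scalerA mulr_algl. Qed.

Lemma galg_algC (c : O) (a : A) : c%:A * a = a * c%:A.
Proof. by rewrite mulr_algl mulr_algr. Qed.

Lemma galg_scale_sum M (a : A) (x : M) :
  a *: x = \sum_g (a g)%:A *: (gelt O g *: x).
Proof.
rewrite {1}[a]galg_sum scaler_suml; apply: eq_bigr => g _; exact: galg_scaler.
Qed.

Lemma galg_inclZ H c a : galg_incl O H (c *: a) = c *: galg_incl O H a.
Proof.
rewrite /galg_incl /= /galg_map scaler_sumr; apply: eq_bigr => g _.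
by rewrite galg_scaleE scalerA.
Qed.

Lemma gelt_mulE h (b : A) x : (gelt O h * b) x = b (h^-1 * x)%g.
Proof.
rewrite galg_mulE (bigD1 h) //= big1 ?addr0 ?ffunE ?eqxx ?mul1r //.
by move=> y /negPf yh; rewrite ffunE yh mul0r.
Qed.

Lemma mul_geltE h (b : A) x : (b * gelt O h) x = b (x * h^-1)%g.
Proof.
rewrite galg_mulE (bigD1 (x * h^-1)%g) //= big1 ?addr0.
  by rewrite invMg invgK mulgKV ffunE eqxx mulr1.
move=> y yh; rewrite ffunE [_ == h](_ : _ = false) ?mulr0 //.
by apply: contraNF yh => /eqP <-; rewrite invMg invgK mulKVg.
Qed.

(** An [O]-linear endomorphism commuting with [H] whose relative trace from [H] is the identity.
    Scalars act as [c%:A] because [M] is only given as a module over the group algebra. *)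
Record higman_map M H (phi : M -> M) : Prop := HigmanMap {
  higmanB : zmod_morphism phi;
  higmanZ : forall c x, phi ((c%:A : A) *: x) = (c%:A : A) *: phi x;
  higmanG : forall h x, h \in H -> phi (gelt O h *: x) = gelt O h *: phi x;
  higmanT : forall x, coset_sum H [set: gT]
    (fun g => gelt O g *: phi (gelt O g^-1 *: x)) = x }.

Lemma higman_coset_fun M H (phi : M -> M) x :
    (forall h x, h \in H -> phi (gelt O h *: x) = gelt O h *: phi x) ->
  coset_fun H (fun g => gelt O g *: phi (gelt O g^-1 *: x)).
Proof.
move=> phiG g h hH.
rewrite invMg !geltM -!scalerA phiG ?groupV // [gelt O h *: _]scalerA.
by rewrite -geltM mulgV -galg1E scale1r.
Qed.

Lemma higman_conj M H (phi : M -> M) z : higman_map H phi ->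
  higman_map (H :^ z^-1)%G (fun x => gelt O z *: phi (gelt O z^-1 *: x)).
Proof.
case=> phiB phiZ phiG phiT; split.
- by move=> x y; rewrite scalerBr phiB scalerBr.
- by move=> c x; rewrite scalerA -galg_algC -scalerA phiZ scalerA -galg_algC -scalerA.
- move=> h x; rewrite mem_conjg invgK => hH.
  have hE : (z^-1 * h = h ^ z * z^-1)%g by rewrite /conjg mulgA mulgK.
  have hE' : (z * h ^ z = h * z)%g by rewrite /conjg mulKVg.
  rewrite scalerA -geltM hE geltM -scalerA phiG // scalerA -geltM hE'.
  by rewrite geltM -scalerA.
move=> x; rewrite -[RHS]phiT -(@coset_sum_conjr _ _ H _ _ z) ?inE //.
- apply: eq_coset_sum; first exact: subsetT.
  by move=> g _; rewrite invMg !geltM !scalerA.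
- exact: subsetT.
exact: higman_coset_fun.
Qed.

(** The module is induced from the restriction of [M] to [H]. The embedding sends x to the sum of g
    (x) phi(g^-1 x) over cosets, the retraction multiplies out, and their composite is the trace of
    [phi]. *)
Lemma higman_relatively_projective M H (phi : M -> M) :
  higman_map H phi -> relatively_projective M H.
Proof.
case=> phiB phiZ phiG phiT.
pose j := galg_incl O H.
pose V := restr_mod M j.
exists V.
have [pDl pDr pS] := @pure_balanced _ _ j V.
pose i0 x : induced V := coset_sum H [set: gT]
   (fun g => pure j (gelt O g) (phi (gelt O g^-1 *: x) : V)).
have pgelt g h (v : V) : h \in H -> pure j (gelt O (g * h)) v = pure j (gelt O g) (gelt O h
  *: (v : M) : V).
  move=> hH; rewrite -[h](@subgK _ H) //; set h0 := subg H h.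
  have jE : j (gelt O h0) = gelt O (sgval h0) by exact: galg_map_gelt.
  by rewrite geltM -jE pS.
have i0f x : coset_fun H (fun g => pure j (gelt O g) (phi (gelt O g^-1 *: x) : V)).
  move=> g h hH; rewrite pgelt // invMg geltM -scalerA phiG ?groupV //.
  by congr (pure _ _ _); rewrite scalerA -geltM mulgV -galg1E scale1r.
have i0B : zmod_morphism i0.
  move=> x y; rewrite /i0 /coset_sum -sumrB; apply: eq_bigr => C _.
  apply/eqP; rewrite eq_sym subr_eq; apply/eqP; rewrite -pDr; congr (pure _ _ _).
  by rewrite scalerBr phiB subrK.
pose i1 : {additive M -> induced V} := HB.pack i0 (GRing.isZmodMorphism.Build _ _ i0 i0B).
have i0Z c x : i0 ((c%:A : A) *: x) = (c%:A : A) *: i0 x.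
  rewrite /i0 /coset_sum scaler_sumr; apply: eq_bigr => C _.
  have -> : phi (gelt O (repr C)^-1 *: (c%:A *: x)) = (c%:A : A) *: phi (gelt O (repr C)^-1
    *: x).
    by rewrite scalerA -galg_algC -scalerA phiZ.
  rewrite tensor_scale_pure galg_algC.
  have jc : j c%:A = c%:A by rewrite galg_inclZ rmorph1.
  by rewrite -jc pS.
have i0G h x : i0 (gelt O h *: x) = gelt O h *: i0 x.
  rewrite /i0 -[in LHS](@coset_sum_transl _ _ _ _ _ h) ?inE //.
  - rewrite /coset_sum scaler_sumr; apply: eq_bigr => C _.
    by rewrite tensor_scale_pure -geltM invMg scalerA -geltM mulgKV.
  exact: subsetT.
(* Linearity over the group algebra reduces to scalars and group elements. *)
have i0A : scalable i0.
  move=> a x; rewrite galg_scale_sum -[i0]/(i1 : _ -> _) raddf_sum /=.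
  by rewrite [RHS]galg_scale_sum; apply: eq_bigr => g _; rewrite /= i0Z i0G.
pose q0 : induced V -> M := @tensor_lift _ _ j V M (fun (a : A) (v : V) => a *: (v : M)).
have bal : balanced j (fun (a : A) (v : V) => a *: (v : M)).
  split=> [a b v|a u v|a s v]; [exact: scalerDl|exact: scalerDr|].
  by rewrite -scalerA.
have q0B : zmod_morphism q0 by apply: tensor_liftB.
have q0A : scalable q0.
  move=> a t; apply: (@tensor_eq_pure _ _ j V M (fun t => q0 (a *: t)) (fun t => a *: q0 t)).
  - by move=> t1 t2; rewrite scalerBr q0B.
  - by move=> t1 t2; rewrite q0B scalerBr.
  by move=> b v; rewrite tensor_scale_pure /q0 !tensor_lift_pure // scalerA.
pose i : {linear M -> induced V} := HB.pack i0 (GRing.isZmodMorphism.Build _ _ i0 i0B)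
  (GRing.isScalable.Build _ _ _ _ i0 i0A).
pose q : {linear induced V -> M} := HB.pack q0 (GRing.isZmodMorphism.Build _ _ q0 q0B)
  (GRing.isScalable.Build _ _ _ _ q0 q0A).
exists i, q => x; rewrite -[RHS]phiT /= -[q0]/(q : _ -> _) raddf_sum.
by apply: eq_bigr => C _; rewrite /= /q0 tensor_lift_pure.
Qed.

Section FromInduced.
Variables (H : {group gT}) (V : lmodType (galg O (subg_of H))).
Local Notation j := (galg_incl O H).

(** The projection onto the span of [H]; the lemmas below make it linear on both sides over the
    group algebra of [H], so that it passes to the tensor product. *)
Definition galg_restr (a : A) : A := [ffun g => if g \in H then a g else 0].

Lemma galg_restrD a b : galg_restr (a + b) = galg_restr a + galg_restr b.
Proof.
apply/ffunP => g; rewrite [RHS]ffunE ![galg_restr _ _]ffunE ffunE.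
by case: ifP => // _; rewrite addr0.
Qed.

Lemma galg_restrZ c a : galg_restr (c *: a) = c *: galg_restr a.
Proof.
apply/ffunP => g; rewrite [RHS]galg_scaleE ![galg_restr _ _]ffunE galg_scaleE.
by case: ifP => // _; rewrite mulr0.
Qed.

Lemma galg_restr_mul_gelt h a : h \in H ->
  galg_restr (gelt O h * a) = gelt O h * galg_restr a.
Proof.
move=> hH.
apply/ffunP => x; rewrite ffunE !gelt_mulE ffunE.
by rewrite groupMl ?groupV.
Qed.

Lemma galg_restr_mul_incl s a : galg_restr (a * j s) = galg_restr a * j s.
Proof.
have -> : j s = \sum_g s g *: gelt O (sgval g) by [].
rewrite !mulr_sumr.
rewrite (big_morph galg_restr galg_restrD (_ : _ = 0)); last first.
  by apply/ffunP => g; rewrite !ffunE if_same.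
apply: eq_bigr => h _; rewrite -!scalerAr galg_restrZ; congr (_ *: _).
by apply/ffunP => x; rewrite ffunE !mul_geltE ffunE groupMr // groupV subgP.
Qed.

Definition induced_proj : induced V -> induced V :=
  @tensor_lift _ _ j V _ (fun a v => pure j (galg_restr a) v).

Lemma balanced_induced_proj : balanced j (fun a (v : V) => pure j (galg_restr a) v).
Proof.
have [pDl pDr pS] := @pure_balanced _ _ j V.
split=> [a b v|a u v|a s v]; first by rewrite galg_restrD pDl.
  by rewrite pDr.
by rewrite galg_restr_mul_incl pS.
Qed.

Lemma induced_projB : zmod_morphism induced_proj.
Proof. exact/tensor_liftB/balanced_induced_proj. Qed.

Lemma induced_proj_pure a v : induced_proj (pure j a v) = pure j (galg_restr a) v.
Proof. exact/tensor_lift_pure/balanced_induced_proj. Qed.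

(** The translates of the summand 1 (x) V by coset representatives decompose the induced module, and
    the conjugates of the projection onto that summand add up to the identity. *)
Lemma induced_higman : higman_map H induced_proj.
Proof.
have [pDl pDr pS] := @pure_balanced _ _ j V.
have pB (v : V) : zmod_morphism (fun a => pure j a v).
  by move=> a b; apply/eqP; rewrite /= eq_sym subr_eq -pDl subrK.
pose pA (v : V) : {additive A -> induced V} := HB.pack (fun a => pure j a v)
  (GRing.isZmodMorphism.Build _ _ _ (pB v)).
split=> [|c|h x hH|].
- exact: induced_projB.
- apply: (@tensor_eq_pure _ _ j V _ (fun x => induced_proj (_ *: x)) (fun x => _ *:
  induced_proj x)).
  + by move=> x y; rewrite scalerBr induced_projB.
  + by move=> x y; rewrite induced_projB scalerBr.
  by move=> a v; rewrite tensor_scale_pure !induced_proj_pure tensor_scale_pure !mulr_algl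
    galg_restrZ.
- move: x; apply: (@tensor_eq_pure _ _ j V _ (fun x => induced_proj (_ *: x)) (fun x => _
  *: induced_proj x)).
  + by move=> x y; rewrite scalerBr induced_projB.
  + by move=> x y; rewrite induced_projB scalerBr.
  by move=> a v; rewrite tensor_scale_pure !induced_proj_pure tensor_scale_pure
    galg_restr_mul_gelt.
apply: (@tensor_eq_pure _ _ j V _ (fun x => coset_sum H [set: gT] (fun g => gelt O g *:
  induced_proj (gelt O g^-1 *: x))) (fun x => x)) => //.
  move=> x y; rewrite /coset_sum -sumrB; apply: eq_bigr => C _.
  by rewrite !scalerBr induced_projB scalerBr.
move=> a v; rewrite /coset_sum.
under eq_bigr do rewrite tensor_scale_pure induced_proj_pure tensor_scale_pure.
rewrite -[LHS](raddf_sum (pA v)); congr (pure _ _ _).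
(* The term of a coset C is the part of [a] supported on C, so at [x] only the coset of [x]
   contributes. *)
apply/ffunP => x; rewrite sum_ffunE (bigD1 (x *: H)%g) /=; last first.
  by apply/lcosetsP; exists x.
rewrite gelt_mulE ffunE gelt_mulE invgK mulKVg.
have [C1 C1H xC1] := lcosets_repr_surj (subsetT H) (in_setT x).
rewrite -mem_lcoset repr_lcosetK lcoset_refl big1 ?addr0 // => C /andP[CG Cx].
rewrite gelt_mulE ffunE gelt_mulE invgK mulKVg -mem_lcoset (repr_lcosetsK CG).
case: ifP => // xC; case/eqP: Cx; case/lcosetsP: CG xC => y _ -> /lcoset_eqP -> //.
Qed.

End FromInduced.

(** The Higman map of the induced module is compressed to the summand by the inclusion and the
    retraction. *)
Lemma relatively_projective_higman M H : relatively_projective M H ->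
  exists phi : M -> M, higman_map H phi.
Proof.
case=> V [i [q iq]]; have [pB pZ pG pT] := induced_higman V.
exists (fun x => q (induced_proj (i x))); split.
- by move=> x y; rewrite !raddfB pB raddfB.
- by move=> c x; rewrite !linearZ /= pZ linearZ.
- by move=> h x hH; rewrite !linearZ /= pG // linearZ.
move=> x; rewrite -[RHS]iq -[in RHS](pT (i x)) raddf_sum; apply: eq_bigr => C _.
rewrite linearZ; symmetry; exact: linearZ.
Qed.

End Higman.

(** * Interior algebras with local fixed points *)

Lemma minimal_subgroup_exists (gT : finGroupType) (Pr : {group gT} -> Prop)
    (H : {group gT}) : Pr H -> exists2 Q, minimal_subgroup Pr Q & Q \subset H.
Proof.
have [m] := ubnP #|H|; elim: m H => // m IHm H ltHm PrH.
have [minH|/boolp.existsNP[Q /boolp.not_implyP[PrQ /boolp.not_implyP[sQH neQH]]]] :=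
  boolp.pselect (forall Q : {group gT}, Pr Q -> Q \subset H -> Q :=: H).
  by exists H.
have ltQH : Q \proper H by rewrite properEneq sQH andbT; apply/eqP.
have [|Q' minQ' sQ'Q] := IHm Q _ PrQ.
  by apply: leq_trans (proper_card ltQH) _.
by exists Q' => //; apply: subset_trans sQH.
Qed.

Lemma minimal_subgroup_conj (gT : finGroupType) (Pr : {group gT} -> Prop)
    (H : {group gT}) z :
    (forall (Q : {group gT}) u, Pr Q -> Pr (Q :^ u^-1)%G) ->
  minimal_subgroup Pr H -> minimal_subgroup Pr (H :^ z^-1)%G.
Proof.
move=> PrJ [PrH minH]; split; first exact: PrJ.
move=> Q PrQ sQH; apply/eqP; rewrite eqEcard sQH cardJg /=.
have := minH _ (PrJ _ z^-1%g PrQ); rewrite /= invgK => <-; first by rewrite cardJg.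
by rewrite /= ?invgK sub_conjg.
Qed.

Section InteriorAlgebraTheory.
Variables (gT : finGroupType) (A : nzRingType) (iota : gT -> A).
Hypothesis iota1 : iota 1%g = 1.
Hypothesis iotaM : forall x y, iota (x * y)%g = iota x * iota y.
Implicit Types (H P D : {group gT}).
Local Notation cj := (conj_act iota).

(** The predicate whose minimal subgroups are the defect groups of the interior algebra. *)
Definition trace_one H := exists2 a, fixed_by iota H a & rel_trace iota H a = 1.

Lemma iotaV x : iota x * iota x^-1%g = 1.
Proof. by rewrite -iotaM mulgV. Qed.

Lemma iotaVr x : iota x^-1%g * iota x = 1.
Proof. by rewrite -iotaM mulVg. Qed.

Lemma conj_actM x y a : cj (x * y)%g a = cj x (cj y a).
Proof. by rewrite /conj_act invMg !iotaM !mulrA. Qed.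

Lemma conj_act_mul x a b : cj x (a * b) = cj x a * cj x b.
Proof.
by rewrite /conj_act !mulrA -[_ * iota x^-1%g * iota x]mulrA iotaVr mulr1.
Qed.

Lemma conj_act_sum x (T : Type) (r : seq T) (B : pred T) (F : T -> A) :
  cj x (\sum_(t <- r | B t) F t) = \sum_(t <- r | B t) cj x (F t).
Proof. by rewrite /conj_act mulr_sumr mulr_suml. Qed.

Lemma conj_act1 x : cj x 1 = 1.
Proof. by rewrite /conj_act mulr1 iotaV. Qed.

Lemma conj_act_coset_fun H a : fixed_by iota H a -> coset_fun H (fun x => cj x a).
Proof. by move=> aH x h hH; rewrite conj_actM aH. Qed.

Lemma rel_traceE H a : rel_trace iota H a = coset_sum H [set: gT] (fun x => cj x a).
Proof. by []. Qed.

Lemma fixed_rel_trace H a : fixed_by iota H a ->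
  fixed_by iota [set: gT] (rel_trace iota H a).
Proof.
move=> aH x _; rewrite !rel_traceE.
rewrite -[in RHS](@coset_sum_transl _ _ H [set: gT]%G _ x) ?inE ?subsetT //.
  by rewrite /coset_sum conj_act_sum; apply: eq_bigr => C _; rewrite conj_actM.
exact: conj_act_coset_fun.
Qed.

Lemma trace_oneT : trace_one [set: gT].
Proof.
exists 1; first by move=> x _; rewrite conj_act1.
rewrite rel_traceE (@coset_sum_id _ _ [set: gT]%G) ?conj_act1 //.
by move=> x h _; rewrite !conj_act1.
Qed.

Lemma trace_one_conj H z : trace_one H -> trace_one (H :^ z^-1)%G.
Proof.
case=> a aH traH; exists (cj z a).
  move=> x; rewrite mem_conjg invgK => /aH E.
  by rewrite -conj_actM -[(x * z)%g](mulKVg z) -/(conjg x z) conj_actM E.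
rewrite -traH !rel_traceE.
rewrite -[in RHS](@coset_sum_conjr _ _ H [set: gT]%G _ z) ?inE ?subsetT //.
  by apply: eq_coset_sum => [|x _]; [exact: subsetT | rewrite conj_actM].
exact: conj_act_coset_fun.
Qed.

Lemma defect_group_exists H : trace_one H ->
  exists2 Q, defect_group iota Q & Q \subset H.
Proof. exact: minimal_subgroup_exists. Qed.

Lemma defect_group_conj H z : defect_group iota H -> defect_group iota (H :^ z^-1)%G.
Proof. by apply: minimal_subgroup_conj => Q u; apply: trace_one_conj. Qed.

(* Locality of the ring of G-fixed points. *)
Definition local_fixed := forall (T : finType) (B : {pred T}) (c : T -> A),
  (forall t, t \in B -> fixed_by iota [set: gT] (c t)) -> \sum_(t in B) c t = 1 ->
  exists2 t, t \in B & exists2 w, fixed_by iota [set: gT] w & w * c t = 1.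

Hypothesis locA : local_fixed.

(** A form of Rosenberg's lemma: locality gives a left inverse of one of the traces, and this
    inverse, being fixed by the whole group, can be moved inside the trace. *)
Lemma local_trace (T : finType) (B : {pred T}) (R : T -> {group gT}) (d : T -> A) :
    (forall t, t \in B -> fixed_by iota (R t) (d t)) ->
    \sum_(t in B) rel_trace iota (R t) (d t) = 1 ->
  exists2 t, t \in B & trace_one (R t).
Proof.
move=> dR sum1.
have [t tB [w wG w1]] := locA (fun t tB => fixed_rel_trace (dR t tB)) sum1.
exists t => //; exists (w * d t).
  by move=> x xR; rewrite conj_act_mul wG ?inE // dR.
rewrite -w1 /rel_trace mulr_sumr; apply: eq_bigr => C _.
by rewrite conj_act_mul wG ?inE.
Qed.

(** Since Tr_D(c) is fixed by the whole group, 1 = Tr_P(a) Tr_D(c) = Tr_P(a Tr_D(c)). Mackey's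
    formula turns this into a sum of traces from the groups P meet zDz^-1. One of these admits trace
    one, and minimality of [P] makes it equal to [P]. *)
Lemma defect_group_sub_conj P D : defect_group iota P -> trace_one D ->
  exists z, P \subset (D :^ z^-1)%G.
Proof.
case=> [[a aP traP] minP] [c cD trcD].
have cF : coset_fun D (fun x => cj x c) by exact: conj_act_coset_fun.
pose f := idm_morphism P.
pose R z := mackey_stab f D z.
pose d z := a * cj z c.
have dR z : fixed_by iota (R z) (d z).
  move=> y; rewrite mackey_stabP => /andP[yP yD].
  rewrite conj_act_mul aP // -conj_actM; congr (_ * _).
  by rewrite -[(y * z)%g](mulKVg z) conj_actM mulgA [cj _ c]cD.
have [|z zR [b bR trb]] := @local_trace _ [in double_reps f D] R d (fun z _ => dR z).
  rewrite -traP -[RHS]mulr1 -trcD rel_traceE {1}/coset_sum mulr_suml.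
  transitivity (coset_sum P [set: gT] (fun x => cj x (a * rel_trace iota D c))); last first.
    rewrite /coset_sum; apply: eq_bigr => C _.
    by rewrite conj_act_mul (fixed_rel_trace cD) ?inE.
  rewrite rel_traceE (coset_sum_mackey f cF).
  rewrite [RHS](eq_bigr (fun C => \sum_(z in double_reps f D)
     cj (repr C) (coset_sum (R z) P (fun y => cj y (d z))))); last first.
    move=> C _; rewrite mulr_sumr conj_act_sum; apply: eq_bigr => z _.
    congr (cj _ _); rewrite /coset_sum mulr_sumr; apply: eq_bigr => E EP.
    have yP : repr E \in P := repr_lcosets_in (mackey_stab_sub f D z) EP.
    by rewrite conj_act_mul aP // conj_actM.
  rewrite exchange_big /=; apply: eq_bigr => z _.
  rewrite rel_traceE (@coset_sum_trans _ _ (R z) P [set: gT]%G).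
  - apply: eq_bigr => C _; rewrite /coset_sum conj_act_sum.
    by apply: eq_bigr => E _; rewrite conj_actM.
  - exact: mackey_stab_sub.
  - exact: subsetT.
  exact: conj_act_coset_fun.
have RP : R z :=: P.
  by apply: minP; [exists b | exact: mackey_stab_sub].
exists z; apply/subsetP => y yP; move: (yP); rewrite -[in X in X -> _]RP.
by rewrite mackey_stabP yP mem_conjg invgK /conjg mulgA.
Qed.

End InteriorAlgebraTheory.

(** * Absolutely irreducible representations in characteristic zero *)

(* Sealing these maps keeps conversion from unfolding into the group algebra. *)
HB.lock Definition mxrep (R : comNzRingType) (gT : finGroupType) (n : nat)
    (X : gT -> 'M[R]_n) (a : galg R gT) : 'M[R]_n := \sum_g a g *: X g.

HB.lock Definition mxunrep (K : fieldType) (gT : finGroupType) (n : nat)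
    (X : gT -> 'M[K]_n) (Y : 'M[K]_n) : galg K gT :=
  [ffun g => n%:R / #|gT|%:R * \tr (Y *m X g^-1%g) : K].

HB.lock Definition fracg (O : idomainType) (gT : finGroupType) (a : galg O gT) :
  galg {fraction O} gT := galg_frac O gT a.

Section MatrixRep.
Variables (R : comNzRingType) (gT : finGroupType) (n : nat) (X : gT -> 'M[R]_n).
Local Notation A := (galg R gT).

Local Notation mxrep := (mxrep X).

Lemma mxrepE a : mxrep a = \sum_g a g *: X g.
Proof. by rewrite mxrep.unlock. Qed.

Lemma mxrep_is_linear : linear mxrep.
Proof.
move=> c a b; rewrite !mxrepE scaler_sumr -big_split; apply: eq_bigr => g _ /=.
by rewrite !ffunE scalerDl scalerA.
Qed.

HB.instance Definition _ := GRing.isLinear.Build R A 'M[R]_n _ mxrep mxrep_is_linear.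

Lemma mxrep_gelt g : mxrep (gelt R g) = X g.
Proof.
rewrite !mxrepE (bigD1 g) //= big1 ?addr0 ?ffunE ?eqxx ?scale1r //.
by move=> x /negPf xg; rewrite ffunE xg scale0r.
Qed.

Hypothesis X1 : X 1%g = 1%:M.
Hypothesis XM : forall x y, X (x * y)%g = X x *m X y.

Lemma mxrep1 : mxrep 1 = 1%:M.
Proof. by rewrite galg1E mxrep_gelt. Qed.

Lemma mxrepM a b : mxrep (a * b) = mxrep a *m mxrep b.
Proof.
rewrite !mxrepE mulmx_suml.
under eq_bigr => g _ do rewrite galg_mulE scaler_suml.
rewrite exchange_big /=; apply: eq_bigr => y _.
rewrite mulmx_sumr (reindex_inj (mulgI y)) /=; apply: eq_bigr => g _.
by rewrite mulKg XM -scalemxAl -scalemxAr scalerA.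
Qed.

Lemma mxtrace_mxrep a : \tr (mxrep a) = galg_ext (fun g => \tr (X g)) a.
Proof. by rewrite !mxrepE raddf_sum; apply: eq_bigr => g _; rewrite /= mxtraceZ. Qed.

End MatrixRep.

Section AbsIrrRep.
Variables (K : fieldType) (gT : finGroupType) (n : nat).
Hypothesis charK : [pchar K] =i pred0.
Variable (rG : mx_representation K [set: gT] n).
Hypothesis rG_irr : mx_absolutely_irreducible rG.
Local Notation A := (galg K gT).

Lemma natK_eq0 m : (m%:R == 0 :> K) = (m == 0)%N.
Proof. by have /pcharf0P := charK. Qed.

Lemma abs_irr_n_gt0 : (0 < n)%N.
Proof. by case/andP: rG_irr. Qed.

Lemma natn_neq0 : n%:R != 0 :> K.
Proof. by rewrite natK_eq0 -lt0n abs_irr_n_gt0. Qed.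

Lemma card_neq0 : #|gT|%:R != 0 :> K.
Proof. by rewrite natK_eq0 -lt0n; apply/card_gt0P; exists 1%g. Qed.

(** The sum commutes with the representation, so it is scalar by absolute irreducibility; comparing
    traces determines the scalar. *)
Lemma schur_average (Y : 'M[K]_n) :
  \sum_g rG g^-1%g *m Y *m rG g = (#|gT|%:R / n%:R * \tr Y)%:M.
Proof.
set Z := LHS.
have : is_scalar_mx Z.
  apply: (mx_abs_irr_cent_scalar rG_irr); apply/centgmxP => h _.
  rewrite /Z mulmx_suml mulmx_sumr (reindex_inj (mulIg h^-1%g)) /=.
  apply: eq_bigr => g _.
  rewrite invMg invgK !repr_mxM ?inE // -!mulmxA; congr (_ *m (_ *m (_ *m _))).
  by rewrite -repr_mxM ?inE // mulVg repr_mx1 mulmx1.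
case/is_scalar_mxP => c Zc.
have : \tr Z = #|gT|%:R * \tr Y.
  rewrite /Z raddf_sum /= (eq_bigr (fun=> \tr Y)).
    by rewrite sumr_const mulr_natl; congr (_ *+ _); apply: eq_card.
  move=> g _; rewrite mxtrace_mulC mulmxA -repr_mxM ?inE // mulgV repr_mx1.
  by rewrite mul1mx.
rewrite Zc mxtrace_scalar => cE; congr (_%:M).
by rewrite mulrAC -cE -[c *+ n]mulr_natr mulfK ?natn_neq0.
Qed.

Local Notation RX := (mxrep rG).
Definition deg_ratio : K := n%:R / #|gT|%:R.

(* A section of rG : K[gT] -> 'M_n whose image is the two-sided ideal of K[gT]
   on which rG is faithful. *)
Local Notation mxunrep := (mxunrep rG).

Lemma mxunrepE Y g : mxunrep Y g = deg_ratio * \tr (Y *m rG g^-1%g).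
Proof. by rewrite mxunrep.unlock ffunE. Qed.

Lemma mxunrep_is_linear : linear mxunrep.
Proof.
move=> c Y Z; apply/ffunP => g; rewrite !(mxunrepE, ffunE) mulmxDl mxtraceD -scalemxAl.
by rewrite mxtraceZ mulrDr /GRing.scale /= mulrCA.
Qed.

HB.instance Definition _ :=
  GRing.isLinear.Build K 'M[K]_n A _ mxunrep mxunrep_is_linear.

Lemma mul_mxunrep (a : A) Y : a * mxunrep Y = mxunrep (RX a *m Y).
Proof.
rewrite {1}[a]galg_sum mxrepE mulr_suml mulmx_suml raddf_sum /=.
apply: eq_bigr => h _; rewrite -scalerAl -scalemxAl linearZ /=; congr (_ *: _).
apply/ffunP => g; rewrite gelt_mulE !mxunrepE invMg invgK repr_mxM ?inE //.
by congr (_ * _); rewrite mulmxA mxtrace_mulC mulmxA.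
Qed.

Lemma mxunrep_mul (a : A) Y : mxunrep Y * a = mxunrep (Y *m RX a).
Proof.
rewrite {1}[a]galg_sum mxrepE mulr_sumr mulmx_sumr raddf_sum /=.
apply: eq_bigr => h _; rewrite -scalerAr -scalemxAr linearZ /=; congr (_ *: _).
apply/ffunP => g; rewrite mul_geltE !mxunrepE invMg invgK repr_mxM ?inE //.
by rewrite mulmxA.
Qed.

(** Fourier inversion on one matrix block. Averaging a matrix unit gives Schur's orthogonality
    relations [orth], and summing these against the entries of [Y] returns [Y]. *)
Lemma mxunrepK Y : RX (mxunrep Y) = Y.
Proof.
apply/matrixP => l j; rewrite !mxrepE summxE.
under eq_bigr => g _ do rewrite mxE mxunrepE.
have mul_delta (B C : 'M[K]_n) i k l' j' :
    (B *m delta_mx k l' *m C) i j' = B i k * C l' j'.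
  rewrite -(mul_delta_mx (0 : 'I_1)) mulmxA -mulmxA -colE -rowE.
  by rewrite mxE big_ord1 !mxE.
have orth i k l' j' : \sum_g rG g^-1%g i k * rG g l' j' =
    #|gT|%:R / n%:R * ((k == l') && (i == j'))%:R.
  have /matrixP/(_ i j') := schur_average (delta_mx k l').
  rewrite summxE mxE => E; rewrite -(eq_bigr _ (fun g _ => mul_delta _ _ _ _ _ _)) E.
  rewrite /mxtrace (bigD1 k) //= big1 ?addr0 => [|t /negPf tk]; last first.
    by rewrite mxE tk.
  rewrite mxE eqxx /= -mulrnAr; congr (_ * _); do 2!case: (_ == _) => //.
transitivity (deg_ratio * \sum_i \sum_k Y k i * \sum_g (rG g^-1%g i k * rG g l j)).
  rewrite mulr_sumr.
  under eq_bigr => g _ do rewrite /mxtrace mulr_sumr mulr_suml.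
  rewrite exchange_big /=.
  transitivity (\sum_(k < n) \sum_g \sum_i deg_ratio * (Y k i * (rG g^-1%g i k * rG g l j))).
    apply: eq_bigr => k _; apply: eq_bigr => g _; rewrite mxE mulr_sumr mulr_suml.
    by apply: eq_bigr => i _; rewrite !mulrA.
  rewrite (eq_bigr _ (fun k _ => exchange_big _ _ _ _ _ _))  /=.
  rewrite exchange_big /=; apply: eq_bigr => i _; rewrite mulr_sumr.
  by apply: eq_bigr => k _; rewrite !mulr_sumr.
under eq_bigr => i _ do under eq_bigr => k _ do rewrite orth.
rewrite (bigD1 j) //= (bigD1 l) //= !eqxx big1 ?addr0 => [|k /negPf kl]; last first.
  by rewrite kl !mulr0.
rewrite big1 ?addr0 => [|i /negPf ij]; last first.
  by apply: big1 => k _; rewrite ij andbF !mulr0.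
by rewrite mulr1 /deg_ratio mulrCA [X in Y l j * X]mulrA divfK ?card_neq0 // mulfV
  ?natn_neq0 ?mulr1.
Qed.

Lemma mxunrep1_idem : mxunrep 1%:M * mxunrep 1%:M = mxunrep 1%:M.
Proof. by rewrite mul_mxunrep mxunrepK mul1mx. Qed.

Lemma mxunrep1_mulC a : mxunrep 1%:M * a = a * mxunrep 1%:M.
Proof. by rewrite mxunrep_mul mul_mxunrep mul1mx mulmx1. Qed.

(** With u = [mxunrep 1%:M], primitivity applied to e = eu + e(1 - u) leaves e = eu, since the trace
    rules out eu = 0. The matrix of e is then a scalar idempotent of non-zero trace, hence the
    identity. *)
Lemma pcidem_mxunrep (e : pcidem A) : \tr (RX (pcidem_val e)) != 0 ->
  pcidem_val e = mxunrep 1%:M.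
Proof.
move=> tre; have [e0 [ee eC] eprim] := pcidemP e.
set u := mxunrep 1%:M; set ev := pcidem_val e in e0 ee eC eprim tre *.
have eu : ev * u = mxunrep (RX ev) by rewrite mul_mxunrep mulmx1.
have eu0 : ev * u <> 0.
  by move=> E; move: tre; rewrite -[RX ev]mxunrepK -eu E raddf0 mxtrace0 eqxx.
have ci a : a * a = a -> (forall x, a * x = x * a) ->
    central_idempotent (ev * a).
  move=> aa aC; split=> [|x];
    first by rewrite -mulrA [a * _]mulrA -[a * ev]eC !mulrA ee -mulrA aa.
  by rewrite -mulrA aC mulrA eC mulrA.
have uu : u * u = u := mxunrep1_idem.
have : ev * u = 0 \/ ev * (1 - u) = 0.
  apply: eprim.
  - exact: ci uu mxunrep1_mulC.
  - apply: ci => [|x]; first by rewrite mulrBl mul1r mulrBr mulr1 uu subrr subr0.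
    by rewrite mulrBl mulrBr mulr1 mul1r mxunrep1_mulC.
  - rewrite -mulrA [u * _]mulrA mxunrep1_mulC -!mulrA mulrBr mulr1 uu subrr.
    by rewrite !mulr0.
  - by rewrite -mulrDr addrC subrK mulr1.
case=> [//|E].
have {}E : ev = ev * u by apply/eqP; rewrite -subr_eq0 -{1}[ev]mulr1 -mulrBr E.
have : is_scalar_mx (RX ev).
  apply: (mx_abs_irr_cent_scalar rG_irr); apply/centgmxP => h _.
  rewrite -[in LHS]mxrep_gelt -[in RHS]mxrep_gelt.
  have rM := mxrepM (fun x y => repr_mxM rG (in_setT x) (in_setT y)).
  by rewrite -!rM eC.
case/is_scalar_mxP => c cE.
have : c%:M = c%:M *m c%:M :> 'M_n.
  have rM := mxrepM (fun x y => repr_mxM rG (in_setT x) (in_setT y)).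
  by rewrite -cE -rM ee.
have n0 := abs_irr_n_gt0.
rewrite -scalar_mxM => /matrixP/(_ (Ordinal n0) (Ordinal n0)); rewrite !mxE eqxx !mulr1n => cc.
have c0 : c != 0 by apply: contraNneq tre => c0; rewrite cE c0 mxtrace_scalar mul0rn.
have c1 : c = 1 by apply: (mulfI c0); rewrite mulr1.
by rewrite E eu cE c1.
Qed.

Lemma mxtrace_nondegenerate (Y : 'M[K]_n) :
  (forall Z, \tr (Y *m Z) = 0) -> Y = 0.
Proof.
move=> trY; apply/matrixP => i j; rewrite mxE -(trY (delta_mx j i)).
rewrite /mxtrace (bigD1 i) //= big1 ?addr0 => [|t /negPf ti].
  rewrite mxE (bigD1 j) //= big1 ?addr0 ?mxE ?eqxx ?mulr1 // => k /negPf kj.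
  by rewrite mxE kj mulr0.
by rewrite mxE big1 // => k _; rewrite mxE ti andbF mulr0.
Qed.

(* A representation of the same degree and trace has the same kernel on K[gT],
   hence an enveloping algebra of the same dimension. *)
Lemma same_trace_abs_irr (rH : mx_representation K [set: gT] n) :
  (forall g, \tr (rH g) = \tr (rG g)) -> mx_absolutely_irreducible rH.
Proof.
move=> trE; rewrite /mx_absolutely_irreducible abs_irr_n_gt0 /=.
case/andP: rG_irr => _ fullG.
have rM := mxrepM (fun x y => repr_mxM rG (in_setT x) (in_setT y)).
have rM' := mxrepM (fun x y => repr_mxM rH (in_setT x) (in_setT y)).
have mulE (r : mx_representation K [set: gT] n) (v : 'rV[K]_#|[set: gT]|) :
    v *m enveloping_algebra_mx r = mxvec (mxrep r [ffun g => v 0 (gring_index [set: gT] g)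
      : K]).
  rewrite !mxrepE (mulmx_sum_row v) raddf_sum /= (reindex (@gring_index _ [set: gT])) /=;
    last first.
    exists (@enum_val _ (mem [set: gT])) => x _; first by rewrite gring_indexK ?inE.
    by rewrite /gring_index enum_valK_in.
  by apply: eq_bigr => g _; rewrite ffunE linearZ rowK /= gring_indexK ?inE.
(* If [rH] kills [a], then tr(rG(a) Z) = 0 for every Z, because Z is rG of [mxunrep Z] and both
   representations have the same trace on the group algebra. The trace form then gives rG(a) = 0. *)
have : (kermx (enveloping_algebra_mx rH) <= kermx (enveloping_algebra_mx rG))%MS.
  apply/rV_subP => v /sub_kermxP; rewrite mulE => /eqP; rewrite mxvec_eq0 => /eqP v0.
  apply/sub_kermxP; rewrite mulE; set a := finfun _ in v0 *.
  rewrite (_ : mxrep rG a = 0) ?linear0 //.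
  apply: mxtrace_nondegenerate => Z.
  rewrite -[Z]mxunrepK -rM mxtrace_mxrep -[RHS](mxtrace0 _ n) -(mul0mx _ (mxrep rH (mxunrep
    Z))).
  by rewrite -v0 -rM' mxtrace_mxrep; apply: eq_bigr => g _; rewrite trE.
move/mxrankS; rewrite !mxrank_ker leq_sub2lE ?rank_leq_row // => le.
by rewrite /row_full eqn_leq rank_leq_col; apply: leq_trans le; rewrite (eqP fullG).
Qed.

End AbsIrrRep.

(** * OGe as an order of matrices *)

Section ResidueField.
Variables (O : idomainType) (k : fieldType) (res : {rmorphism O -> k}).
Hypothesis res_map : residue_map res.

Lemma unit_res x : (x \is a GRing.unit) = (res x != 0).
Proof.
have [_ /(_ x) [r0 r1]] := res_map.
apply/idP/idP => [xU|]; first by apply/eqP => /r0; rewrite xU.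
by apply: contra_neqT => xU; apply: r1.
Qed.

(** Locality of [O]: a sum of non-units reduces to 0, not to 1. *)
Lemma sum_eq1_unit (T : finType) (B : {pred T}) (c : T -> O) :
  \sum_(t in B) c t = 1 -> exists2 t, t \in B & c t \is a GRing.unit.
Proof.
move=> s1; have [/exists_inP[t tB tU]|/exists_inPn noU] := boolP [exists t in B, c t \is a
  GRing.unit].
  by exists t.
have /eqP := congr1 res s1; rewrite rmorph_sum big1 /=; last first.
  by move=> t /noU; rewrite unit_res negbK => /eqP.
by rewrite rmorph1 eq_sym oner_eq0.
Qed.

End ResidueField.

Lemma uniformizer_divides_total (O : idomainType) (pi : O) (x y : O) :
  uniformizer pi -> divides x y \/ divides y x.
Proof.
case=> pi0 _ piP.
have [->|x0] := eqVneq x 0; first by right; exists 0; rewrite mulr0.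
have [->|y0] := eqVneq y 0; first by left; exists 0; rewrite mulr0.
have [i [u [uU ->]]] := piP x x0; have [j [v [vU ->]]] := piP y y0.
have key (i' j' : nat) (u' v' : O) : (i' <= j')%N -> u' \is a GRing.unit ->
    divides (u' * pi ^+ i') (v' * pi ^+ j').
  move=> le uU'; exists (u'^-1 * v' * pi ^+ (j' - i')).
  rewrite mulrACA [u' * _]mulrA divrr ?mul1r // -exprD subnKC //.
by case/orP: (leq_total i j) => le; [left | right]; apply: key.
Qed.

Lemma tofrac_inj (O : idomainType) : injective (@tofrac O).
Proof. by move=> x y /eqP; rewrite tofrac_eq => /eqP. Qed.

Section FractionAlgebra.
Variables (O : idomainType) (gT : finGroupType).

Lemma fracg_is_zmod_morphism : zmod_morphism (@fracg O gT).
Proof. by rewrite fracg.unlock; apply: rmorphB. Qed.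

Lemma fracg_is_monoid_morphism : monoid_morphism (@fracg O gT).
Proof. by rewrite fracg.unlock; split; [apply: rmorph1 | apply: rmorphM]. Qed.

HB.instance Definition _ := GRing.isZmodMorphism.Build
  (galg O gT) (galg {fraction O} gT) (@fracg O gT) fracg_is_zmod_morphism.
HB.instance Definition _ := GRing.isMonoidMorphism.Build
  (galg O gT) (galg {fraction O} gT) (@fracg O gT) fracg_is_monoid_morphism.

Lemma fracgE (a : galg O gT) g : fracg a g = tofrac (a g).
Proof.
rewrite fracg.unlock /galg_frac /= /galg_map sum_ffunE (bigD1 g) //= big1.
  by rewrite addr0 galg_scaleE ffunE eqxx mulr1.
by move=> h /negPf hg; rewrite galg_scaleE ffunE eq_sym hg mulr0.
Qed.

Lemma fracg_gelt (g : gT) : fracg (gelt O g) = gelt {fraction O} g.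
Proof. by rewrite fracg.unlock galg_frac_gelt. Qed.

Lemma fracgZ c (a : galg O gT) : fracg (c *: a) = tofrac c *: fracg a.
Proof. by rewrite fracg.unlock galg_frac_scale. Qed.

Lemma fracg_inj : injective (@fracg O gT).
Proof.
move=> a b /ffunP E; apply/ffunP => g; have := E g; rewrite !fracgE.
exact: tofrac_inj.
Qed.

End FractionAlgebra.

Section MatrixModel.
Variables (O : idomainType) (gT : finGroupType) (n : nat).
Local Notation K := {fraction O}.
Variable X : gT -> 'M[O]_n.
Hypothesis X1 : X 1%g = 1%:M.
Hypothesis XM : forall x y, X (x * y)%g = X x *m X y.

Definition fracX (g : gT) : 'M[K]_n := map_mx (@tofrac O) (X g).

Lemma fracX_repr : mx_repr [set: gT] fracX.
Proof.
by split=> [|x y _ _]; rewrite /fracX ?X1 ?XM ?map_mxM // map_mx1.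
Qed.

Definition fracX_rep := MxRepresentation fracX_repr.

Hypothesis charK : [pchar K] =i pred0.
Hypothesis irrX : mx_absolutely_irreducible fracX_rep.
Local Notation RK := (mxrep fracX_rep).
Local Notation RO := (mxrep X).

Lemma mxrep_frac a : RK (fracg a) = map_mx (@tofrac O) (RO a).
Proof.
rewrite !mxrepE map_mx_sum.
by apply: eq_bigr => g _; rewrite fracgE map_mxZ.
Qed.

Lemma map_frac_inj m1 m2 : injective (@map_mx _ _ (@tofrac O) m1 m2).
Proof.
move=> Y Z /matrixP E; apply/matrixP => i j; have := E i j; rewrite !mxE.
exact: tofrac_inj.
Qed.

Variable e : pcidem (galg K gT).
Hypothesis eE : pcidem_val e = mxunrep fracX_rep 1%:M.

Lemma mul_pcidem a : a * pcidem_val e = mxunrep fracX_rep (RK a).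
Proof. by rewrite eE mul_mxunrep mulmx1. Qed.

Lemma mxrep_pcidem : RK (pcidem_val e) = 1%:M.
Proof. by rewrite eE mxunrepK. Qed.

Lemma OGe_val a : val (corner_elt (galg_frac O gT) e a) = fracg a * pcidem_val e.
Proof. by rewrite fracg.unlock. Qed.

Lemma OGe_valM (x y : OGe e) : val (x * y) = val x * val y.
Proof. by []. Qed.

Lemma OGe_valB (x y : OGe e) : val (x - y) = val x - val y.
Proof. by []. Qed.

Lemma OGe_lift (x : OGe e) : exists a, x = corner_elt (galg_frac O gT) e a.
Proof.
by case: x => v vP; case/corner_predP: (vP) => a va; exists a; apply: val_inj.
Qed.

(** The matrix is read off a chosen preimage in the group algebra; [OGe_mx_elt] shows that the
    choice does not matter. *)
Definition OGe_mx (x : OGe e) : 'M[O]_n := RO (projT1 (boolp.cid (OGe_lift x))).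

Lemma mxrep_fracM (a b : galg K gT) : RK (a * b) = RK a *m RK b.
Proof. by apply: mxrepM => x y; rewrite repr_mxM ?inE. Qed.

Lemma mxrep_mul_pcidem a : RK (a * pcidem_val e) = RK a.
Proof. by rewrite mxrep_fracM mxrep_pcidem mulmx1. Qed.

Lemma OGe_mx_elt a : OGe_mx (corner_elt _ e a) = RO a.
Proof.
rewrite /OGe_mx; case: boolp.cid => b /= ab.
have E : fracg a * pcidem_val e = fracg b * pcidem_val e by rewrite -!OGe_val ab.
apply: map_frac_inj; rewrite -!mxrep_frac.
by rewrite -[LHS]mxrep_mul_pcidem -[RHS]mxrep_mul_pcidem -E.
Qed.

Lemma OGe_mx1 : OGe_mx 1 = 1%:M.
Proof. by rewrite -[1 : OGe e]/(corner_elt _ e 1) OGe_mx_elt mxrep1. Qed.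

(** By [mul_pcidem] the element ae is recovered from the matrix of a through [mxunrep]. *)
Lemma OGe_mx_inj : injective OGe_mx.
Proof.
move=> x y; case: (OGe_lift x) (OGe_lift y) => [a ->] [b ->]; rewrite !OGe_mx_elt => E.
by apply: val_inj; rewrite !OGe_val !mul_pcidem !mxrep_frac E.
Qed.

Lemma OGe_mxM x y : OGe_mx (x * y) = OGe_mx x *m OGe_mx y.
Proof.
case: (OGe_lift x) (OGe_lift y) => [a ->] [b ->]; rewrite !OGe_mx_elt -mxrepM //.
rewrite -OGe_mx_elt; congr OGe_mx; apply: val_inj.
rewrite OGe_valM !OGe_val rmorphM -!mulrA; congr (_ * _).
by rewrite pcidemC -mulrA pcidem_idem.
Qed.

Lemma OGe_mxB : zmod_morphism OGe_mx.
Proof.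
move=> x y; case: (OGe_lift x) (OGe_lift y) => [a ->] [b ->]; rewrite !OGe_mx_elt -linearB.
rewrite /= -OGe_mx_elt; congr OGe_mx; apply: val_inj.
by rewrite OGe_valB !OGe_val rmorphB mulrBl.
Qed.

HB.instance Definition _ :=
  GRing.isZmodMorphism.Build (OGe e) 'M[O]_n OGe_mx OGe_mxB.

Lemma OGe_mx_sum (T : Type) (r : seq T) (B : pred T) (F : T -> OGe e) :
  OGe_mx (\sum_(t <- r | B t) F t) = \sum_(t <- r | B t) OGe_mx (F t).
Proof. exact: raddf_sum. Qed.

Lemma OGe_mxG g : OGe_mx (OGe_elt e g) = X g.
Proof. by rewrite OGe_mx_elt mxrep_gelt. Qed.

Lemma OGe_elt1 : OGe_elt e 1 = 1.
Proof. by apply: OGe_mx_inj; rewrite [RHS]OGe_mx1 OGe_mxG X1. Qed.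

Lemma OGe_eltM x y : OGe_elt e (x * y) = OGe_elt e x * OGe_elt e y.
Proof. by apply: OGe_mx_inj; rewrite OGe_mxM !OGe_mxG. Qed.

Lemma OGe_mx_conj g x : OGe_mx (conj_act (OGe_elt e) g x) = X g *m OGe_mx x *m X g^-1%g.
Proof. by rewrite !OGe_mxM !OGe_mxG. Qed.

Definition OGe_scalar (c : O) : OGe e := corner_elt _ e c%:A.

Lemma OGe_mx_scalar c : OGe_mx (OGe_scalar c) = c%:M.
Proof. by rewrite OGe_mx_elt linearZ /= mxrep1 // scalemx1. Qed.

Lemma OGe_scalar_fixed c H : fixed_by (OGe_elt e) H (OGe_scalar c).
Proof.
move=> h _; apply: OGe_mx_inj.
by rewrite OGe_mx_conj OGe_mx_scalar scalar_mxC -mulmxA -XM mulgV X1 mulmx1.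
Qed.

(** Schur's lemma over the fraction field makes the matrix scalar, and the scalar lies in [O] as a
    diagonal entry of an integral matrix. *)
Lemma OGe_center x : fixed_by (OGe_elt e) [set: gT] x -> exists c, x = OGe_scalar c.
Proof.
move=> xG; have n0 : (0 < n)%N by apply: abs_irr_n_gt0 irrX.
have : is_scalar_mx (map_mx (@tofrac O) (OGe_mx x)).
  apply: (mx_abs_irr_cent_scalar irrX); apply/centgmxP => h _.
  rewrite /= /fracX -!map_mxM; congr (map_mx _ _).
  have := congr1 OGe_mx (xG h (in_setT h)); rewrite OGe_mx_conj => {1}<-.
  by rewrite -mulmxA -XM mulVg X1 mulmx1.
case/is_scalar_mxP => c cE.
pose i0 := Ordinal n0; exists (OGe_mx x i0 i0); apply: OGe_mx_inj.
apply: map_frac_inj; rewrite OGe_mx_scalar map_scalar_mx /= cE.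
by have /matrixP/(_ i0 i0) := cE; rewrite !mxE eqxx mulr1n => ->.
Qed.

Section Local.
Variables (k : fieldType) (res : {rmorphism O -> k}).
Hypothesis res_map : residue_map res.

Lemma OGe_local_fixed : local_fixed (OGe_elt e).
Proof.
move=> T B c cG sum1.
have /boolp.choice[l lP] : forall t, exists l, t \in B -> c t = OGe_scalar l.
  move=> t; case: (boolP (t \in B)) => [/cG/OGe_center[l]|_]; first by exists l.
  by exists 0.
have n0 : (0 < n)%N by apply: abs_irr_n_gt0 irrX.
have : \sum_(t in B) l t = 1.
  have /matrixP/(_ (Ordinal n0) (Ordinal n0)) := congr1 OGe_mx sum1.
  rewrite raddf_sum /= summxE OGe_mx1 mxE eqxx mulr1n => <-.
  by apply: eq_bigr => t tB; rewrite lP // OGe_mx_scalar mxE eqxx mulr1n.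
case/(sum_eq1_unit res_map) => t tB tU; exists t => //.
exists (OGe_scalar (l t)^-1); first exact: OGe_scalar_fixed.
by apply: OGe_mx_inj; rewrite lP // OGe_mxM !OGe_mx_scalar -scalar_mxM mulVr ?OGe_mx1.
Qed.

End Local.

(** The trace condition in terms of [X] alone: in this form it is passed on to the lattice and to
    the reduction, and [mx_trace_one] takes it back from the block. *)
Lemma trace_one_mx (P : {group gT}) : trace_one (OGe_elt e) P ->
  exists a, (forall h, h \in P -> X h *m RO a = RO a *m X h) /\
    coset_sum P [set: gT] (fun x => X x *m RO a *m X x^-1%g) = 1%:M.
Proof.
case=> x xP tr1; have [a xa] := OGe_lift x; exists a; split=> [h hP|].
  have := congr1 OGe_mx (xP h hP); rewrite OGe_mx_conj xa OGe_mx_elt => E.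
  by rewrite -[in RHS]E -[_ *m X h^-1%g *m _]mulmxA -XM mulVg X1 mulmx1.
have := congr1 OGe_mx tr1; rewrite OGe_mx1 raddf_sum /= => <-.
by apply: eq_bigr => C _; rewrite OGe_mx_conj xa OGe_mx_elt.
Qed.

Lemma mx_trace_one (P : {group gT}) a :
    (forall h, h \in P -> X h *m RO a = RO a *m X h) ->
    coset_sum P [set: gT] (fun x => X x *m RO a *m X x^-1%g) = 1%:M ->
  trace_one (OGe_elt e) P.
Proof.
move=> aP tr1; exists (corner_elt _ e a) => [h hP|]; apply: OGe_mx_inj.
  by rewrite OGe_mx_conj OGe_mx_elt aP // -mulmxA -XM mulgV X1 mulmx1.
rewrite OGe_mx1 -tr1 raddf_sum; apply: eq_bigr => C _ /=.
by rewrite OGe_mx_conj OGe_mx_elt.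
Qed.

End MatrixModel.

(** * Lattices and blocks *)

Section LatticeMatrices.
Variables (O : idomainType) (gT : finGroupType) (L : lmodType (galg O gT)).
Variables (n : nat) (v : 'I_n -> L) (X : gT -> 'M[O]_n).
Hypothesis v_basis : O_basis v.
Hypothesis vX : forall g i, gelt O g *: v i = \sum_l (X g l i)%:A *: v l.
Local Notation A := (galg O gT).

Definition lin_comb (c : 'I_n -> O) : L := \sum_i (c i)%:A *: v i.

Lemma lin_comb_inj c d : lin_comb c = lin_comb d -> c =1 d.
Proof.
move=> cd; have [f [_ fU]] := v_basis (lin_comb c).
have E c' : lin_comb c' = lin_comb c -> f = finfun c'.
  by move=> E'; apply: fU; rewrite -E'; apply: eq_bigr => i _; rewrite ffunE.
by move=> i; have /ffunP/(_ i) := etrans (esym (E c erefl)) (E d (esym cd)); rewrite !ffunE.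
Qed.

Lemma scale_lin_comb (a : A) i : a *: v i = lin_comb (fun l => mxrep X a l i).
Proof.
rewrite galg_scale_sum /lin_comb.
transitivity (\sum_g \sum_l (a g * X g l i)%:A *: v l).
  apply: eq_bigr => g _; rewrite vX scaler_sumr; apply: eq_bigr => l _.
  by rewrite scalerA -scalerAl mul1r scalerA.
rewrite exchange_big; apply: eq_bigr => l _ /=.
rewrite -scaler_suml mxrepE summxE -scaler_suml; congr (_ *: _ *: _).
by apply: eq_bigr => g _; rewrite mxE.
Qed.

Lemma lattice_mx1 : X 1%g = 1%:M.
Proof.
apply/matrixP => l i; rewrite -[X 1%g]mxrep_gelt -galg1E.
have E : lin_comb (fun l => mxrep X 1 l i) = lin_comb (fun l => 1%:M l i).
  rewrite -scale_lin_comb scale1r /lin_comb (bigD1 i) //= big1 ?addr0.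
    by rewrite mxE eqxx !scale1r.
  by move=> l' /negPf li; rewrite mxE li !scale0r.
exact: lin_comb_inj E l.
Qed.

Lemma lattice_mxM x y : X (x * y)%g = X x *m X y.
Proof.
apply/matrixP => l i.
have E : lin_comb (fun l => X (x * y)%g l i) = lin_comb (fun l => (X x *m X y) l i).
  rewrite /lin_comb -vX geltM -scalerA vX scaler_sumr.
  transitivity (\sum_j \sum_l (X x l j * X y j i)%:A *: v l).
    apply: eq_bigr => j _; rewrite scalerA -galg_algC -scalerA vX scaler_sumr.
    by apply: eq_bigr => m _; rewrite scalerA -scalerAl mul1r scalerA mulrC.
  rewrite exchange_big; apply: eq_bigr => m _ /=.
  by rewrite -scaler_suml -scaler_suml mxE.
exact: lin_comb_inj E l.
Qed.

Lemma mxrep0_scale (a : A) : mxrep X a = 0 -> forall y : L, a *: y = 0.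
Proof.
move=> a0 y; have [c [-> _]] := v_basis y; rewrite scaler_sumr big1 // => i _.
rewrite scalerA -galg_algC -scalerA scale_lin_comb /lin_comb big1 ?scaler0 // => l _.
by rewrite a0 mxE !scale0r.
Qed.

Lemma mxrep_eq_scale (a b : A) : mxrep X a = mxrep X b -> forall y : L, a *: y = b *: y.
Proof.
move=> ab y; apply/eqP; rewrite -subr_eq0 -scalerBl mxrep0_scale //.
by rewrite linearB /= ab subrr.
Qed.

(** The group algebra acts on the lattice through its matrices, so multiplication by [a] inherits
    both identities even if [P] does not centralise [a] in the group algebra. *)
Lemma lattice_higman (P : {group gT}) (a : A) :
    (forall h, h \in P -> X h *m mxrep X a = mxrep X a *m X h) ->
    coset_sum P [set: gT] (fun x => X x *m mxrep X a *m X x^-1%g) = 1%:M ->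
  higman_map P (fun y : L => a *: y).
Proof.
have rM := mxrepM lattice_mxM.
move=> aP a1; split.
- by move=> x y; rewrite scalerBr.
- by move=> c x; rewrite !scalerA galg_algC.
- move=> h x hP; rewrite !scalerA; apply: mxrep_eq_scale.
  by rewrite !rM mxrep_gelt aP.
move=> x; rewrite -[RHS]scale1r.
transitivity ((\sum_(C in lcosets P [set: gT])
   gelt O (repr C) * a * gelt O (repr C)^-1%g : A) *: x).
  by rewrite scaler_suml; apply: eq_bigr => C _; rewrite !scalerA.
apply: mxrep_eq_scale; rewrite mxrep1 ?lattice_mx1 // -a1 linear_sum /=.
by apply: eq_bigr => C _; rewrite !rM !mxrep_gelt.
Qed.

End LatticeMatrices.

Section BlockTrace.
Variables (O : idomainType) (gT : finGroupType) (n : nat) (X : gT -> 'M[O]_n).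
Hypothesis X1 : X 1%g = 1%:M.
Hypothesis XM : forall x y, X (x * y)%g = X x *m X y.
Variable b : pcidem (galg O gT).
Hypothesis bX : mxrep X (pcidem_val b) = 1%:M.

Lemma block_elt1 : block_elt b 1 = 1.
Proof. by []. Qed.

Lemma block_eltM x y : block_elt b (x * y) = block_elt b x * block_elt b y.
Proof.
apply: val_inj; rewrite /= geltM -!mulrA; congr (_ * _).
by rewrite [RHS]pcidemC -mulrA pcidem_idem.
Qed.

(** As [b] acts by the identity matrix, [X] extends to a unital ring morphism from the block to
    matrices; it respects conjugation and therefore relative traces. *)
Lemma block_trace_mx (D : {group gT}) : trace_one (block_elt b) D ->
  exists a, (forall h, h \in D -> X h *m mxrep X a = mxrep X a *m X h) /\
    coset_sum D [set: gT] (fun x => X x *m mxrep X a *m X x^-1%g) = 1%:M.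
Proof.
have XV x : X x^-1%g *m X x = 1%:M by rewrite -XM mulVg X1.
pose m (c : block b) := mxrep X (corner_val c).
have mM c d : m (c * d) = m c *m m d by rewrite /m corner_valM mxrepM.
have mG g : m (block_elt b g) = X g.
  by rewrite /m /= mxrepM // bX mulmx1 mxrep_gelt.
have mJ g c : m (conj_act (block_elt b) g c) = X g *m m c *m X g^-1%g.
  by rewrite !mM !mG.
case=> c cD tr1; exists (corner_val c); split=> [h hD|].
  have := congr1 m (cD h hD); rewrite mJ -/(m c) => E.
  by rewrite -[in RHS]E -[_ *m X h^-1%g *m _]mulmxA XV mulmx1.
have mD : {morph m : c d / c + d} by move=> c1 c2; rewrite /m -linearD.
have m0 : m 0 = 0 by apply: linear0.
have := congr1 m tr1; rewrite {2}/m corner_val1 bX => <-.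
by rewrite /rel_trace (big_morph m mD m0); apply: eq_bigr => C _; rewrite mJ.
Qed.

End BlockTrace.

(** * Group algebras of p-groups *)

Lemma pgroup_fixed_vector (k : fieldType) (p : nat) (gT : finGroupType)
    (G : {group gT}) (n : nat) (rG : mx_representation k G n) (U : 'M_n) :
    p \in [pchar k] -> (p.-group G)%g -> mxmodule rG U -> U != 0 ->
  exists2 u : 'rV_n, u != 0 & (u <= U)%MS /\ {in G, forall x, u *m rG x = u}.
Proof.
move=> pk pG modU U0.
have : rfix_mx (submod_repr modU) G != 0.
  by apply: (rfix_pgroup_pchar pk _ _ pG) => //; rewrite lt0n mxrank_eq0.
set F := rfix_mx _ _ => F0; exists (val_submod (nz_row F)).
  by rewrite val_submod_eq0 nz_row_eq0.
split; first exact: val_submodP.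
move=> x xG; rewrite -(val_submodJ modU) //; congr val_submod.
by move: x xG; apply/rfix_mxP; apply: nz_row_sub.
Qed.

Section PGroupAlgebra.
Variables (O : idomainType) (k : fieldType) (res : {rmorphism O -> k}).
Hypothesis res_map : residue_map res.
Variables (p : nat) (pT : finGroupType).
Hypothesis char_k : p \in [pchar k].
Hypothesis p_pT : (p.-group [set: pT])%g.
Local Notation A := (galg O pT).

Definition augment (a : A) : O := \sum_g a g.

Lemma augmentM a b : augment (a * b) = augment a * augment b.
Proof.
rewrite /augment mulr_suml; under eq_bigr do rewrite galg_mulE.
rewrite exchange_big /=; apply: eq_bigr => y _; rewrite mulr_sumr.
by rewrite (reindex_inj (mulgI y)); apply: eq_bigr => x _; rewrite /= mulKg.
Qed.

Lemma augmentD a b : augment (a + b) = augment a + augment b.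
Proof. by rewrite /augment -big_split; apply: eq_bigr => g _; rewrite ffunE. Qed.

Lemma augment1 : augment 1 = 1.
Proof.
rewrite /augment (bigD1 1%g) //= big1 ?addr0 galg1E ?ffunE ?eqxx //.
by move=> g /negPf g1; rewrite ffunE g1.
Qed.

Local Notation N := #|[set: pT]%G|.
Local Notation gi := (gring_index [set: pT]%G).
Let gv (i : 'I_N) : pT := enum_val i.

Let giK g : gv (gi g) = g.
Proof. by rewrite /gv gring_indexK ?inE. Qed.

Let gvK i : gi (gv i) = i.
Proof. by rewrite /gring_index enum_valK_in. Qed.

Let sum_gv (Z : nmodType) (F : pT -> Z) : \sum_(i < N) F (gv i) = \sum_g F g.
Proof.
rewrite (reindex gi) /=; first by apply: eq_bigr => g _; rewrite giK.
by exists gv => x _; rewrite ?giK ?gvK.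
Qed.

(* On coordinate rows, right multiplication by lmul_mx a is b |-> a * b. *)
Definition lmul_mx (a : A) : 'M[O]_N := \matrix_(i, j) a (gv j * (gv i)^-1)%g.

(** The reduced matrix commutes with the regular representation. If it were singular, its kernel
    would contain a non-zero vector fixed by the p-group, that is a constant one; but it multiplies
    constant vectors by the reduced augmentation of [a]. *)
Lemma lmul_mx_unit a : res (augment a) != 0 -> lmul_mx a \in unitmx.
Proof.
move=> a0; rewrite unitmxE (unit_res res_map) -det_map_mx -unitfE -unitmxE.
set W := map_mx res (lmul_mx a).
pose rG := regular_repr k [set: pT]%G.
have rGE (u : 'rV[k]_N) x j : (u *m rG x) 0 j = u 0 (gi (gv j * x^-1)%g).
  rewrite mxE (bigD1 (gi (gv j * x^-1)%g)) //= big1 ?addr0 => [|i ij].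
    by rewrite mxE mxE -/(gv _) giK mulgKV gvK !eqxx mulr1.
  rewrite mxE mxE eqxx /= [_ == _](_ : _ = false) ?mulr0 //.
  by apply: contraNF ij => /eqP ->; rewrite giK mulgK gvK.
have WE (u : 'rV[k]_N) j : (u *m W) 0 j = \sum_g u 0 (gi g) * res (a (gv j * g^-1)%g).
  by rewrite mxE -sum_gv; apply: eq_bigr => i _; rewrite !mxE gvK.
have Wc : centgmx rG W.
  apply/centgmxP => x _; apply/row_matrixP => i; rewrite !rowE !mulmxA.
  set u := delta_mx 0 i; apply/matrixP => z j; rewrite ord1 rGE !WE.
  rewrite [RHS](reindex_inj (mulIg x)) /=; apply: eq_bigr => g _.
  by rewrite rGE !giK mulgK invMg !mulgA.
have [ker0|ker0] := eqVneq (kermx W) 0.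
  by rewrite -row_free_unit -kermx_eq0 ker0.
have [u u0 [/sub_kermxP uW ufix]] :=
  pgroup_fixed_vector char_k p_pT (kermx_centg_module Wc) ker0.
have uc g : u 0 (gi g) = u 0 (gi 1%g).
  have := congr1 (fun w : 'rV_N => w 0 (gi g)) (ufix g (in_setT g)).
  by rewrite /= rGE giK mulgV => ->.
case/negP: u0; apply/eqP/rowP => j; rewrite mxE -(gvK j) uc.
have /rowP/(_ (gi 1%g)) := uW; rewrite WE mxE giK => /eqP.
under eq_bigr do rewrite uc mul1g.
rewrite -mulr_sumr -rmorph_sum (reindex_inj invg_inj) /=.
under eq_bigr do rewrite invgK.
by rewrite mulf_eq0 (negPf a0) orbF => /eqP.
Qed.

Lemma augment_right_inverse a : res (augment a) != 0 -> exists b, a * b = 1.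
Proof.
move/lmul_mx_unit => Wu.
pose w : 'rV[O]_N := delta_mx 0 (gi 1%g) *m invmx (lmul_mx a).
exists [ffun g => w 0 (gi g) : O]; apply/ffunP => x.
have /rowP/(_ (gi x)) : w *m lmul_mx a = delta_mx 0 (gi 1%g) by rewrite mulmxKV.
rewrite [RHS]mxE eqxx /= (_ : (gi x == gi 1%g) = (x == 1%g)); last first.
  by apply/eqP/eqP => [/(congr1 gv)|->//]; rewrite !giK.
rewrite galg1E [gelt _ _ _]ffunE => <-.
rewrite galg_mulE mxE (reindex_inj invg_inj) (reindex_inj (mulIg x^-1)%g) /=.
rewrite -sum_gv; apply: eq_bigr => i _.
by rewrite [lmul_mx _ _ _]mxE giK ffunE invgK invMg invgK mulrC mulgKV gvK.
Qed.

Lemma augment_invertible a : res (augment a) != 0 -> invertible a.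
Proof.
move=> a0; have [b ab] := augment_right_inverse a0.
have [|c bc] := @augment_right_inverse b.
  apply: contra_neq (oner_neq0 k) => b0.
  by rewrite -(rmorph1 res) -augment1 -ab augmentM rmorphM b0 mulr0.
exists b; split=> //; suff -> : a = c by [].
by rewrite -[a]mulr1 -bc mulrA ab mul1r.
Qed.

End PGroupAlgebra.

(** * Reduction modulo the maximal ideal *)

Section Reduction.
Variables (O : idomainType) (k : fieldType) (res : {rmorphism O -> k}).
Hypothesis res_map : residue_map res.
Variables (p : nat) (gT : finGroupType) (n : nat) (X : gT -> 'M[O]_n).
Hypothesis char_k : p \in [pchar k].
Hypothesis X1 : X 1%g = 1%:M.
Hypothesis XM : forall x y, X (x * y)%g = X x *m X y.
Local Notation RO := (mxrep X).

Definition resX (g : gT) : 'M[k]_n := map_mx res (X g).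

Lemma resX_repr : mx_repr [set: gT] resX.
Proof. by split=> [|x y _ _]; rewrite /resX ?X1 ?XM ?map_mxM // map_mx1. Qed.

Definition resX_rep := MxRepresentation resX_repr.

Lemma res_mxrep a : map_mx res (RO a) = \sum_g res (a g) *: resX g.
Proof. by rewrite mxrepE map_mx_sum; apply: eq_bigr => g _; rewrite map_mxZ. Qed.

Lemma res_natr_eq0 m : (res m%:R == 0) = (p %| m)%N.
Proof. by rewrite rmorph_nat (dvdn_pcharf char_k). Qed.

Lemma natr_unit m : (m%:R \is a @GRing.unit O) = ~~ (p %| m)%N.
Proof. by rewrite (unit_res res_map) res_natr_eq0. Qed.

Lemma res_rfix_mul (Q : {group gT}) (w : 'rV[k]_n) a :
    (Q <| [set: gT])%g -> (w <= rfix_mx resX_rep Q)%MS ->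
  (w *m map_mx res (RO a) <= rfix_mx resX_rep Q)%MS.
Proof.
move=> nQ wQ; rewrite res_mxrep mulmx_sumr summx_sub // => g _.
rewrite -scalemxAr scalemx_sub //.
exact: (mxmodule_trans (normal_rfix_mx_module resX_rep nQ) (in_setT g) wQ).
Qed.

(** Suppose [Q] is not inside [P]. For a vector w of the reduction fixed by [Q], the terms [F] x of
    w Tr_P(a) are constant on cosets of PQ, since the fixed space of a normal subgroup is a
    submodule. Their sum is then a multiple of |PQ : P|, which is 0 in [k], although it equals w. *)
Lemma normal_pgroup_sub_anchor (P Q : {group gT}) a : (0 < n)%N -> (p.-group P)%g ->
    (forall h, h \in P -> X h *m RO a = RO a *m X h) ->
    coset_sum P [set: gT] (fun x => X x *m RO a *m X x^-1%g) = 1%:M ->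
    (p.-group Q)%g -> (Q <| [set: gT])%g ->
  Q \subset P.
Proof.
move=> n0 pP aP a1 pQ nQ; apply/idPn => nsQP.
pose rk := resX_rep.
have F0 : rfix_mx rk Q != 0 by apply: (rfix_pgroup_pchar char_k _ n0 pQ); case/andP: nQ.
pose w := nz_row (rfix_mx rk Q); have w0 : w != 0 by rewrite nz_row_eq0.
have wQ : (w <= rfix_mx rk Q)%MS by apply: nz_row_sub.
pose RB := map_mx res (RO a).
pose F x := w *m resX x *m RB *m resX x^-1%g.
have XV x : X x *m X x^-1%g = 1%:M by rewrite -XM mulgV X1.
have resM x y : resX (x * y)%g = resX x *m resX y by rewrite /resX XM map_mxM.
have FP : coset_fun P F.
  move=> x h hP; rewrite /F invMg !resM !mulmxA; congr (_ *m _).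
  rewrite -!mulmxA; congr (_ *m (_ *m _)).
  by rewrite /RB -!map_mxM mulmxA aP // -mulmxA XV mulmx1.
have FQ x q : q \in Q -> F (x * q)%g = F x.
  move=> qQ; rewrite /F invMg !resM !mulmxA.
  have wxQ : (w *m resX x <= rfix_mx rk Q)%MS.
    exact: (mxmodule_trans (normal_rfix_mx_module rk nQ) (in_setT x) wQ).
  have /rfix_mxP/(_ q qQ) /= -> := wxQ.
  have /rfix_mxP/(_ q^-1%g) /= -> := res_rfix_mul a nQ wxQ; rewrite ?groupV //.
have PQE : (P <*> Q)%G :=: (P * Q)%g.
  by rewrite /= norm_joinEl //; apply: subset_trans (subsetT _) (normal_norm nQ).
have FPQ : coset_fun (P <*> Q)%G F.
  move=> x h; rewrite /= PQE => /mulsgP[y q yP qQ ->].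
  by rewrite mulgA FQ // FP.
have sPPQ : P \subset (P <*> Q)%G by apply: joing_subl.
have pPQ : (p.-group (P <*> Q)%G)%g by rewrite /= PQE pgroupM pP.
have dvd_p : (p %| #|(P <*> Q)%G : P|%g)%N.
  have pr_p : prime p by apply: pcharf_prime char_k.
  have := pnat_dvd (dvdn_indexg _ P) pPQ => pI.
  case: (p_natP pI) => -[|m] E; last by rewrite E expnS dvdn_mulr.
  move/eqP: E; rewrite expn0 indexg_eq1 => sPQP.
  by case/negP: nsQP; apply: subset_trans sPQP; apply: joing_subr.
have : map_mx res (1%:M : 'M[O]_n) = map_mx res 1%:M by [].
rewrite -{1}a1 => /(congr1 (mulmx w)).
rewrite map_mx1 mulmx1 (_ : w *m _ = coset_sum P [set: gT]%G F); last first.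
  rewrite /coset_sum map_mx_sum mulmx_sumr; apply: eq_bigr => C _.
  by rewrite !map_mxM !mulmxA.
rewrite (coset_sum_trans sPPQ (subsetT _) FP) /coset_sum big1 => [E|C CG].
  by rewrite -E eqxx in w0.
rewrite (eq_bigr (fun=> F (repr C))).
  rewrite sumr_const card_lcosets -scaler_nat.
  by move: dvd_p; rewrite (dvdn_pcharf char_k) => /eqP ->; rewrite scale0r.
by move=> E EP; rewrite FPQ // (repr_lcosets_in sPPQ EP).
Qed.

End Reduction.

(** For a [P]-fixed [a], the trace of [w * a] from [S] to [P] is w |P : S| a = a; transitivity of
    traces does the rest. *)
Lemma trace_one_sub (gT : finGroupType) (A : nzRingType) (iota : gT -> A)
    (S P : {group gT}) (w : A) :
    iota 1%g = 1 -> (forall x y, iota (x * y)%g = iota x * iota y) ->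
    S \subset P -> fixed_by iota [set: gT] w -> w * #|P : S|%g%:R = 1 ->
  trace_one iota P -> trace_one iota S.
Proof.
move=> i1 iM sSP wG w1 [a aP tra]; have waS : fixed_by iota S (w * a).
  by move=> x xS; rewrite (conj_act_mul i1 iM) // wG ?inE // aP // (subsetP sSP).
exists (w * a) => //.
rewrite -w1 -[RHS]mulr1 -[X in _ = _ * X]tra -mulrA rel_traceE.
rewrite (@coset_sum_trans _ _ S P [set: gT]%G) ?subsetT //;
  last exact: (conj_act_coset_fun iM).
rewrite /rel_trace !mulr_sumr; apply: eq_bigr => C _.
rewrite /coset_sum (eq_bigr (fun=> w * conj_act iota (repr C) a)) => [|E EP].
  by rewrite sumr_const card_lcosets -mulrnAr mulr_natl.
have xP := repr_lcosets_in sSP EP.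
by rewrite conj_actM // (conj_act_mul i1 iM) wG ?inE // (conj_act_mul i1 iM) wG ?inE // aP.
Qed.

(** * Anchors are p-groups, and OPe is local *)

Section AnchorProperties.
Variables (O : idomainType) (gT : finGroupType) (n : nat).
Local Notation K := {fraction O}.
Variable X : gT -> 'M[O]_n.
Hypothesis X1 : X 1%g = 1%:M.
Hypothesis XM : forall x y, X (x * y)%g = X x *m X y.
Hypothesis charK : [pchar K] =i pred0.
Hypothesis irrX : mx_absolutely_irreducible (fracX_rep X1 XM).
Variable e : pcidem (galg K gT).
Hypothesis eE : pcidem_val e = mxunrep (fracX_rep X1 XM) 1%:M.
Variables (k : fieldType) (res : {rmorphism O -> k}) (p : nat).
Hypothesis res_map : residue_map res.
Hypothesis p_prime : prime p.
Hypothesis char_k : p \in [pchar k].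
Local Notation RO := (mxrep X).
Local Notation omx := (@OGe_mx O gT n X e).

Let n0 : (0 < n)%N := abs_irr_n_gt0 irrX.

Lemma OGe_scalar_nat m : (m%:R : OGe e) = OGe_scalar e m%:R.
Proof.
have sD : {morph @OGe_scalar O gT e : c d / c + d}.
  by move=> c d; apply: val_inj;
    rewrite -[RHS]/(val _ + val _) !OGe_val scalerDl rmorphD mulrDl.
have s1 : OGe_scalar e 1 = 1 by rewrite /OGe_scalar scale1r.
elim: m => [|m IHm]; last by rewrite !mulrS sD s1 IHm.
by apply: val_inj; rewrite OGe_val scale0r [fracg 0]raddf0 mul0r.
Qed.

(** A Sylow p-subgroup of [P] has index prime to p, which is a unit of [O], so it already admits
    trace one; minimality makes it equal to [P]. *)
Lemma anchor_pgroup (P : {group gT}) : anchor e P -> (p.-group P)%g.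
Proof.
case=> tP minP; have [S sylS] := Sylow_exists p P.
have sSP : S \subset P := pHall_sub sylS.
suff tS : trace_one (OGe_elt e) S by rewrite -(minP _ tS sSP) (pHall_pgroup sylS).
have pm : ~~ (p %| #|P : S|%g)%N by rewrite -p'natE //; case/and3P: sylS.
apply: (@trace_one_sub _ _ _ S P (OGe_scalar e (#|P : S|%g%:R)^-1)
  (OGe_elt1 charK irrX eE) (OGe_eltM charK irrX eE) sSP _ _ tP).
  exact: (OGe_scalar_fixed charK irrX eE).
apply: (OGe_mx_inj charK irrX eE).
have -> : (#|P : S|%g%:R : OGe e) = OGe_scalar e #|P : S|%g%:R.
  exact: OGe_scalar_nat.
rewrite (OGe_mxM charK irrX eE) !(OGe_mx_scalar charK irrX eE) (OGe_mx1 charK irrX eE).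
by rewrite -scalar_mxM mulVr // (natr_unit res_map char_k).
Qed.

Lemma corner_eltM (A B : nzRingType) (f : {rmorphism A -> B}) (c : pcidem B) a b :
  corner_elt f c a * corner_elt f c b = corner_elt f c (a * b).
Proof.
apply: val_inj; rewrite /= rmorphM -!mulrA; congr (_ * _).
by rewrite pcidemC -mulrA pcidem_idem.
Qed.

Lemma OPe_val (P : {group gT}) a :
  val (corner_elt (galg_sub_frac O P) e a) = fracg (galg_incl O P a) * pcidem_val e.
Proof.
congr (_ * _).
have -> : galg_incl O P a = \sum_g a g *: gelt O (sgval g) by [].
rewrite raddf_sum; apply: eq_bigr => g _.
by rewrite /= fracgZ fracg_gelt.
Qed.

Lemma OPe_lift (P : {group gT}) (x : OPe e P) :
  exists a, x = corner_elt (galg_sub_frac O P) e a.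
Proof.
by case: x => v vP; case/corner_predP: (vP) => a va; exists a; apply: val_inj.
Qed.

Lemma mxrep_frac_pcidem a : mxrep (fracX_rep X1 XM) (fracg a * pcidem_val e) =
  map_mx (@tofrac O) (RO a).
Proof. by rewrite (mxrep_mul_pcidem charK irrX eE) mxrep_frac. Qed.

(** A unit augmentation already gives an inverse in the group algebra of [P]. Otherwise the
    reduction of [a] annihilates the non-zero vectors fixed by [P], on which it acts by its
    augmentation, and no inverse can exist. *)
Lemma OPe_noninvertible (P : {group gT}) a : (p.-group P)%g ->
  ~ invertible (corner_elt (galg_sub_frac O P) e a) <-> res (augment a) = 0.
Proof.
move=> pP; split=> [|a0 [y [xy _]]].
  apply: boolp.contra_notP => /eqP a0.
  have pP' : (p.-group [set: subg_of P])%g by rewrite /pgroup cardsT card_sub.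
  have [b [ab ba]] := augment_invertible res_map char_k pP' a0.
  by exists (corner_elt _ e b); rewrite !corner_eltM ab ba.
have [b yE] := OPe_lift y; rewrite {}yE in xy.
have : val (corner_elt (galg_sub_frac O P) e a) * val (corner_elt (galg_sub_frac O P) e b) =
  pcidem_val e by rewrite -(corner_val1 (galg_sub_frac O P) e) -xy.
rewrite !OPe_val => /(congr1 (mxrep (fracX_rep X1 XM))).
rewrite mxrep_fracM !mxrep_frac_pcidem (mxrep_pcidem charK irrX eE).
rewrite -map_mxM -(map_mx1 (@tofrac O)) => /(@map_frac_inj _ _ _) /(congr1 (map_mx res)).
set ia := galg_incl O P a; rewrite map_mxM map_mx1 => ab1.
pose rk := resX_rep res X1 XM.
have F0 : rfix_mx rk P != 0 by apply: (rfix_pgroup_pchar char_k _ n0 pP); apply: subsetT.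
set w := nz_row (rfix_mx rk P); have w0 : w != 0 by rewrite nz_row_eq0.
have wP : (w <= rfix_mx rk P)%MS by apply: nz_row_sub.
case/eqP: w0; rewrite -[w]mulmx1 -ab1 mulmxA.
suff -> : w *m map_mx res (RO ia) = 0 by rewrite mul0mx.
have iaE : ia = \sum_g a g *: gelt O (sgval g) by [].
rewrite iaE raddf_sum map_mx_sum mulmx_sumr.
transitivity (\sum_g res (a g) *: w).
  apply: eq_bigr => g _; rewrite /= linearZ /= mxrep_gelt map_mxZ -scalemxAr.
  by have /rfix_mxP/(_ _ (subgP g)) /= -> := wP.
by rewrite -scaler_suml -rmorph_sum a0 scale0r.
Qed.

Lemma OPe_local (P : {group gT}) : (p.-group P)%g -> local_ring (OPe e P).
Proof.
move=> pP x y; have [a ->] := OPe_lift x; have [b ->] := OPe_lift y.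
move=> /(OPe_noninvertible a pP) a0 /(OPe_noninvertible b pP) b0.
have -> : corner_elt (galg_sub_frac O P) e a + corner_elt (galg_sub_frac O P) e b =
   corner_elt (galg_sub_frac O P) e (a + b).
  by apply: val_inj; rewrite /= raddfD mulrDl.
by apply/(OPe_noninvertible _ pP); rewrite augmentD rmorphD a0 b0 addr0.
Qed.

End AnchorProperties.

(** * Separability *)

Section SeparableAnchor.
Variables (O : idomainType) (gT : finGroupType).
Local Notation K := {fraction O}.
Variable e : pcidem (galg K gT).
Hypothesis elt1 : OGe_elt e 1%g = 1.
Hypothesis eltM : forall x y, OGe_elt e (x * y)%g = OGe_elt e x * OGe_elt e y.
Variable (P : {group gT}) (a : OGe e).
Hypothesis aP : fixed_by (OGe_elt e) P a.
Hypothesis tra : rel_trace (OGe_elt e) P a = 1.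
Local Notation E := (OGe_elt e).
Local Notation j := (OPe_incl e P).
Local Notation T := (tensor_square j).

Lemma OGe_scalarC c (x : OGe e) : OGe_scalar e c * x = x * OGe_scalar e c.
Proof.
have [b ->] := OGe_lift x; rewrite /OGe_scalar !corner_eltM; congr corner_elt.
exact: galg_algC.
Qed.

Lemma OGe_sum (x : OGe e) : exists b : gT -> O, x = \sum_g OGe_scalar e (b g) * E g.
Proof.
have [b ->] := OGe_lift x; exists b.
pose f := corner_elt (galg_frac O gT) e.
have fD : {morph f : y z / y + z}.
  by move=> y z; apply: val_inj; rewrite -[RHS]/(val _ + val _) !OGe_val rmorphD mulrDl.
have f0 : f 0 = 0 by apply: val_inj; rewrite OGe_val [fracg 0]raddf0 mul0r.
rewrite -/(f b) {1}[b]galg_sum (big_morph f fD f0); apply: eq_bigr => g _.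
by rewrite /f /OGe_scalar /OGe_elt corner_eltM mulr_algl.
Qed.

Lemma OPe_incl_gelt h (hP : h \in P) :
  j (corner_elt (galg_sub_frac O P) e (gelt O (subg P h))) = E h.
Proof.
apply: val_inj; rewrite [RHS]OGe_val -[LHS]/(val (corner_elt (galg_sub_frac O P) e (gelt O
  (subg P h)))).
by rewrite OPe_val fracg_gelt; congr (_ * _);
  rewrite -[galg_incl _ _ _]/(galg_map _ _ _) galg_map_gelt fracg_gelt /= subgK.
Qed.

Lemma OPe_incl_scalar c : j (corner_elt (galg_sub_frac O P) e c%:A) = OGe_scalar e c.
Proof.
apply: val_inj; rewrite [RHS]OGe_val -[LHS]/(val (corner_elt (galg_sub_frac O P) e c%:A)).
by rewrite OPe_val galg_inclZ rmorph1.
Qed.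

(** The factor [b] records a right multiplication: translating the cosets by g compares the sum for
    [b = 1] with the sum for [b = E g]. *)
Definition sep_term (b : OGe e) (h : gT) : T :=
  @pure _ _ j (restr j) (E h * a) (E h^-1%g * b : restr j).

Lemma sep_term_coset_fun b : coset_fun P (sep_term b).
Proof.
move=> g h hP; have [pDl pDr pS] := @pure_balanced _ _ j (restr j).
have aC : E h * a = a * E h.
  have /(congr1 (fun x => x * E h)) := aP hP.
  by rewrite /conj_act -[_ * E h]mulrA -eltM mulVg elt1 mulr1.
rewrite /sep_term eltM -mulrA aC mulrA -(OPe_incl_gelt hP) pS; congr (pure _ _ _).
by rewrite {1}/GRing.scale /= /restr_scale (OPe_incl_gelt hP) invMg eltM !mulrA -eltM mulgV
  elt1 mul1r.
Qed.

Definition sep_elt : T := coset_sum P [set: gT] (sep_term 1).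

Lemma tensor_rscaleB (b : OGe e) : zmod_morphism (fun t : T => tensor_rscale t b).
Proof. exact/tensor_liftB/balanced_rscale. Qed.

Lemma tensor_rscale_scale (x y : OGe e) (t : T) :
  tensor_rscale (x *: t) y = x *: tensor_rscale t y.
Proof.
move: t; apply: (@tensor_eq_pure _ _ j (restr j) T
  (fun t => tensor_rscale (x *: t) y) (fun t => x *: tensor_rscale t y)).
- by move=> t u; rewrite scalerBr tensor_rscaleB.
- by move=> t u; rewrite tensor_rscaleB scalerBr.
by move=> z w; rewrite tensor_scale_pure !tensor_rscale_pure tensor_scale_pure.
Qed.

Lemma tensor_rscaleM (x y : OGe e) (t : T) :
  tensor_rscale t (x * y) = tensor_rscale (tensor_rscale t x) y.
Proof.
move: t; apply: (@tensor_eq_pure _ _ j (restr j) T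
  (fun t => tensor_rscale t (x * y)) (fun t => tensor_rscale (tensor_rscale t x) y)).
- exact: tensor_rscaleB.
- by move=> t u; rewrite !tensor_rscaleB.
by move=> z w; rewrite !tensor_rscale_pure mulrA.
Qed.

Lemma tensor_rscaleD (x y : OGe e) (t : T) :
  tensor_rscale t (x + y) = tensor_rscale t x + tensor_rscale t y.
Proof.
have [pDl pDr pS] := @pure_balanced _ _ j (restr j).
move: t; apply: (@tensor_eq_pure _ _ j (restr j) T
  (fun t => tensor_rscale t (x + y)) (fun t => tensor_rscale t x + tensor_rscale t y)).
- exact: tensor_rscaleB.
- by move=> t u; rewrite !tensor_rscaleB opprD addrACA.
by move=> z w; rewrite !tensor_rscale_pure -pDr; congr (pure _ _ _); apply: mulrDr.
Qed.

Lemma tensor_rscale_sum (I : finType) (F : I -> OGe e) (t : T) :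
  tensor_rscale t (\sum_i F i) = \sum_i tensor_rscale t (F i).
Proof.
apply: (big_morph (tensor_rscale t)); first by move=> x y; apply: tensor_rscaleD.
by apply: (addrI (tensor_rscale t 0)); rewrite -tensor_rscaleD !addr0.
Qed.

Lemma rscale_coset_sum (F : gT -> T) b :
  tensor_rscale (coset_sum P [set: gT] F) b = coset_sum P [set: gT] (fun h => tensor_rscale
    (F h) b).
Proof.
apply: (big_morph (fun t : T => tensor_rscale t b)).
  move=> t u; rewrite -[u in t + u]opprK -[- u]sub0r !tensor_rscaleB opprB.
  by rewrite (_ : tensor_rscale 0 b = 0) ?subr0 // -[X in tensor_rscale X _](subrr (0 : T))
    tensor_rscaleB subrr.
by rewrite -[X in tensor_rscale X _](subrr (0 : T)) tensor_rscaleB subrr.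
Qed.

(** Left multiplication by g permutes the cosets and leaves g on the right. Scalars cross the tensor
    sign because they come from OPe, and scalars and group elements generate OGe. *)
Lemma sep_elt_central b : b *: sep_elt = tensor_rscale sep_elt b.
Proof.
have [pDl pDr pS] := @pure_balanced _ _ j (restr j).
have cG g : E g *: sep_elt = tensor_rscale sep_elt (E g).
  rewrite /sep_elt rscale_coset_sum.
  rewrite [RHS](_ : _ = coset_sum P [set: gT] (sep_term (E g))); last first.
    by apply: eq_bigr => C _; rewrite /sep_term tensor_rscale_pure mulr1.
  rewrite -[in RHS](@coset_sum_transl _ _ P [set: gT]%G _ g) ?inE ?subsetT //;
    last exact: sep_term_coset_fun.
  rewrite /coset_sum scaler_sumr; apply: eq_bigr => C _.
  by rewrite /sep_term tensor_scale_pure mulr1 mulrA -!eltM invMg mulgKV.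
have cO c : OGe_scalar e c *: sep_elt = tensor_rscale sep_elt (OGe_scalar e c).
  rewrite /sep_elt rscale_coset_sum /coset_sum scaler_sumr; apply: eq_bigr => C _.
  rewrite /sep_term tensor_scale_pure tensor_rscale_pure OGe_scalarC -[in
    LHS]OPe_incl_scalar pS.
  congr (pure _ _ _); rewrite {1}/GRing.scale /= /restr_scale OPe_incl_scalar.
  exact: OGe_scalarC.
have [c ->] := OGe_sum b; rewrite scaler_suml tensor_rscale_sum; apply: eq_bigr => g _.
by rewrite -scalerA cG -tensor_rscale_scale cO -tensor_rscaleM.
Qed.

(** The splitting is x |-> x s with s = [sep_elt]; multiplication sends s to Tr_P(a) = 1. *)
Lemma anchor_separable : separable_extension j.
Proof.
exists (fun x => x *: sep_elt); split.
- by move=> x y; rewrite scalerDl.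
- by move=> x y; rewrite scalerA.
- by move=> x y; rewrite -scalerA sep_elt_central tensor_rscale_scale.
move=> x; rewrite -[RHS]mulr1 -tra /rel_trace mulr_sumr.
rewrite /sep_elt /coset_sum scaler_sumr.
have mB : zmod_morphism (@tensor_mult _ _ j) by apply: tensor_liftB; apply: balanced_mult.
have m0 : tensor_mult (0 : T) = 0 by rewrite -(subrr (0 : T)) mB subrr.
rewrite (big_morph (@tensor_mult _ _ j) (op1 := +%R) (id1 := 0)) //.
  by apply: eq_bigr => C _;
    rewrite /sep_term tensor_scale_pure tensor_mult_pure mulr1 /conj_act !mulrA.
by move=> t u; rewrite -[u in t + u]opprK -[- u]sub0r !mB m0 sub0r opprK.
Qed.

End SeparableAnchor.

(** * OGe as a bimodule *)

Lemma coset_sum_setX (gT hT : finGroupType) (Z : zmodType) (P : {group gT})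
    (Q : {group hT}) (F : gT * hT -> Z) : coset_fun (setX_group P Q) F ->
  coset_sum (setX_group P Q) [set: gT * hT] F =
  coset_sum P [set: gT] (fun x => coset_sum Q [set: hT] (fun y => F (x, y))).
Proof.
move=> Fi; rewrite [RHS]/coset_sum.
under [RHS]eq_bigr do rewrite /coset_sum.
rewrite pair_big_dep /=.
rewrite (@coset_sum_transversal _ _ _ (fun CE => (CE.1 \in lcosets P [set: gT])
  && (CE.2 \in lcosets Q [set: hT])) (fun CE => (repr CE.1, repr CE.2))) //.
- exact: subsetT.
- by move=> t _; rewrite inE.
- move=> [x y] _; have [C CG Cx] := lcosets_repr_surj (subsetT P) (in_setT x).
  have [E EG Ey] := lcosets_repr_surj (subsetT Q) (in_setT y).
  by exists (C, E); [rewrite unfold_in /= CG | apply/setXP].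
move=> [C E] [C' E'] /andP[/= CG EG] /andP[/= CG' EG'].
case/setXP => /= CC EE.
by rewrite (lcosets_inj CG CG' CC) (lcosets_inj EG EG' EE).
Qed.

Section Bimodule.
Variables (O : idomainType) (gT : finGroupType).
Local Notation K := {fraction O}.
Variable e : pcidem (galg K gT).
Local Notation E := (OGe_elt e).
Local Notation M := (OGe_bimod e).

Lemma OGe_val_idem (x : OGe e) : val x * pcidem_val e = val x.
Proof. by have [a ->] := OGe_lift x; rewrite OGe_val -mulrA pcidem_idem. Qed.

Lemma bimod_gelt u (x : M) :
  gelt O u *: x = (E u.1 * (x : OGe e) * E u.2^-1%g : OGe e) :> M.
Proof.
apply: (@val_inj _ _ (OGe e)).
transitivity (bimod_act (gelt O u) (val (x : OGe e))) => //.
rewrite /bimod_act (bigD1 u) //= big1 ?addr0.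
  rewrite ffunE eqxx rmorph1 scale1r.
  rewrite -[RHS]/(val (E u.1) * val (x : OGe e) * val (E u.2^-1%g)) !OGe_val !fracg_gelt.
  have xe := OGe_val_idem x; set v := val (x : OGe e) in xe *.
  have ex : pcidem_val e * v = v by rewrite pcidemC.
  rewrite -[gelt K u.1 * pcidem_val e * v]mulrA ex -[gelt K u.2^-1%g * _]pcidemC mulrA.
  by rewrite -[gelt K u.1 * v * pcidem_val e]mulrA xe.
by move=> w /negPf wu; rewrite ffunE wu rmorph0 scale0r.
Qed.

Lemma bimod_scalar c (x : M) :
  (c%:A : galg O (gT * gT)%type) *: x = (OGe_scalar e c * (x : OGe e) : OGe e) :> M.
Proof.
apply: (@val_inj _ _ (OGe e)).
transitivity (bimod_act c%:A (val (x : OGe e))) => //.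
rewrite /bimod_act (bigD1 1%g) //= big1 ?addr0.
  rewrite galg_scaleE galg1E ffunE eqxx mulr1 invg1 -galg1E mul1r mulr1.
  rewrite -[RHS]/(val (OGe_scalar e c) * val (x : OGe e)) !OGe_val fracgZ rmorph1.
  by rewrite -!scalerAl mul1r pcidemC OGe_val_idem.
by move=> w /negPf wu; rewrite galg_scaleE galg1E ffunE wu mulr0 rmorph0 scale0r.
Qed.

Hypothesis elt1 : E 1%g = 1.
Hypothesis eltM : forall x y, E (x * y)%g = E x * E y.

(** The trace of x |-> axa over the cosets of P x P factors as Tr_P(a) x Tr_P(a), which is x. *)
Lemma bimod_higman_setX (P : {group gT}) (a : OGe e) :
    fixed_by E P a -> rel_trace E P a = 1 ->
  higman_map (M := M) (setX_group P P) (fun x => (a * (x : OGe e) * a : OGe e)).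
Proof.
move=> aP tra.
have aC h : h \in P -> E h * a = a * E h.
  move=> hP; have /(congr1 (fun x => x * E h)) := aP h hP.
  by rewrite /conj_act -[_ * E h]mulrA -eltM mulVg elt1 mulr1.
pose phi (x : M) : M := (a * (x : OGe e) * a : OGe e).
have phiG h x : h \in setX_group P P -> phi (gelt O h *: x) = gelt O h *: phi x.
  case: h => [h1 h2] /setXP[/= h1P h2P]; rewrite /phi !bimod_gelt /= !mulrA.
  by rewrite aC // -!mulrA; congr (_ * (_ * (_ * _))); rewrite aC ?groupV.
rewrite -/phi; split=> //.
- move=> x y; rewrite /phi -[X in a * X * a]/((x : OGe e) - (y : OGe e)).
  by rewrite mulrBr mulrBl.
- by move=> c x; rewrite /phi !bimod_scalar !mulrA -[a * OGe_scalar e c]OGe_scalarC.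
move=> x; rewrite coset_sum_setX; last first.
  exact: higman_coset_fun.
rewrite -[RHS]mul1r -[RHS]mulr1 -[X in X * _ * _]tra -[X in _ * X]tra.
rewrite /rel_trace mulr_suml mulr_suml; apply: eq_bigr => C _.
rewrite mulr_sumr; apply: eq_bigr => D _.
by rewrite /phi !bimod_gelt /= /conj_act !invgK !mulrA.
Qed.

End Bimodule.

Lemma vertex_conj (O : comNzRingType) (gT : finGroupType)
    (M : lmodType (galg O gT)) (Q : {group gT}) z :
  vertex M Q -> vertex M (Q :^ z^-1)%G.
Proof.
apply: minimal_subgroup_conj => H u /relatively_projective_higman[phi phiP].
exact: (higman_relatively_projective (higman_conj u phiP)).
Qed.

Section BimoduleVertices.
Variables (O : idomainType) (gT : finGroupType).
Local Notation K := {fraction O}.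
Variable e : pcidem (galg K gT).
Local Notation E := (OGe_elt e).
Local Notation M := (OGe_bimod e).
Hypothesis elt1 : E 1%g = 1.
Hypothesis eltM : forall x y, E (x * y)%g = E x * E y.

Lemma diag_morphM : {in [set: gT] &, {morph (fun x : gT => (x, x)) : x y / (x * y)%g}}.
Proof. by []. Qed.

Definition diag_morphism := Morphism diag_morphM.

Lemma inl_morphM : {in [set: gT] &, {morph (fun x : gT => (x, 1%g : gT)) : x y / (x * y)%g}}.
Proof. by move=> x y _ _; rewrite -[RHS]/(x * y, 1 * 1)%g mulg1. Qed.

Definition inl_morphism := Morphism inl_morphM.

(* Mackey's formula for the restriction to the diagonal, evaluated at 1. *)
Lemma diag_sub_conj (P : {group gT}) (Q : {group gT * gT}) (phi : M -> M) :
    local_fixed E -> defect_group E P -> higman_map Q phi ->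
  exists z, diag_group P \subset (Q :^ z^-1)%G.
Proof.
move=> locE defP [_ _ phiG phiT].
pose one : M := (1 : OGe e).
pose F (u : gT * gT) : M := gelt O u *: phi (gelt O u^-1 *: one).
have FQ : coset_fun Q F by apply: higman_coset_fun.
pose R z := mackey_stab diag_morphism Q z.
have J1 x : gelt O (x, x)^-1%g *: one = one.
  by rewrite bimod_gelt /one mulr1 -eltM mulgV elt1.
(* The unit of OGe is fixed by the diagonal, so the diagonal action on the values of [F] becomes
   conjugation in the interior algebra. *)
have FJ x z : F ((x, x) * z)%g = conj_act E x (F z : OGe e) :> OGe e.
  rewrite /F invMg !geltM -!scalerA J1 [gelt O (x, x) *: _]bimod_gelt //.
have FR z : z \in double_reps diag_morphism Q -> fixed_by E (R z) (F z).
  move=> _ y; rewrite mackey_stabP => /andP[_ yQ].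
  by rewrite -FJ -[X in F X](mulKVg z) FQ // mulgA.
have [|z zR tR] := local_trace elt1 eltM locE FR.
  rewrite -[RHS](phiT one) (coset_sum_mackey diag_morphism FQ).
  by apply: eq_bigr => z _; apply: eq_bigr => C _; rewrite -FJ.
have [w sPR] := defect_group_sub_conj elt1 eltM locE defP tR.
(* Here [P] lies in the conjugate by w^-1 of the diagonal preimage of [Q :^ z^-1], which accounts
   for the element (w, w)z. *)
exists ((w, w) * z)%g; apply/subsetP => _ /imsetP[x xP ->].
have := subsetP sPR x xP; rewrite !mem_conjg !invgK mackey_stabP => /andP[_].
have xw : ((x, x) ^ (w, w) = (x ^ w, x ^ w))%g by [].
by rewrite conjgM xw /= [(_ ^ z)%g]conjgE mulgA.
Qed.

End BimoduleVertices.

(** * Defect zero *)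

Lemma coset_sum1 (gT : finGroupType) (Z : zmodType) (F : gT -> Z) :
  coset_sum 1%G [set: gT] F = \sum_g F g.
Proof.
rewrite (@coset_sum_transversal _ _ _ predT id) //.
- exact: subsetT.
- by move=> x h /set1P ->; rewrite mulg1.
- by move=> t _; rewrite inE.
- by move=> x _; exists x; rewrite // inE mulVg.
by move=> x y _ _ /set1P xy; rewrite -(mulKVg x y) xy mulg1.
Qed.

(** * Free spanning subfamilies over a valuation ring *)

Section FreeSpan.
Variables (O : idomainType) (pi : O) (V : lmodType O) (T : finType) (w : T -> V).
Hypothesis pi_unif : uniformizer pi.
Hypothesis torsion_free : forall (c : O) (x : V), c *: x = 0 -> c = 0 \/ x = 0.

Lemma min_divisor (s : seq T) (c : T -> O) : s != [::] ->
  exists2 m, m \in s & forall i, i \in s -> divides (c m) (c i).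
Proof.
elim: s => // t [|t' s] IHs _.
  by exists t => [|i]; rewrite inE // => /eqP ->; exists 1; rewrite mulr1.
have [//|m ms mdiv] := IHs.
have [tm|mt] := uniformizer_divides_total (c t) (c m) pi_unif.
  exists t; first exact: mem_head.
  move=> i; rewrite inE => /orP[/eqP ->|/mdiv[d ->]]; first by exists 1; rewrite mulr1.
  by case: tm => d' ->; exists (d' * d); rewrite mulrA.
exists m; first by rewrite inE ms orbT.
by move=> i; rewrite inE => /orP[/eqP ->|/mdiv].
Qed.

Definition spanned (I : {set T}) := forall t, exists c : T -> O, w t = \sum_(i in I) c i *:
  w i.

(* A spanning subfamily of minimal size is free: in a dependence relation,
   some coefficient divides all the others. *)
Lemma free_spanning_subset : exists2 I : {set T}, spanned I &
  forall c : T -> O, \sum_(i in I) c i *: w i = 0 -> forall i, i \in I -> c i = 0.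
Proof.
pose SP (I : {set T}) := boolp.asbool (spanned I).
have spanT : SP setT.
  apply/boolp.asboolP => t; exists (fun i => (i == t)%:R).
  rewrite (bigD1 t) ?inE //= eqxx scale1r big1 ?addr0 // => i /andP[_ /negPf ->].
  by rewrite scale0r.
case: (@arg_minnP _ setT SP (fun I : {set T} => #|I|) spanT) => I /boolp.asboolP spanI minI.
exists I => // c c0 i0 i0I; apply/eqP/negPn/negP => ci0.
have [|m] := @min_divisor (enum I) c.
  by apply: contraTneq i0I => e0; rewrite -mem_enum e0.
rewrite mem_enum => mI mdiv.
have cm0 : c m != 0.
  by have [|d ci0E] := mdiv i0; [rewrite mem_enum | apply: contraNneq ci0 => cm;
    rewrite ci0E cm mul0r].
have /boolp.choice[d dP] : forall i, exists d, i \in I -> c i = c m * d.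
  move=> i; case: (boolP (i \in I)) => [iI|_]; last by exists 0.
  by have [|d dE] := mdiv i; [rewrite mem_enum | exists d].
have dm : d m = 1 by apply: (mulfI cm0); rewrite -dP // mulr1.
have d0 : \sum_(i in I) d i *: w i = 0.
  have [|//|//] := torsion_free (c := c m) (x := \sum_(i in I) d i *: w i).
    rewrite scaler_sumr -[RHS]c0; apply: eq_bigr => i iI.
    by rewrite scalerA -dP.
  by move/eqP; rewrite (negPf cm0).
have wm : w m = - \sum_(i in I :\ m) d i *: w i.
  apply/eqP; rewrite -addr_eq0 -[X in _ == X]d0 [in X in _ == X](big_setD1 m) //=.
  by rewrite dm scale1r.
have spanI' : SP (I :\ m).
  apply/boolp.asboolP => t; have [b ->] := spanI t.
  exists (fun i => b i - b m * d i); rewrite (big_setD1 m) //= wm scalerN.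
  rewrite addrC scaler_sumr -sumrB; apply: eq_bigr => i _.
  by rewrite scalerBl scalerA.
by have := minI _ spanI'; rewrite (cardsD1 m I) mI ltnn.
Qed.

End FreeSpan.

Section DefectZero.
Variables (O : idomainType) (gT : finGroupType) (n : nat).
Local Notation K := {fraction O}.
Variable X : gT -> 'M[O]_n.
Hypothesis X1 : X 1%g = 1%:M.
Hypothesis XM : forall x y, X (x * y)%g = X x *m X y.
Hypothesis charK : [pchar K] =i pred0.
Hypothesis irrX : mx_absolutely_irreducible (fracX_rep X1 XM).
Variable e : pcidem (galg K gT).
Hypothesis eE : pcidem_val e = mxunrep (fracX_rep X1 XM) 1%:M.
Local Notation RO := (mxrep X).
Local Notation E := (OGe_elt e).
Local Notation M := (OGe_bimod e).
Local Notation omx := (@OGe_mx O gT n X e).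

Let n0 : (0 < n)%N := abs_irr_n_gt0 irrX.

Lemma pcidem_coef g : pcidem_val e g = n%:R / #|gT|%:R * tofrac (\tr (X g^-1%g)).
Proof. by rewrite eE mxunrepE mul1mx /= /fracX trace_map_mx. Qed.

(** An integral n/|G| makes the coefficients of [mxunrep] of an integral matrix integral, so the
    matrix unit [D] lies in the image of OG. By [schur_average] the conjugates of c [D] sum to
    (n/|G|)(|G|/n) tr [D] = 1. *)
Lemma trace_one_trivial (c : O) : tofrac c = n%:R / #|gT|%:R -> trace_one E 1%G.
Proof.
move=> cE; pose D : 'M[O]_n := delta_mx (Ordinal n0) (Ordinal n0).
pose a : galg O gT := [ffun g => c * \tr (D *m X g^-1%g)].
have aE : fracg a = mxunrep (fracX_rep X1 XM) (map_mx (@tofrac O) D).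
  apply/ffunP => g; rewrite fracgE ffunE mxunrepE tofracM cE.
  by rewrite /= /fracX -map_mxM trace_map_mx.
have RaD : RO a = D.
  by apply: map_frac_inj; rewrite -(mxrep_frac X1 XM) aE mxunrepK.
apply: (mx_trace_one charK irrX eE (a := c *: a)) => [h /set1P ->|].
  by rewrite X1 mul1mx mulmx1.
rewrite coset_sum1 linearZ /= RaD; apply: map_frac_inj; rewrite map_mx1 map_mx_sum.
transitivity (tofrac c *: \sum_g fracX X g^-1%g *m map_mx (@tofrac O) D *m fracX X g).
  rewrite scaler_sumr [RHS](reindex_inj invg_inj); apply: eq_bigr => g _ /=.
  by rewrite invgK -scalemxAr -scalemxAl map_mxZ !map_mxM.
rewrite (schur_average charK irrX) trace_map_mx.
rewrite /mxtrace (bigD1 (Ordinal n0)) //= big1 ?addr0 => [|i /negPf i0];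
  last by rewrite mxE i0.
rewrite mxE eqxx rmorph1 mulr1 scale_scalar_mx cE.
rewrite mulrA divfK ?card_neq0 // mulfV //.
by have /pcharf0P -> := charK; rewrite -lt0n.
Qed.

(** Mackey's formula for the restriction to G x 1: the outcome [psi] is a Higman map relative to the
    trivial subgroup for OGe as a left module. *)
Lemma bimod_left_higman (P : {group gT}) (phi : M -> M) :
    higman_map (diag_group P) phi ->
  exists psi : OGe e -> OGe e,
    [/\ {morph psi : x y / x + y},
        forall c x, psi (OGe_scalar e c * x) = OGe_scalar e c * psi x &
        forall x, \sum_g E g * psi (E g^-1%g * x) = x].
Proof.
have elt1 := OGe_elt1 charK irrX eE; have eltM := OGe_eltM charK irrX eE.
case=> phiB phiZ phiG phiT.
pose reps := double_reps (inl_morphism gT) (diag_group P).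
pose psi (x : M) : M := \sum_(z in reps) gelt O z *: phi (gelt O z^-1%g *: x).
have phiD : {morph phi : x y / x + y}.
  pose phi' : {additive M -> M} := HB.pack phi (GRing.isZmodMorphism.Build _ _ phi phiB).
  exact: (raddfD phi').
have psiD (x y : M) : psi (x + y) = psi x + psi y.
  rewrite /psi -big_split; apply: eq_bigr => z _ /=.
  by rewrite scalerDr phiD scalerDr.
exists psi; split; first exact: psiD.
- move=> c x; rewrite -[OGe_scalar e c * x]bimod_scalar -[RHS]bimod_scalar /psi scaler_sumr.
  apply: eq_bigr => z _.
  rewrite scalerA -galg_algC -scalerA phiZ scalerA -galg_algC -scalerA //.
move=> x; pose F (u : gT * gT) : M := gelt O u *: phi (gelt O u^-1 *: (x : M)).
have FQ : coset_fun (diag_group P) F by apply: higman_coset_fun.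
rewrite -[RHS](phiT (x : M)) (coset_sum_mackey (inl_morphism gT) FQ).
(* Conjugates of (y, 1) have second component 1, so the only one on the diagonal is trivial. *)
have R1 z : mackey_stab (inl_morphism gT) (diag_group P) z = 1%G.
  apply/group_inj/trivgP/subsetP => y; rewrite mackey_stabP => /andP[_ /imsetP[h _]].
  rewrite /= => -[E1 E2]; apply/set1P; move: E1; rewrite -E2 mulg1 mulVg.
  by move/(canRL (mulgK _)); rewrite mul1g => /(canRL (mulKg _)); rewrite invgK mulgV.
under [RHS]eq_bigr do rewrite R1 coset_sum1.
rewrite exchange_big /=; apply: eq_bigr => g _.
rewrite -[E g * _](_ : gelt O (g, 1%g) *: psi (gelt O (g, 1%g)^-1 *: (x : M)) = _).
  rewrite /psi scaler_sumr; apply: eq_bigr => z _.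
  by rewrite /F invMg !geltM !scalerA.
by rewrite bimod_gelt bimod_gelt /= invgK invg1 elt1 !mulr1.
Qed.

End DefectZero.

Section IntegralIdempotent.
Variables (O : idomainType) (gT : finGroupType) (n : nat).
Local Notation K := {fraction O}.
Variable X : gT -> 'M[O]_n.
Hypothesis X1 : X 1%g = 1%:M.
Hypothesis XM : forall x y, X (x * y)%g = X x *m X y.
Hypothesis charK : [pchar K] =i pred0.
Hypothesis irrX : mx_absolutely_irreducible (fracX_rep X1 XM).
Variable e : pcidem (galg K gT).
Hypothesis eE : pcidem_val e = mxunrep (fracX_rep X1 XM) 1%:M.
Local Notation RO := (mxrep X).
Local Notation E := (OGe_elt e).
Local Notation omx := (@OGe_mx O gT n X e).

Lemma mx_torsion_free m1 m2 (c : O) (Y : 'M[O]_(m1, m2)) : c *: Y = 0 -> c = 0 \/ Y = 0.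
Proof.
have [->|c0] := eqVneq c 0; first by left.
move=> /matrixP cY; right; apply/matrixP => i j; have := cY i j; rewrite !mxE.
by move/eqP; rewrite mulf_eq0 (negPf c0) => /eqP.
Qed.

(* If OGe is relatively 1-projective as a left OG-module, the surjection
   OG -> OGe splits; the image of e under the splitting is then e itself. *)
Lemma pcidem_integral (pi : O) (psi : OGe e -> OGe e) : uniformizer pi ->
    {morph psi : x y / x + y} ->
    (forall c x, psi (OGe_scalar e c * x) = OGe_scalar e c * psi x) ->
    (forall x, \sum_g E g * psi (E g^-1%g * x) = x) ->
  exists w : galg O gT, fracg w = pcidem_val e.
Proof.
move=> pi_unif psiD psiZ psiT.
(* Identifying OGe with the span of the matrices [X g] gives an [O]-basis consisting of some of
   them; on it the values of [psi] can be lifted to the group algebra. *)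
have [I spanI freeI] := free_spanning_subset X pi_unif (@mx_torsion_free n n).
have /boolp.choice[c cP] := spanI.
have /boolp.choice[y yP] : forall i, exists y, psi (E i) = corner_elt (galg_frac O gT) e y.
  by move=> i; apply: OGe_lift.
pose s g : galg O gT := \sum_(i in I) c g i *: y i.
(* The image of the unit under the section x |-> sum of g s(g^-1 x) of OG -> OGe, where s lifts
   [psi]. *)
pose w := \sum_g gelt O g * s g^-1%g.
exists w.
pose f := corner_elt (galg_frac O gT) e.
have fD : {morph f : u v / u + v}.
  by move=> u v; apply: val_inj; rewrite -[RHS]/(val _ + val _) !OGe_val rmorphD mulrDl.
have f0 : f 0 = 0 by apply: val_inj; rewrite OGe_val [fracg 0]raddf0 mul0r.
have fZ d u : f (d *: u) = OGe_scalar e d * f u.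
  by rewrite /f /OGe_scalar corner_eltM mulr_algl.
have psi0 : psi 0 = 0 by apply: (addrI (psi 0)); rewrite -psiD !addr0.
have fs g : f (s g) = psi (E g).
  have -> : E g = \sum_(i in I) OGe_scalar e (c g i) * E i.
    apply: (OGe_mx_inj charK irrX eE); rewrite (OGe_mxG charK irrX eE) [LHS]cP.
    rewrite (OGe_mx_sum charK irrX eE).
    apply: eq_bigr => i _.
    by rewrite (OGe_mxM charK irrX eE) (OGe_mx_scalar charK irrX eE) (OGe_mxG charK irrX
      eE) mul_scalar_mx.
  rewrite (big_morph psi psiD psi0) (big_morph f fD f0); apply: eq_bigr => i _.
  by rewrite fZ psiZ yP.
have fw : f w = 1.
  rewrite (big_morph f fD f0) -[RHS]psiT; apply: eq_bigr => g _.
  by rewrite mulr1 -fs /f corner_eltM.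
(* The lift depends linearly on the matrices alone, so an element acting as 0 on OGe annihilates the
   image of the section. *)
have kill (u : galg O gT) : RO u = 0 -> u * w = 0.
  move=> u0.
  have -> : u * w = \sum_g gelt O g * \sum_(i in I) (\sum_h u h * c (g^-1 * h)%g i) *: y i.
    rewrite {1}[u]galg_sum mulr_suml.
    transitivity (\sum_h \sum_g gelt O g * (u h *: s (g^-1 * h)%g)).
      apply: eq_bigr => h _; rewrite /w mulr_sumr [RHS](reindex_inj (mulgI h)) /=.
      apply: eq_bigr => g _; rewrite invMg mulgKV -scalerAr -scalerAl.
      by rewrite mulrA geltM.
    rewrite exchange_big /=; apply: eq_bigr => g _; rewrite -mulr_sumr; congr (_ * _).
    rewrite (eq_bigr (fun h => \sum_(i in I) (u h * c (g^-1 * h)%g i) *: y i)) => [|h _];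
      last first.
      by rewrite /s scaler_sumr; apply: eq_bigr => i _; rewrite scalerA.
    by rewrite exchange_big; apply: eq_bigr => i _; rewrite scaler_suml.
  apply: big1 => g _.
  suff -> : \sum_(i in I) (\sum_h u h * c (g^-1 * h)%g i) *: y i = 0 by apply: mulr0.
  apply: big1 => i iI.
  suff -> : \sum_h u h * c (g^-1 * h)%g i = 0 by apply: scale0r.
  pose b i' := \sum_h u h * c (g^-1 * h)%g i'.
  have bX : \sum_(i' in I) b i' *: X i' = 0.
    transitivity (X g^-1%g *m RO u); last by rewrite u0 mulmx0.
    rewrite mxrepE mulmx_sumr.
    transitivity (\sum_h \sum_(i in I) (u h * c (g^-1 * h)%g i) *: X i).
      by rewrite exchange_big; apply: eq_bigr => j _; rewrite scaler_suml.
    apply: eq_bigr => h _; rewrite -scalemxAr -XM cP scaler_sumr.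
    by apply: eq_bigr => j _; rewrite scalerA.
  exact: freeI bX i iI.
have NK : #|gT|%:R != 0 :> K by apply: card_neq0.
(* Clearing denominators, [d] = |G|(1 - e) is integral and acts as 0, whence (1 - e)w = 0. On the
   other hand [fw] says we = e, so w = e. *)
pose v : galg O gT := [ffun g => n%:R * \tr (X g^-1%g)].
have vE : fracg v = #|gT|%:R *: pcidem_val e.
  apply/ffunP => g; rewrite fracgE ffunE galg_scaleE (pcidem_coef eE) tofracM tofracMn tofrac1.
  by rewrite mulrA mulrCA mulfV ?mulr1.
pose d : galg O gT := #|gT|%:R *: 1 - v.
have dE : fracg d = #|gT|%:R *: (1 - pcidem_val e).
  have -> : fracg d = fracg (#|gT|%:R *: 1) - fracg v by apply: rmorphB.
  by rewrite fracgZ vE scalerBr -(rmorph1 (@fracg O gT)) tofracMn tofrac1.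
have d0 : RO d = 0.
  apply: map_frac_inj; rewrite -(mxrep_frac X1 XM) dE linearZ linearB /=.
  have -> : mxrep (fracX_rep X1 XM) 1 = 1%:M by apply: mxrep1; apply: repr_mx1.
  by rewrite (mxrep_pcidem charK irrX eE) subrr scaler0 map_mx0.
have : fracg d * fracg w = 0.
  by transitivity (fracg (d * w)); [exact/esym/rmorphM | rewrite (kill d d0); apply: raddf0].
rewrite dE -scalerAl => /eqP.
rewrite scaler_eq0 (negPf NK) /= mulrBl mul1r subr_eq0 pcidemC => /eqP ->.
have := congr1 val fw; rewrite OGe_val => ->.
by rewrite -[1 : OGe e]/(corner_elt (galg_frac O gT) e 1) OGe_val rmorph1 mul1r.
Qed.

End IntegralIdempotent.

(** * Ranks of integral idempotent matrices and of their reductions *)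

Section IdempotentMatrices.

Lemma mxrank_factor (F : fieldType) m1 m2 (Y : 'M[F]_(m1, m2)) :
  exists (L : 'M_(m1, \rank Y)) (R : 'M_(\rank Y, m2)) C B,
    [/\ L *m R = Y, C *m L = 1%:M & R *m B = 1%:M].
Proof.
have /row_freeP[B RB] := row_base_free Y.
have /row_fullP[C CL] := col_base_full Y.
by exists (col_base Y), (row_base Y), C, B; rewrite mulmx_base.
Qed.

(** For a full-rank factorisation Y = LR, idempotency cancels to RL = 1, whose trace is the rank. *)
Lemma mxtrace_idem (F : fieldType) m (Y : 'M[F]_m) : Y *m Y = Y -> \tr Y = (\rank Y)%:R.
Proof.
have [L [R [C [B [YE CL RB]]]]] := mxrank_factor Y; rewrite -{1 2 3 4}YE => YY.
have RL : R *m L = 1%:M.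
  have := congr1 (fun Z => C *m Z *m B) YY.
  by rewrite /= !mulmxA CL !mul1mx -!mulmxA RB mulmx1.
by rewrite mxtrace_mulC RL mxtrace1.
Qed.

Lemma mxrank_idem_compl (F : fieldType) m (Y : 'M[F]_m) : Y *m Y = Y ->
  (\rank Y + \rank (1%:M - Y)%R = m)%N.
Proof.
move=> YY; have -> : \rank (1%:M - Y)%R = \rank (kermx Y).
  apply/eqP; rewrite eqn_leq !mxrankS //.
    apply/rV_subP => u /sub_kermxP uY; apply/submxP; exists u.
    by rewrite mulmxBr mulmx1 uY subr0.
  by apply/sub_kermxP; rewrite mulmxBl mul1mx YY subrr.
by rewrite mxrank_ker subnKC // rank_leq_row.
Qed.

Variables (O : idomainType) (k : fieldType) (res : {rmorphism O -> k}).
Hypothesis res_map : residue_map res.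

(** An identity CYB = 1 of size r over [k] lifts to an integral matrix of unit determinant, which
    stays invertible over the fraction field. *)
Lemma mxrank_res_le m1 m2 (Y : 'M[O]_(m1, m2)) :
  (\rank (map_mx res Y) <= \rank (map_mx (@tofrac O) Y))%N.
Proof.
set Yk := map_mx res Y; set r := \rank Yk.
have [L [R [C [B [YE CL RB]]]]] := mxrank_factor Yk.
have CYB : C *m Yk *m B = 1%:M.
  by rewrite -[X in C *m X]YE !mulmxA CL mul1mx RB.
have [sec secP] := boolp.choice res_map.1.
have liftK a b (Z : 'M[k]_(a, b)) : map_mx res (map_mx sec Z) = Z.
  by apply/matrixP => i j; rewrite !mxE.
pose W : 'M[O]_r := map_mx sec C *m Y *m map_mx sec B.
have WU : map_mx (@tofrac O) W \in unitmx.
  have : \det W \is a GRing.unit.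
    by rewrite (unit_res res_map) -det_map_mx !map_mxM !liftK CYB det1 oner_eq0.
  rewrite unitmxE det_map_mx unitfE => dW; rewrite tofrac_eq0.
  by apply: contraTneq dW => ->; rewrite unitr0.
rewrite -[X in (X <= _)%N](mxrank_unit WU) !map_mxM -mulmxA.
by apply: leq_trans (mxrankM_maxr _ _) (mxrankM_maxl _ _).
Qed.

(** The inequality applies to both Y and 1 - Y, and over either field the two ranks add up to m. *)
Lemma mxrank_idem_res m (Y : 'M[O]_m) : Y *m Y = Y ->
  \rank (map_mx res Y) = \rank (map_mx (@tofrac O) Y).
Proof.
move=> YY; apply/eqP; rewrite eqn_leq mxrank_res_le /=.
have Yf : map_mx (@tofrac O) Y *m map_mx (@tofrac O) Y = map_mx (@tofrac O) Y by rewrite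
  -map_mxM YY.
have Yk : map_mx res Y *m map_mx res Y = map_mx res Y by rewrite -map_mxM YY.
have le := mxrank_res_le (1%:M - Y); rewrite !map_mxB !map_mx1 in le.
rewrite -(leq_add2r (\rank (1%:M - map_mx res Y)%R)) (mxrank_idem_compl Yk).
by rewrite -[X in (_ <= X)%N](mxrank_idem_compl Yf) leq_add2l.
Qed.

End IdempotentMatrices.

(* The matrix of the values tr (rG (x y^-1)) factors through 'M_n. *)
Lemma mxrank_trace_matrix (F : fieldType) (gT : finGroupType) (N n : nat)
    (rG : gT -> 'M[F]_n) (x y : 'I_N -> gT) :
    (forall g h, rG (g * h)%g = rG g *m rG h) ->
  (\rank (\matrix_(i, j) \tr (rG (x i * y j)%g)) <= n * n)%N.
Proof.
move=> rM; set Z := \matrix_(i, j) _.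
pose L : 'M[F]_(N, n * n) := \matrix_i mxvec (rG (x i)).
pose B : 'M[F]_(n * n, N) := \matrix_(l, j) \tr (vec_mx (delta_mx 0 l) *m rG (y j)).
suff -> : Z = L *m B by apply: leq_trans (mxrankM_maxl _ _) (rank_leq_col _).
apply/matrixP => i j; rewrite [RHS]mxE mxE rM.
rewrite -[rG (x i)]mxvecK [mxvec _]row_sum_delta linear_sum /= mulmx_suml raddf_sum /=.
apply: eq_bigr => l _; rewrite linearZ /= -scalemxAl mxtraceZ.
by rewrite [B _ _]mxE; congr (_ * _); rewrite -[L i l](_ : row i L 0 l = _) ?mxE // rowK.
Qed.

(** * Unit quotients in O and p-parts of integers *)

Section DefectZeroArithmetic.
Variables (O : idomainType) (k : fieldType) (res : {rmorphism O -> k}).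
Hypothesis res_map : residue_map res.
Variable p : nat.
Hypothesis char_k : p \in [pchar k].
Hypothesis charK : [pchar {fraction O}] =i pred0.

Lemma natO_eq0 m : (m%:R == 0 :> O) = (m == 0)%N.
Proof.
have /pcharf0P <- := charK.
by rewrite -[m%:R in RHS](_ : tofrac m%:R = _) ?tofrac_eq0 // tofracMn tofrac1.
Qed.

Let p_prime : prime p := pcharf_prime char_k.

Lemma p'part_unit m : (0 < m)%N -> (m`_p^')%N%:R \is a @GRing.unit O.
Proof.
move=> m0; by rewrite (natr_unit res_map char_k) -p'natE // part_pnat.
Qed.

(** If the p-adic valuations differed, cancelling the common power of p would exhibit p as a divisor
    of a unit. The reverse inequality uses the inverse of [u]. *)
Lemma ppart_eq_of_unit_ratio (a b : nat) (u : O) : (0 < a)%N -> (0 < b)%N ->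
  u \is a GRing.unit -> a%:R = b%:R * u -> (a`_p = b`_p)%N.
Proof.
suff le (c d : nat) (v : O) : (0 < c)%N -> (0 < d)%N -> v \is a GRing.unit ->
    c%:R = d%:R * v -> (logn p d <= logn p c)%N.
  move=> a0 b0 uU E; rewrite !p_part; congr (p ^ _)%N; apply/eqP; rewrite eqn_leq.
  rewrite (le _ _ _ a0 b0 uU E) andbT (le b a u^-1) ?unitrV //.
  by rewrite E mulrK.
move=> c0 d0 vU E; rewrite leqNgt; apply/negP => lt.
have pn : p%:R \isn't a @GRing.unit O by rewrite (natr_unit res_map char_k) dvdnn.
case/negP: pn.
have pO0 : p%:R != 0 :> O by rewrite natO_eq0 -lt0n prime_gt0.
have := E; rewrite -{1}(partnC p c0) -{1}(partnC p d0) !natrM !p_part !natrX.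
rewrite -(subnKC (ltnW lt)) exprD -!mulrA => /(mulfI (expf_neq0 _ pO0)) E'.
have cU := p'part_unit c0; rewrite E' in cU.
move: cU; rewrite unitrM => /andP[]; rewrite unitrX_pos ?subn_gt0 //.
Qed.

Lemma ppart_unit_ratio (a b : nat) : (0 < a)%N -> (0 < b)%N -> (a`_p = b`_p)%N ->
  exists2 u : O, u \is a GRing.unit & a%:R = b%:R * u.
Proof.
move=> a0 b0 ab; exists ((a`_p^')%N%:R * (b`_p^')%N%:R^-1).
  by rewrite unitrM unitrV !p'part_unit.
rewrite -{1}(partnC p a0) -{1}(partnC p b0) !natrM ab -mulrA; congr (_ * _).
by rewrite mulrCA divrr ?mulr1 // p'part_unit.
Qed.

End DefectZeroArithmetic.

(** * Absolute irreducibility of the reduction when e is integral *)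

Section IntegralIdempotentDegree.
Variables (O : idomainType) (gT : finGroupType) (n : nat).
Local Notation K := {fraction O}.
Variable X : gT -> 'M[O]_n.
Hypothesis X1 : X 1%g = 1%:M.
Hypothesis XM : forall x y, X (x * y)%g = X x *m X y.
Hypothesis charK : [pchar K] =i pred0.
Hypothesis irrX : mx_absolutely_irreducible (fracX_rep X1 XM).
Variable e : pcidem (galg K gT).
Hypothesis eE : pcidem_val e = mxunrep (fracX_rep X1 XM) 1%:M.
Variables (k : fieldType) (res : {rmorphism O -> k}).
Hypothesis res_map : residue_map res.
Hypothesis splitk : group_closure_field k gT.
Variable w : galg O gT.
Hypothesis wE : fracg w = pcidem_val e.
Local Notation RO := (mxrep X).
Local Notation E := (OGe_elt e).
Local Notation rk := (resX_rep res X1 XM).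
Local Notation N := #|gT|.
Let gv (i : 'I_N) : gT := enum_val i.

Let n0 : (0 < n)%N := abs_irr_n_gt0 irrX.
Let NK : N%:R != 0 :> K := card_neq0 gT charK.

Let sum_gv (Z : nmodType) (F : gT -> Z) : \sum_(i < N) F (gv i) = \sum_g F g.
Proof. by rewrite [RHS](reindex _ (onW_bij _ (enum_val_bij gT))). Qed.

Let tofracw g : tofrac (w g) = n%:R / N%:R * tofrac (\tr (X g^-1%g)).
Proof. by rewrite -fracgE wE (pcidem_coef eE). Qed.

Let ww : w * w = w.
Proof.
apply: fracg_inj; transitivity (fracg w * fracg w); first exact: rmorphM.
by rewrite wE pcidem_idem.
Qed.

Let ROw : RO w = 1%:M.
Proof.
apply: map_frac_inj; rewrite -(mxrep_frac X1 XM) wE map_mx1.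
exact: (mxrep_pcidem charK irrX eE).
Qed.

(** On coordinate rows this is left multiplication by [w] on the regular module. *)
Definition idem_mx : 'M[O]_N := \matrix_(i, j) w (gv j * (gv i)^-1)%g.

Lemma idem_mx_idem : idem_mx *m idem_mx = idem_mx.
Proof.
apply/matrixP => i j; rewrite [RHS]mxE -[in RHS]ww galg_mulE mxE.
rewrite (eq_bigr (fun l => w (gv l * (gv i)^-1)%g * w (gv j * (gv l)^-1)%g)); last first.
  by move=> l _; rewrite !mxE.
rewrite (sum_gv (fun g => w (g * (gv i)^-1)%g * w (gv j * g^-1)%g)).
rewrite (reindex_inj (mulIg (gv j))) (reindex_inj invg_inj) /=.
by apply: eq_bigr => y _; rewrite mulrC invMg invgK mulKVg mulgA.
Qed.

Lemma natr_inj_pchar0 (F : fieldType) : [pchar F] =i pred0 ->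
  injective (fun m : nat => m%:R : F).
Proof.
move=> /pcharf0P F0 a b; wlog le : a b / (a <= b)%N.
  by move=> H E; case/orP: (leq_total a b) => le; [apply: H | apply/esym/H].
move=> ab; apply/eqP; rewrite eqn_leq le /= -subn_eq0 -F0 natrB //.
by rewrite ab subrr.
Qed.

(** Over the fraction field the rank is the trace |G| w(1) = n^2, and idempotents keep their rank
    under reduction. *)
Lemma mxrank_idem_mx : \rank (map_mx res idem_mx) = (n * n)%N.
Proof.
rewrite (mxrank_idem_res res_map idem_mx_idem).
apply: (natr_inj_pchar0 charK); rewrite -mxtrace_idem; last by rewrite -map_mxM idem_mx_idem.
rewrite /mxtrace (eq_bigr (fun=> n%:R / N%:R * n%:R)) => [|i _].
  by rewrite sumr_const card_ord natrM -[LHS]mulr_natl mulrA mulrCA mulfV ?mulr1.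
rewrite !mxE mulgV tofracw invg1 X1 mxtrace1; congr (_ * _).
by rewrite tofracMn tofrac1.
Qed.

(** Since [w] acts on the lattice as the identity, it does so on every submodule of the
    reduction. *)
Lemma mxrep_res_split (U : 'M[k]_n) (modU : mxmodule rk U) :
  \sum_g res (w g) *: submod_repr modU g = 1%:M.
Proof.
apply/row_matrixP => i; rewrite rowE row1.
apply: (can_inj (val_submodK (U := U))) => /=.
rewrite mulmx_sumr linear_sum /=.
transitivity (val_submod (delta_mx 0 i : 'rV_(\rank U)) *m map_mx res (RO w)); last first.
  by rewrite ROw map_mx1 mulmx1.
rewrite res_mxrep mulmx_sumr; apply: eq_bigr => g _.
rewrite -!scalemxAr linearZ /=; congr (_ *: _).
by rewrite -[resX res X g]/(rk g) -val_submodJ ?inE.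
Qed.

Lemma classically_exists (P : Prop) : classically P -> P.
Proof. by move=> cP; apply/boolp.asboolP/cP => p; apply/boolp.asboolP. Qed.

(* A simple submodule of the reduction of X has a character proportional to
   the reduction of the coefficients of the block idempotent w, because the
   centre of OGe is O e; hence its degree is at least n. *)
Lemma resX_irreducible : mx_absolutely_irreducible rk.
Proof.
have [V simV _] : exists2 V, mxsimple rk V & (V <= (1%:M)%R)%MS.
  apply: classically_exists; apply: mxsimple_exists; first exact: mxmodule1.
  by rewrite -mxrank_eq0 mxrank1 -lt0n.
have [modV V0 minV] := simV.
pose sub := submod_repr modV; pose r := \rank V.
have irrV : mx_absolutely_irreducible sub by apply: splitk; apply/submod_mx_irr.
have subM x y : sub (x * y)%g = sub x *m sub y by rewrite repr_mxM ?inE.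
pose th g := \tr (sub g).
have [sec secP] := boolp.choice res_map.1.
(* An arbitrary lift [sec] suffices: [z] is a class function because [th] is one, so its image in
   OGe is central and hence a scalar [c]. *)
pose z : galg O gT := [ffun g => sec (th g^-1%g)].
have thJ g h : th (g * h * g^-1)%g = th h.
  by rewrite /th -mulgA subM mxtrace_mulC -subM mulgKV.
have zw : exists c, z * w = c *: w.
  pose zz := corner_elt (galg_frac O gT) e z.
  have [|c zc] := @OGe_center _ _ _ _ X1 XM charK irrX e eE zz.
    move=> h _; apply: (OGe_mx_inj charK irrX eE).
    rewrite (OGe_mx_conj charK irrX eE) (OGe_mx_elt charK irrX eE) !mxrepE.
    rewrite mulmx_sumr mulmx_suml [RHS](reindex_inj (conjg_inj h^-1)%g) /=.
    apply: eq_bigr => g _; rewrite -scalemxAr -scalemxAl -!XM /conjg invgK mulgA !ffunE.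
    by congr (sec _ *: _); rewrite !invMg invgK mulgA thJ.
  exists c; apply: fracg_inj; have := congr1 val zc; rewrite !OGe_val -wE => E1.
  rewrite fracgZ -[LHS](_ : fracg z * fracg w = _); last exact/esym/rmorphM.
  by rewrite E1 fracgZ rmorph1 -scalerAl mul1r.
have [c zwc] := zw.
(* The coefficient of zw = cw at g is compared with the trace of sub(g^-1), rewritten using that [w]
   acts as the identity on [V]. *)
have thE g : th g^-1%g = res c * res (w g).
  have cwE : c * w g = \sum_h z h * w (h^-1 * g)%g by rewrite -galg_mulE zwc galg_scaleE.
  rewrite -rmorphM cwE rmorph_sum.
  transitivity (\sum_y res (w y) * th (y * g^-1)%g).
    have := congr1 (fun Y => \tr (Y *m sub g^-1%g)) (mxrep_res_split modV).
    rewrite mul1mx -/(th _) => <-; rewrite mulmx_suml raddf_sum; apply: eq_bigr => y _ /=.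
    by rewrite -scalemxAl mxtraceZ -subM.
  rewrite (reindex_inj (mulIg g)) (reindex_inj invg_inj) /=; apply: eq_bigr => h _.
  by rewrite mulgK ffunE rmorphM secP mulrC.
(* Otherwise the trace would vanish on the span of [sub], which is the full matrix algebra. *)
have c0 : res c != 0.
  apply/negP => /eqP c0; have /mx_abs_irrP[r0 [a aE]] := irrV.
  have := congr1 mxtrace (aE (delta_mx (Ordinal r0) (Ordinal r0))).
  rewrite raddf_sum /= big1 => [|g _].
    rewrite /mxtrace (bigD1 (Ordinal r0)) //= big1 => [|i /negPf ir]; last by rewrite mxE ir.
    by rewrite addr0 mxE !eqxx => /eqP; rewrite oner_eq0.
  by rewrite mxtraceZ -/(sub g) -/(th g) -[g]invgK thE c0 mul0r mulr0.
(* The matrix of the values [th] at products g_i g_j^-1 is [res c] times the reduced [idem_mx], of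
   rank n^2, and it factors through r x r matrices. *)
have le_n_r : (n * n <= r * r)%N.
  rewrite -mxrank_idem_mx -(mxrank_scale_nz _ c0).
  have := mxrank_trace_matrix gv (fun j => (gv j)^-1)%g subM; congr (\rank _ <= _)%N.
  by apply/matrixP => i j; rewrite !mxE -/(th _) -[(_ * _)%g]invgK thE invMg invgK.
have rn : r = n.
  by apply/eqP; rewrite eqn_leq rank_leq_col /= -leq_sqr -!mulnn.
have full : ((1%:M)%R <= V)%MS by rewrite sub1mx /row_full -/r rn.
apply: splitk; split; [exact: mxmodule1 | by rewrite -mxrank_eq0 mxrank1 -lt0n |].
by move=> U modU _ U0; apply: submx_trans full (minV U modU (submx_trans (submx1 U) full) U0).
Qed.

(** If every value reduced to 0, the trace would vanish on the span of the reduced representation,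
    which is the full matrix algebra over [k]. *)
Lemma unit_character_value : exists g, \tr (X g) \is a GRing.unit.
Proof.
apply: boolp.contrapT => no; have /mx_abs_irrP[r0 [a aE]] := resX_irreducible.
have := congr1 mxtrace (aE (delta_mx (Ordinal r0) (Ordinal r0))).
rewrite raddf_sum /= big1 => [|g _].
  rewrite /mxtrace (bigD1 (Ordinal r0)) //= big1 => [|i /negPf ir]; last by rewrite mxE ir.
  by rewrite addr0 mxE !eqxx => /eqP; rewrite oner_eq0.
rewrite mxtraceZ /= /resX trace_map_mx; apply/eqP; rewrite mulf_eq0; apply/orP; right.
by apply: boolp.contrapT => /negP ng; apply: no; exists g; rewrite (unit_res res_map).
Qed.

End IntegralIdempotentDegree.

(** * The ratio of the degree to the group order *)

Section DefectZeroCriterion.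
Variables (O : idomainType) (gT : finGroupType) (n : nat).
Local Notation K := {fraction O}.
Variable X : gT -> 'M[O]_n.
Hypothesis X1 : X 1%g = 1%:M.
Hypothesis XM : forall x y, X (x * y)%g = X x *m X y.
Hypothesis charK : [pchar K] =i pred0.
Hypothesis irrX : mx_absolutely_irreducible (fracX_rep X1 XM).
Variable e : pcidem (galg K gT).
Hypothesis eE : pcidem_val e = mxunrep (fracX_rep X1 XM) 1%:M.
Variables (k : fieldType) (res : {rmorphism O -> k}) (p : nat).
Hypothesis res_map : residue_map res.
Hypothesis char_k : p \in [pchar k].
Local Notation E := (OGe_elt e).

Let n0 : (0 < n)%N := abs_irr_n_gt0 irrX.
Let N0 : (0 < #|gT|)%N.
Proof. by apply/card_gt0P; exists 1%g. Qed.
Let NK : #|gT|%:R != 0 :> K := card_neq0 gT charK.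
Let nK : n%:R != 0 :> K := natn_neq0 charK irrX.

(** The element (|G|/n)e has the integral coefficients tr X(g^-1), and the scalar |G|/n by which it
    acts is an entry of an integral matrix. *)
Lemma degree_divides_card : exists d : O, #|gT|%:R = n%:R * d.
Proof.
pose v : galg O gT := [ffun g => \tr (X g^-1%g)].
have vE : fracg v = (#|gT|%:R / n%:R) *: pcidem_val e.
  apply/ffunP => g; rewrite fracgE ffunE galg_scaleE (pcidem_coef eE) mulrA.
  by rewrite [_ / _ * (_ / _)]mulrA divfK // mulfV // mul1r.
exists (mxrep X v (Ordinal n0) (Ordinal n0)); apply: tofrac_inj.
have := mxrep_frac X1 XM v; rewrite vE linearZ /= (mxrep_pcidem charK irrX eE).
move/matrixP/(_ (Ordinal n0) (Ordinal n0)); rewrite !mxE eqxx mulr1 => dE.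
by rewrite tofracM -dE !tofracMn tofrac1 mulrC divfK.
Qed.

(** The coefficient of e at g^-1 is (n/|G|) tr X(g). A unit value of the trace puts n/|G| in [O],
    and its inverse is integral by [degree_divides_card]. *)
Lemma degree_unit_ratio (w : galg O gT) : group_closure_field k gT ->
  fracg w = pcidem_val e -> exists2 u : O, u \is a GRing.unit & n%:R = #|gT|%:R * u.
Proof.
move=> splitk wE; have [g gU] := unit_character_value charK irrX eE res_map splitk wE.
have [d dE] := degree_divides_card.
have E1 : #|gT|%:R * w g^-1%g = n%:R * \tr (X g).
  apply: tofrac_inj; rewrite !tofracM -fracgE wE (pcidem_coef eE) invgK !tofracMn tofrac1.
  by rewrite mulrA mulrCA mulfV ?mulr1.
have nE : n%:R = #|gT|%:R * (w g^-1%g / \tr (X g)) by rewrite mulrA E1 mulrK.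
exists (w g^-1%g / \tr (X g)) => //; apply/unitrPr; exists d.
have nO : n%:R != 0 :> O by rewrite (natO_eq0 charK) -lt0n.
by apply: (mulfI nO); rewrite mulr1 mulrCA -dE mulrC -nE.
Qed.

Lemma trace_one_trivial_ratio (u : O) : n%:R = #|gT|%:R * u -> trace_one E 1%G.
Proof.
move=> nE; apply: (trace_one_trivial charK irrX eE (c := u)).
apply: (canRL (mulfK NK)); rewrite mulrC.
have := congr1 (@tofrac O) nE; rewrite tofracM !tofracMn tofrac1 => <- //.
Qed.

End DefectZeroCriterion.

Theorem theorem1p2
  (* the p-modular system (K, O, k), with K = Frac(O) *)
  (p : nat) (p_prime : prime p)
  (O : idomainType) (O_cdvr : complete_dvr O)
  (k : fieldType) (res : {rmorphism O -> k}) (res_map : residue_map res)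
  (char_k : p \in [pchar k]) (char_K : [pchar {fraction O}] =i pred0)
  (* the finite group G, identified with [set: gT] *)
  (gT : finGroupType)
  (splitK : group_closure_field {fraction O} gT)
  (splitk : group_closure_field k gT)
  (splitK2 : group_closure_field {fraction O} (gT * gT)%type)
  (splitk2 : group_closure_field k (gT * gT)%type)
  (* chi in Irr(G), and its idempotent e = e_chi *)
  (chi : gT -> {fraction O}) (chi_irr : irr_character chi)
  (e : pcidem (galg {fraction O} gT))
  (e_chi : galg_ext chi (pcidem_val e) != 0)
  (* the block B = OGb containing chi *)
  (b : pcidem (galg O gT))
  (b_chi : galg_frac O gT (pcidem_val b) * pcidem_val e = pcidem_val e)
  (* an OG-lattice L affording chi *)
  (L : lmodType (galg O gT)) (L_lattice : lattice L)
  (L_chi : affords L chi)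
  (* an anchor P of chi *)
  (P : {group gT}) (P_anchor : anchor e P) :
  (* (a) *)
  (exists D : {group gT}, block_defect_group b D /\ P \subset D) /\
  (* (b) *)
  (exists Q : {group gT}, vertex L Q /\ Q \subset P) /\
  (* (c) *)
  'O_p([set: gT])%g \subset P /\
  (* (d) *)
  (local_ring (OPe e P) /\ separable_extension (OPe_incl e P)) /\
  (* (e) *)
  (exists Q : {group gT * gT},
     vertex (OGe_bimod e) Q /\ diag_group P \subset Q) /\
  (exists Q : {group gT * gT},
     vertex (OGe_bimod e) Q /\ Q \subset setX P P) /\
  (vertex (OGe_bimod e) (diag_group P) <-> defect_zero p chi).
Proof.
have [pi pi_unif _] := O_cdvr.
have [m [rG [rG_irr rG_chi]]] := chi_irr.
have [n [v [X [v_basis vX X_chi]]]] := L_chi.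
have rG_abs : mx_absolutely_irreducible rG := splitK _ _ _ rG_irr.
have X1 : X 1%g = 1%:M := lattice_mx1 v_basis vX.
have XM x y : X (x * y)%g = X x *m X y by apply: (lattice_mxM v_basis vX).
have chi1 : chi 1%g = n%:R by rewrite X_chi X1 map_mx1 mxtrace1.
have mn : m = n.
  by apply: (natr_inj_pchar0 char_K); rewrite -chi1 rG_chi repr_mx1 mxtrace1.
subst m.
have X_tr g : \tr (fracX_rep X1 XM g) = \tr (rG g) by rewrite -rG_chi X_chi.
(* Irreducibility is known for [rG]; it passes to the representation given by the lattice because
   the characters agree. *)
have irrX := same_trace_abs_irr char_K rG_abs X_tr.
have eE : pcidem_val e = mxunrep (fracX_rep X1 XM) 1%:M.
  apply: (pcidem_mxunrep char_K irrX); rewrite mxtrace_mxrep.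
  rewrite -[X in X != 0](_ : galg_ext chi (pcidem_val e) = _) //.
  by apply: eq_bigr => g _; rewrite X_chi.
(* From be = e, and since e acts as the identity matrix, so does b. *)
have bX : mxrep X (pcidem_val b) = 1%:M.
  apply: map_frac_inj; rewrite map_mx1 -(mxrep_frac X1 XM).
  rewrite -(mxrep_mul_pcidem char_K irrX eE) fracg.unlock b_chi.
  exact: (mxrep_pcidem char_K irrX eE).
have elt1 := OGe_elt1 char_K irrX eE; have eltM := OGe_eltM char_K irrX eE.
have locE := OGe_local_fixed char_K irrX eE res_map.
have n0 : (0 < n)%N := abs_irr_n_gt0 irrX.
have pP : (p.-group P)%g := anchor_pgroup char_K irrX eE res_map p_prime char_k P_anchor.
have [tP minP] := P_anchor.
have [a [aP a1]] := trace_one_mx char_K irrX eE tP.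
have [a' a'P tra'] := tP.
have projPP : relatively_projective (OGe_bimod e) (setX_group P P).
  exact: higman_relatively_projective (bimod_higman_setX elt1 eltM a'P tra').
have [Q vQ sQPP] := minimal_subgroup_exists projPP.
have diagQ : exists z, diag_group P \subset (Q :^ z^-1)%G.
  have [phi phiP] := relatively_projective_higman vQ.1.
  exact: (diag_sub_conj elt1 eltM locE P_anchor phiP).
have small1 : trace_one (OGe_elt e) 1%G -> P = 1%G.
  move=> t1; have [z sP1] := defect_group_sub_conj elt1 eltM locE P_anchor t1.
  by apply/group_inj/trivgP; apply: subset_trans sP1 _; rewrite /= conjs1g.
have N0 : (0 < #|gT|)%N by apply/card_gt0P; exists 1%g.
have card_gT : #|[set: gT]| = #|gT| by rewrite cardsT.
split; last split; last split; last split; last split; last split.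
(* For (a), a trace decomposition of b maps to one of e, so [P] lies in a conjugate of the defect
   group [D0]. *)
- have [D0 defD0 _] := defect_group_exists (trace_oneT (block_elt1 b) (block_eltM b)).
  have [c [cD c1]] := block_trace_mx X1 XM bX defD0.1.
  have tD0 := mx_trace_one char_K irrX eE cD c1.
  have [z sPD] := defect_group_sub_conj elt1 eltM locE P_anchor tD0.
  exists (D0 :^ z^-1)%G; split=> //.
  exact: (defect_group_conj (block_eltM b) z defD0).
- have [Q' vQ' sQ'P] := minimal_subgroup_exists (higman_relatively_projective
  (lattice_higman v_basis vX aP a1)).
  by exists Q'.
- apply: (normal_pgroup_sub_anchor res char_k X1 XM n0 pP aP a1);
  [exact: pcore_pgroup | exact: pcore_normal].
- split; first exact: (OPe_local char_K irrX eE res_map char_k pP).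
  exact: (anchor_separable elt1 eltM a'P tra').
- by have [z sz] := diagQ; exists (Q :^ z^-1)%G; split=> //; apply: vertex_conj.
- by exists Q.
split=> [vD|[d [chi_d d_p]]].
  have [phi phiP] := relatively_projective_higman vD.1.
  have [psi [psiD psiZ psiT]] := bimod_left_higman char_K irrX eE phiP.
  have [w wE] := pcidem_integral char_K irrX eE pi_unif psiD psiZ psiT.
  have [u uU nE] := degree_unit_ratio char_K irrX eE res_map splitk wE.
  exists n; split=> //; rewrite card_gT.
  exact: (ppart_eq_of_unit_ratio res_map char_k char_K n0 N0 uU nE).
have dn : d = n by apply: (natr_inj_pchar0 char_K); rewrite -chi_d chi1.
rewrite {}dn card_gT in d_p.
(* Equal p-parts make n/|G| a unit, so [P] is trivial. Then P x P is trivial as well, and relative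
   projectivity to it makes the trivial group a vertex. *)
have [u uU nE] := ppart_unit_ratio res_map char_k n0 N0 d_p.
have P1 : P = 1%G := small1 (trace_one_trivial_ratio char_K irrX eE nE).
have X11 : setX_group P P = 1%G.
  apply/group_inj/trivgP/subsetP => -[x y]; rewrite P1 => /setXP[/= /set1P -> /set1P ->].
  exact: set11.
have diag1 : diag_group P = 1%G.
  apply/group_inj/trivgP/subsetP => y /imsetP[x xP ->]; move: xP; rewrite P1 => /set1P ->.
  exact: set11.
rewrite diag1; split; first by rewrite -X11.
by move=> Q' _ /trivgP.
Qed.
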